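(* There exists a non-linearizable germ $f(z)=e^{2\pi i\alpha}z+O(z^2)$ of holomorphic diffeomorphism fixing $0$, with $\alpha\in\mathbb{R}\setminus\mathbb{Q}$, together with a hedgehog $K$ of $f$ such that: (i) the impression of every prime end of $\hat{\mathbb{C}}\setminus K$ is all of $K$; (ii) the fixed point $0$ is inaccessible from $\hat{\mathbb{C}}\setminus K$.
   Context: A germ $f(z)=e^{2\pi i\alpha}z+O(z^2)$ with $\alpha\in\mathbb{R}\setminus\mathbb{Q}$ is linearizable if it is holomorphically conjugate near $0$ to $z\mapsto e^{2\pi i\alpha}z$, and non-linearizable otherwise. By a theorem of Perez-Marco, if $f$ is univalent on a neighbourhood of the closure of a Jordan domain $U\ni0$, there exist compact, connected, full sets $K\subset\overline{U}$ with $0\in K$, $K\cap\partial U\ne\emptyset$ and $f(K)=K=f^{-1}(K)$; for non-linearizable $f$ such a set $K\ne\{0\}$ is called a hedgehog. $\hat{\mathbb{C}}\setminus K$ is then a simply connected domain containing $\infty$; prime ends and their impressions are in the sense of Carathéodory. A point $p\in K$ is accessible from $\hat{\mathbb{C}}\setminus K$ if there is a continuous path $c:[0,1]\to\hat{\mathbb{C}}$ with $c([0,1))\subset\hat{\mathbb{C}}\setminus K$ and $c(1)=p$. *)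

(* Defs.v *)
(* mathcomp-analysis topology on the complex numbers R[i]
   (R : realType), with R[i] viewed as a normed space over itself, so that
   [derivable f z 1] is complex differentiability. *)
From HB Require Import structures.
From mathcomp Require Import all_boot all_order all_algebra.
From mathcomp Require Import complex.
From mathcomp Require Import all_classical all_reals all_analysis.
Import Order.TTheory GRing.Theory Num.Theory.
Import numFieldNormedType.Exports.

Set Implicit Arguments.
Unset Strict Implicit.
Unset Printing Implicit Defensive.

Local Open Scope classical_set_scope.
Local Open Scope ring_scope.

Definition Cplx (R : realType) : Type := R[i].
HB.instance Definition _ (R : realType) := Num.ClosedField.on (Cplx R).
HB.instance Definition _ (R : realType) :=
  PseudoPointedMetric.copy (Cplx R) (Cplx R)^o.
HB.instance Definition _ (R : realType) :=
  GRing.ComAlgebra.copy (Cplx R) (Cplx R)^o.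
HB.instance Definition _ (R : realType) := Vector.copy (Cplx R) (Cplx R)^o.
HB.instance Definition _ (R : realType) :=
  NormedModule.copy (Cplx R) (Cplx R)^o.

Section Defs.
Variable R : realType.
Local Notation C := (Cplx R).

Definition rot_mult (alpha : R) : C :=
  Complex (cos (2 * pi * alpha)) (sin (2 * pi * alpha)).

Definition rC (r : R) : C := Complex r 0.

Definition injective_on (T U : Type) (A : set T) (f : T -> U) : Prop :=
  forall x y, A x -> A y -> f x = f y -> x = y.

Definition holomorphic_on (V : set C) (f : C -> C) : Prop :=
  forall z, V z -> derivable f z 1.

Definition linearizable (f : C -> C) (lam : C) : Prop :=
  exists (h : C -> C) (r : R), 0 < r /\
    holomorphic_on (ball (0 : C) (rC r)) h /\
    injective_on (ball (0 : C) (rC r)) h /\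
    h 0 = 0 /\
    \forall z \near (0 : C), h (f z) = lam * h z.

Definition bdry (A : set C) : set C := closure A `\` interior A.

Definition jordan_domain (U : set C) : Prop :=
  exists gamma : R -> C,
    {within `[0, 1], continuous gamma} /\ gamma 0 = gamma 1 /\
    injective_on `[0, 1[%classic gamma /\
    exists x : C, ~ (gamma @` `[0, 1]) x /\
      U = connected_component (~` (gamma @` `[0, 1])) x /\
      bounded_set U.

(** K is full: its complement (in the sphere, equivalently in the plane,
    K being compact) is connected. *)
Definition full (K : set C) : Prop := connected (~` K).

(** Hedgehog of f relative to the Jordan domain U, with f univalent on the
    open neighbourhood V of closure U.  The preimage f^{-1}(K) is taken for
    f restricted to its domain of univalence V. *)
Definition hedgehog (f : C -> C) (U V : set C) (K : set C) : Prop :=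
  [/\ compact K, connected K, full K, K 0 & K `<=` closure U] /\
  [/\ K `&` bdry U !=set0, f @` K = K,
      [set z | V z /\ K (f z)] = K & K <> [set 0]].

Definition accessible (K : set C) (p : C) : Prop :=
  exists c : R -> C, {within `[0, 1], continuous c} /\
    (forall t, `[0, 1[%classic t -> ~ K (c t)) /\ c 1 = p.

Definition crosscut (Om : set C) (A : set C) : Prop :=
  exists gamma : R -> C,
    {within `[0, 1], continuous gamma} /\
    injective_on `]0, 1[%classic gamma /\
    A = gamma @` `]0, 1[%classic /\ A `<=` Om /\
    bdry Om (gamma 0) /\ bdry Om (gamma 1).

Definition separates (Om S A B : set C) : Prop :=
  A `<=` Om `\` S /\ B `<=` Om `\` S /\
  forall a b, A a -> B b -> ~ connected_component (Om `\` S) a b.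

(** Null chain of crosscuts (Pommerenke, Boundary behaviour of conformal
    maps, Sect. 2.4). *)
Definition null_chain (Om : set C) (Cn : nat -> set C) : Prop :=
  [/\ forall n, crosscut Om (Cn n),
      forall n, closure (Cn n) `&` closure (Cn n.+1) = set0,
      forall n, separates Om (Cn n.+1) (Cn 0%N) (Cn n.+2) &
      forall e : R, 0 < e -> \forall n \near \oo,
        forall x y, Cn n x -> Cn n y -> `|x - y| < rC e].

(** D_n : the component of Om \ C_n containing C_{n+1}. *)
Definition chain_domain (Om : set C) (Cn : nat -> set C) (n : nat) : set C :=
  \bigcup_(x in Cn n.+1) connected_component (Om `\` Cn n) x.

Definition impression (Om : set C) (Cn : nat -> set C) : set C :=
  \bigcap_(n in setT) closure (chain_domain Om Cn n).

End Defs.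

(* Main.v *)
Require Import Defs.
From HB Require Import structures.
From mathcomp Require Import all_boot all_order all_algebra.
From mathcomp Require Import complex ring lra zify.
From mathcomp Require Import all_classical all_reals all_analysis.
Import Order.TTheory GRing.Theory Num.Theory.
Import numFieldNormedType.Exports.

Set Implicit Arguments.
Unset Strict Implicit.
Unset Printing Implicit Defensive.

Local Open Scope classical_set_scope.
Local Open Scope ring_scope.

(* Anosov-Katok construction: [f] is the limit of maps [f_n] that are conjugate, by [H_n],
   to rotations of finite order [q_n] on discs [L_n = h_n (unit disc)], with [h_n] inverse to
   [H_n], and [K] is the intersection of the [L_n].  In the coordinate [H_n], the disc
   [L_(n+1)] is invariant under the rotation of order [q_(n+1)], almost dense in the unit
   disc, and avoids [q_(n+1)] spiral channels entering from the unit circle; each channel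
   winds around [0] and is almost dense as well.  In particular [K] has empty interior, which
   excludes a linearization: the linearizer would map orbit closures contained in [K] onto
   circles, of all small radii because [K] is connected.

   A path in the complement of [K] that enters the unit disc is confined between two arms of
   [L_m], [m] large, hence winds around [0]: unless it crosses the sector around the mouth
   of a given channel, it can neither get deep into the disc nor meet that channel
   (lemma [barrier]).  The image of this sector under [h_n] is small.  So a path staying near
   [0] cannot land at [0].  In a null chain, the channel whose mouth is near an end of
   [C_(i+1)] does not meet [C_i]; it lies in the domain cut off by [C_i] and is almost dense
   in [K], so all impressions contain [K]. *)

(** * Modulus and compactness in the plane *)

(** The obstacle is that a change of coordinates producing channels is violent, while the maps [f_n]
    must converge. The order of choices resolves it: [f_(n+1)] depends only on [H_n] and on the new
    angle, and is close to [f_n] because the angle moves by [1/q_(n+1)]. Only then is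
    [H_(n+1) = phi(H_n)/r] formed, where [phi] commutes with the rotations of order [q_(n+1)]; so
    [f_(n+1)] remains a rotation in the new coordinate, however large the distortion. [phi] is
    sought as z exp(g(z^q)/q), with z phi'/phi = D(z^q). Where D equals e^(i th), the preimages of
    circles under [phi] are spirals of slope cot(th). So D must be 1 at 0, close to e^(i th) near
    the channels and free of zeros on a large disc; a Runge argument yields such a polynomial. The
    maps [H_n] are only locally injective. Hence discs are described by inverse branches normalized
    at 0, and identities between them follow from uniqueness of lifts. Separation in the plane is
    reduced to one crossing lemma for paths in a logarithmic coordinate. *)

Section Modulus.
Variable R : realType.
Local Notation C := (Cplx R).

(** The norm of [Cplx R] takes its values in [Cplx R]; a real-valued modulus lets [lra] and [nra] do
    the estimates. *)
Definition nm (z : C) : R := Num.sqrt (complex.Re z ^+ 2 + complex.Im z ^+ 2).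

Lemma normE (z : C) : `|z| = rC (nm z). Proof. by case: z. Qed.

Lemma rC_inj : injective (@rC R). Proof. by move=> a b []. Qed.

Lemma rC_lt (a b : R) : (rC a < rC b) = (a < b).
Proof. by rewrite /rC ltcR. Qed.

Lemma rC_le (a b : R) : (rC a <= rC b) = (a <= b).
Proof. by rewrite /rC lecR. Qed.

Lemma rCD (a b : R) : rC (a + b) = rC a + rC b :> C.
Proof. by apply/eqP; rewrite eq_complex /= addr0 !eqxx. Qed.

Lemma rCM (a b : R) : rC (a * b) = rC a * rC b :> C.
Proof. by apply/eqP; rewrite eq_complex /= !(mulr0, mul0r, addr0, subr0) !eqxx. Qed.

Lemma rCN (a : R) : rC (- a) = - rC a :> C.
Proof. by apply/eqP; rewrite eq_complex /= oppr0 !eqxx. Qed.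

Lemma rC0 : rC 0 = 0 :> C. Proof. by []. Qed.
Lemma rC1 : rC 1 = 1 :> C. Proof. by []. Qed.

Lemma rCV (a : R) : rC (a^-1) = (rC a)^-1 :> C.
Proof.
have [->|a0] := eqVneq a 0; first by rewrite invr0 rC0 invr0.
have ra0 : rC a != 0 by apply: contra_neq a0 => /rC_inj.
by apply: (mulfI ra0); rewrite divff // -rCM divff.
Qed.

Lemma nm_norm_lt (z : C) (e : R) : (`|z| < rC e) = (nm z < e).
Proof. by rewrite normE rC_lt. Qed.

Lemma rC_gt0P (e : C) : 0 < e -> exists2 r : R, 0 < r & e = rC r.
Proof.
case: e => a b e0; exists a; move: e0; rewrite ltcE /=.
  by case/andP.
by case/andP=> /eqP -> _.
Qed.

Lemma nm_ge0 (z : C) : 0 <= nm z. Proof. exact: sqrtr_ge0. Qed.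

Lemma nmM (z w : C) : nm (z * w) = nm z * nm w.
Proof. by apply: rC_inj; rewrite rCM -!normE normrM. Qed.

Lemma nmD (z w : C) : nm (z + w) <= nm z + nm w.
Proof. by rewrite -rC_le rCD -!normE ler_normD. Qed.

Lemma nmN (z : C) : nm (- z) = nm z.
Proof. by apply: rC_inj; rewrite -!normE normrN. Qed.

Lemma nmB (z w : C) : nm (z - w) <= nm z + nm w.
Proof. by rewrite -(nmN w) nmD. Qed.

Lemma nmBC (z w : C) : nm (z - w) = nm (w - z).
Proof. by rewrite -nmN opprB. Qed.

Lemma nm0 : nm 0 = 0.
Proof. by apply: rC_inj; rewrite -normE normr0. Qed.

Lemma nm1 : nm 1 = 1.
Proof. by apply: rC_inj; rewrite -normE normr1. Qed.

Lemma nm_eq0 (z : C) : (nm z == 0) = (z == 0).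
Proof.
apply/eqP/eqP => [z0|->]; last exact: nm0.
by apply/eqP; rewrite -normr_eq0 normE z0.
Qed.

Lemma nm_gt0 (z : C) : (0 < nm z) = (z != 0).
Proof. by rewrite lt_def nm_ge0 andbT nm_eq0. Qed.

Lemma nmV (z : C) : nm (z^-1) = (nm z)^-1.
Proof. by apply: rC_inj; rewrite rCV -!normE normfV. Qed.

Lemma nmX (z : C) n : nm (z ^+ n) = nm z ^+ n.
Proof. by elim: n => [|n IH]; rewrite ?expr0 ?nm1 // !exprS nmM IH. Qed.

Lemma nm_rC (a : R) : nm (rC a) = `|a|.
Proof. by rewrite /nm /= expr0n addr0 sqrtr_sqr. Qed.

Lemma nm_subr_ge (z w : C) : nm z - nm w <= nm (z - w).
Proof. by rewrite lerBlDr; have := nmD (z - w) w; rewrite subrK. Qed.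

Lemma nm_dist (z w : C) : `|nm z - nm w| <= nm (z - w).
Proof.
have h1 := nm_subr_ge z w; have h2 := nm_subr_ge w z; rewrite nmBC in h2.
by rewrite ler_norml; apply/andP; split; lra.
Qed.

Lemma nm_tri (x y z : C) : nm (x - z) <= nm (x - y) + nm (y - z).
Proof. by have := nmD (x - y) (y - z); rewrite addrA subrK. Qed.

Lemma nm_lt_near (z w : C) (r : R) : nm (w - z) < r - nm z -> nm w < r.
Proof. by rewrite ltrBrDr; apply: le_lt_trans; have := nm_subr_ge w z; rewrite lerBlDr. Qed.

Lemma Re_le_nm (z : C) : `|complex.Re z| <= nm z.
Proof. by rewrite /nm -sqrtr_sqr ler_wsqrtr // lerDl sqr_ge0. Qed.

Lemma Im_le_nm (z : C) : `|complex.Im z| <= nm z.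
Proof. by rewrite /nm -sqrtr_sqr ler_wsqrtr // lerDr sqr_ge0. Qed.

Lemma nm_le_ReIm (z : C) : nm z <= `|complex.Re z| + `|complex.Im z|.
Proof.
rewrite -[leRHS]ger0_norm ?addr_ge0 // -sqrtr_sqr ler_wsqrtr //.
rewrite -(real_normK (num_real (complex.Re z))) -(real_normK (num_real (complex.Im z))).
by rewrite sqrrD; have := mulr_ge0 (normr_ge0 (complex.Re z)) (normr_ge0 (complex.Im z)); lra.
Qed.

Lemma nbhsCP (z : C) (A : set C) :
  nbhs z A <-> exists2 e : R, 0 < e & forall w, nm (w - z) < e -> A w.
Proof.
split=> [/nbhs_ballP [e e0 eA]|[e e0 eA]].
  have [r r0 er] := rC_gt0P e0; exists r => // w wz; apply: eA.
  by rewrite er; apply: (_ : `|z - w| < _); rewrite nm_norm_lt nmBC.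
apply/nbhs_ballP; exists (rC e); first by rewrite /= -rC0 rC_lt.
by move=> w h; apply: eA; move: h; rewrite /ball /= nm_norm_lt nmBC.
Qed.

Lemma ballCE (x : C) (e : R) y : ball x (rC e) y <-> nm (y - x) < e.
Proof. by rewrite /ball /= nm_norm_lt nmBC. Qed.

Lemma openCP (A : set C) :
  open A <-> forall z, A z -> exists2 e : R, 0 < e & forall w, nm (w - z) < e -> A w.
Proof.
rewrite openE; split=> [oA z /oA|oA z Az]; first by move/nbhsCP.
by apply/nbhsCP; exact: oA.
Qed.

Lemma closureCP (A : set C) z :
  closure A z <-> forall e : R, 0 < e -> exists2 w, A w & nm (w - z) < e.
Proof.
split=> [cA e e0|h B /nbhsCP [e e0 eB]].
  have [|w [Aw wz]] := cA [set w | nm (w - z) < e]; last by exists w.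
  by apply/nbhsCP; exists e.
by have [w Aw wz] := h e e0; exists w; split => //; exact: eB.
Qed.

Lemma closedCP (A : set C) :
  closed A <-> forall z, (forall e : R, 0 < e -> exists2 w, A w & nm (w - z) < e) -> A z.
Proof.
split=> [cA z h|h z /closureCP]; first by apply: cA; apply/closureCP.
exact: h.
Qed.

(** Continuity in epsilon-delta form. [cconton] tests only points of [A], which suits inverse
    branches: they come from a choice and are arbitrary outside a disc. *)
Definition ccont (f : C -> C) (z : C) := forall e : R, 0 < e ->
  exists2 d : R, 0 < d & forall w, nm (w - z) < d -> nm (f w - f z) < e.

Definition cconton (A : C -> Prop) (f : C -> C) := forall z, A z -> forall e : R, 0 < e ->
  exists2 d : R, 0 < d & forall w, A w -> nm (w - z) < d -> nm (f w - f z) < e.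

Definition pconton (a b : R) (g : R -> C) := forall t, a <= t <= b -> forall e : R, 0 < e ->
  exists2 d : R, 0 < d & forall s, a <= s <= b -> `|s - t| < d -> nm (g s - g t) < e.


Lemma pcontonP (a b : R) (g : R -> C) : {within `[a, b], continuous g} <-> pconton a b g.
Proof.
split=> [/subspace_continuousP cg t tab e e0|h].
  have tab' : `[a, b]%classic t by rewrite /= in_itv.
  have /cvgrPdist_lt := cg t tab'; move=> /(_ (rC e)); rewrite -{1}rC0 rC_lt => /(_ e0).
  move=> /nbhs_ballP [d d0 hd]; exists d => // s sab st.
  have := hd s; rewrite /ball /= distrC => /(_ st); rewrite in_itv /= => /(_ sab).
  by rewrite nm_norm_lt nmBC.
apply/subspace_continuousP => t; rewrite /= in_itv /= => tab.
apply/cvgrPdist_lt => _/rC_gt0P [e e0 ->].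
have [d d0 hd] := h t tab e e0.
apply/nbhs_ballP; exists d => // s; rewrite /ball /= distrC => st.
by rewrite in_itv /= => sab; rewrite nm_norm_lt nmBC; exact: hd.
Qed.

Lemma ccontP (f : C -> C) z : {for z, continuous f} <-> ccont f z.
Proof.
split=> [cf e e0|h].
  have := (@cvgrPdist_lt C C C (nbhs z) (nbhs_filter z) f (f z)).1 cf (rC e).
  rewrite -{1}rC0 rC_lt => /(_ e0) /nbhsCP [d d0 hd]; exists d => // w wz.
  by have := hd w wz; rewrite nm_norm_lt nmBC.
apply/(@cvgrPdist_lt C C C (nbhs z) (nbhs_filter z) f (f z)) => _/rC_gt0P [e e0 ->].
have [d d0 hd] := h e e0; apply/nbhsCP; exists d => // w wz.
by rewrite nm_norm_lt nmBC; exact: hd.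
Qed.

Definition disc (r : R) : set C := [set z | nm z <= r].

Lemma compact_disc (r : R) : compact (disc r).
Proof.
have cbox : compact (`[- r, r] `*` `[- r, r] : set (R * R)).
  by apply: compact_setX; exact: segment_compact.
pose g (p : R * R) : C := Complex p.1 p.2.
have cg : {within (`[- r, r] `*` `[- r, r] : set (R * R)), continuous g}.
  apply: continuous_subspaceT => p; apply/cvgrPdist_lt => _/rC_gt0P [e e0 ->].
  have e20 : 0 < e / 2 by lra.
  exists (ball p.1 (e / 2), ball p.2 (e / 2)) => /=.
    by split; apply: nbhsx_ballx.
  move=> q [] /=; rewrite /ball /= => h1 h2; rewrite nm_norm_lt.
  by apply: le_lt_trans (nm_le_ReIm _) _ => /=; lra.
have cb := continuous_compact cg cbox.
apply: (subclosed_compact _ cb).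
  apply/closedCP => z h; rewrite /disc /=; rewrite leNgt; apply/negP => rz.
  have [w wr wz] := h (nm z - r) ltac:(lra).
  by have := nm_subr_ge z w; rewrite nmBC => ?; rewrite /disc /= in wr; lra.
move=> z zr; exists (complex.Re z, complex.Im z); last by case: z {zr}.
have h1 := Re_le_nm z; have h2 := Im_le_nm z; rewrite /disc /= in zr.
by split; rewrite /= in_itv /=; move: h1 h2; rewrite !ler_norml; lra.
Qed.

(** Compactness as a principle of uniform scale, from near coverings and the filter of positive [d]
    near 0. The uniform constants over compact sets below come from it or from its interval
    version. *)
Lemma cpt_unif (A : set C) (P : R -> C -> Prop) : compact A ->
  (forall d d' x, 0 < d' -> d' <= d -> P d x -> P d' x) ->
  (forall x, A x -> exists2 e : R, 0 < e & exists2 d : R, 0 < d &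
     forall y, A y -> nm (y - x) < e -> P d y) ->
  exists2 d : R, 0 < d & forall x, A x -> P d x.
Proof.
move=> /compact_near_coveringP cA mono loc.
have [x Ax|e e0 he] := cA R (0^'+) (fun d x => A x -> P d x) _.
- have [e e0 [d d0 h]] := loc x Ax.
  exists ([set y | nm (y - x) < e], [set d' | 0 < d' <= d]) => /=.
    split; first by apply/nbhsCP; exists e.
    apply/nbhs_ballP; exists d => // d'; rewrite /ball /= sub0r normrN => h1 h2 /=.
    by rewrite h2 /=; apply: ltW; apply: le_lt_trans h1; rewrite ler_norm.
  move=> [y d'] /= [yx /andP[d'0 d'd]] Ay; apply: (mono d) => //; exact: h.
- exists (e / 2); first by rewrite /= in e0; lra.
  move=> x Ax; apply: (he (e / 2)) => //=; rewrite /= in e0.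
    by rewrite /ball /= sub0r normrN gtr0_norm; lra.
  lra.
Qed.

Lemma itv_unif (a b : R) (P : R -> R -> Prop) :
  (forall d d' x, 0 < d' -> d' <= d -> P d x -> P d' x) ->
  (forall x, a <= x <= b -> exists2 e : R, 0 < e & exists2 d : R, 0 < d &
     forall y, a <= y <= b -> `|y - x| < e -> P d y) ->
  exists2 d : R, 0 < d & forall x, a <= x <= b -> P d x.
Proof.
have /compact_near_coveringP cA := @segment_compact R a b.
move=> mono loc.
have [x|e e0 he] := cA R (0^'+) (fun d x => a <= x <= b -> P d x) _.
- rewrite /= in_itv /= => Ax; have [e e0 [d d0 h]] := loc x Ax.
  exists ([set y | `|y - x| < e], [set d' | 0 < d' <= d]) => /=.
    split; first by apply/nbhs_ballP; exists e => // y; rewrite /ball /= distrC.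
    apply/nbhs_ballP; exists d => // d'; rewrite /ball /= sub0r normrN => h1 h2 /=.
    by rewrite h2 /=; apply: ltW; apply: le_lt_trans h1; rewrite ler_norm.
  move=> [y d'] /= [yx /andP[d'0 d'd]] Ay; apply: (mono d) => //; exact: h.
- exists (e / 2); first by rewrite /= in e0; lra.
  move=> x Ax; apply: (he (e / 2)) => //=; rewrite /= in e0.
  + by rewrite /ball /= sub0r normrN gtr0_norm; lra.
  + lra.
Qed.

Lemma cconton_unif (A B : set C) (f : C -> C) (e : R) : compact A -> 0 < e ->
  (forall z, A z -> exists2 d : R, 0 < d & forall w, nm (w - z) < d -> B w) ->
  cconton B f ->
  exists2 d : R, 0 < d & forall z w, A z -> nm (w - z) < d -> nm (f w - f z) < e.
Proof.
move=> cA e0 AB cf.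
suff [d d0 h] : exists2 d : R, 0 < d & forall z, A z ->
    forall w, nm (w - z) < d -> nm (f w - f z) < e.
  by exists d => // z w Az; apply: h.
apply: (@cpt_unif A (fun d z => forall w, nm (w - z) < d -> nm (f w - f z) < e) cA) => [d d' x d'0 d'd h w wx|x Ax].
  by apply: h; apply: lt_le_trans wx d'd.
have e20 : 0 < e / 2 by lra.
have [d1 d10 h1] := AB x Ax; have Bx : B x by apply: h1; rewrite subrr nm0.
have [d2 d20 h2] := cf x Bx _ e20.
pose d := Num.min d1 d2.
have d0 : 0 < d by rewrite lt_min d10 d20.
have [dd1 dd2] : d <= d1 /\ d <= d2 by rewrite !ge_min !lexx orbT.
exists (d / 2); first lra; exists (d / 2); first lra.
move=> y Ay yx w wy.
have wx : nm (w - x) < d by have := nm_tri w y x; lra.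
have hw := h2 w (h1 w (lt_le_trans wx dd1)) (lt_le_trans wx dd2).
have yx' : nm (y - x) < d by have := nm_ge0 (y - x); lra.
have hy := h2 y (h1 y (lt_le_trans yx' dd1)) (lt_le_trans yx' dd2).
by have := nm_tri (f w) (f x) (f y); rewrite (nmBC (f x)); lra.
Qed.

Lemma pconton_unif (a b e : R) (g : R -> C) : 0 < e -> pconton a b g ->
  exists2 d : R, 0 < d & forall s t, a <= s <= b -> a <= t <= b -> `|s - t| < d ->
    nm (g s - g t) < e.
Proof.
move=> e0 cg.
have [|x xab|d d0 h] := @itv_unif a b (fun d t => forall s, a <= s <= b -> `|s - t| < d ->
    nm (g s - g t) < e).
- by move=> d d' x d'0 d'd h w wab wx; apply: h => //; apply: lt_le_trans wx d'd.
- have e20 : 0 < e / 2 by lra.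
  have [d d0 h] := cg x xab _ e20.
  exists (d / 2); first lra; exists (d / 2); first lra.
  move=> y yab yx w wab wy.
  have wx : `|w - x| < d by have := ler_distD y w x; lra.
  have hw := h w wab wx; have hy := h y yab ltac:(have := normr_ge0 (y - x); lra).
  by have := nm_tri (g w) (g x) (g y); rewrite (nmBC (g x)); lra.
by exists d => // s t sab tab st; apply: h.
Qed.

Lemma cpt_bounded (A : set C) (f : C -> C) : compact A -> cconton A f ->
  exists2 M : R, 0 < M & forall z, A z -> nm (f z) <= M.
Proof.
move=> cA cf.
have [|x Ax|d d0 h] := @cpt_unif A (fun d z => nm (f z) <= d^-1) cA.
- by move=> d d' x d'0 d'd h; apply: le_trans h _; rewrite lef_pV2 // posrE; lra.
- have [d d0 h] := cf x Ax 1 ltr01.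
  exists d => //; exists (nm (f x) + 1)^-1; first by rewrite invr_gt0; have := nm_ge0 (f x); lra.
  by move=> y Ay yx; rewrite invrK; have := h y Ay yx; have := nm_subr_ge (f y) (f x); lra.
- by exists d^-1 => //; rewrite invr_gt0.
Qed.

Lemma cpt_away0 (A : set C) (f : C -> C) : compact A -> cconton A f ->
  (forall z, A z -> f z != 0) ->
  exists2 m : R, 0 < m & forall z, A z -> m <= nm (f z).
Proof.
move=> cA cf f0.
apply: (@cpt_unif A (fun d z => d <= nm (f z)) cA) => [d d' x d'0 d'd h|x Ax].
  exact: le_trans d'd h.
have fx0 : 0 < nm (f x) by rewrite nm_gt0 f0.
have [d d0 h] := cf x Ax (nm (f x) / 2) ltac:(lra).
exists d => //; exists (nm (f x) / 2); first lra.
by move=> y Ay yx; have := h y Ay yx; have := nm_subr_ge (f x) (f y); rewrite nmBC; lra.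
Qed.

(** If the infimum [m] were not attained, [cpt_unif] would give a [d] with [m + d] still a lower
    bound. *)
Lemma cpt_argmin (A : set C) (f : C -> C) : compact A -> cconton A f -> A !=set0 ->
  exists2 z, A z & forall w, A w -> nm (f z) <= nm (f w).
Proof.
move=> cA cf [a Aa].
pose S := [set nm (f z) | z in A].
have S0 : S !=set0 by exists (nm (f a)); exists a.
have Slb : has_lbound S by exists 0 => _ [z _ <-]; exact: nm_ge0.
pose m := inf S.
have mle z : A z -> m <= nm (f z) by move=> Az; apply: ge_inf => //; exists z.
have [[z Az zm]|nz] := pselect (exists2 z, A z & nm (f z) = m).
  by exists z => // w Aw; rewrite zm mle.
have [|x Ax|d d0 h] := @cpt_unif A (fun d z => m + d <= nm (f z)) cA.
- by move=> d d' x _ d'd h; lra.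
- have mx : m < nm (f x).
    by rewrite lt_neqAle mle // andbT; apply/eqP => h; apply: nz; exists x.
  have [d d0 h] := cf x Ax ((nm (f x) - m) / 2) ltac:(lra).
  exists d => //; exists ((nm (f x) - m) / 2); first lra.
  by move=> y Ay yx; have := h y Ay yx; have := nm_subr_ge (f x) (f y); rewrite nmBC; lra.
- have : m + d <= inf S by apply: lb_le_inf => // _ [z Az <-]; exact: h.
  rewrite -/m; lra.
Qed.

Lemma ccont_on (A : set C) (f : C -> C) : (forall z, A z -> ccont f z) -> cconton A f.
Proof.
move=> cf z Az e e0; have [d d0 h] := cf z Az e e0.
by exists d => // w _; apply: h.
Qed.

Lemma cconton_sub (A B : set C) (f : C -> C) : A `<=` B -> cconton B f -> cconton A f.
Proof.
move=> AB cf z Az e e0; have [d d0 h] := cf z (AB _ Az) e e0.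
by exists d => // w Aw; apply: h; apply: AB.
Qed.

End Modulus.

(** * Complex differentiation *)

Section Calculus.
Variable R : realType.
Local Notation C := (Cplx R).
Implicit Types (f g : C -> C) (z w d : C).

(** Real induction: the supremum of the points up to which [P] holds satisfies [P] by the limit
    hypothesis, and must be [b] by the extension hypothesis. *)
Lemma real_ind (a b : R) (P : R -> Prop) : a <= b -> P a ->
  (forall t, a <= t < b -> P t -> exists2 t', t < t' & forall s, t <= s <= t' -> s <= b -> P s) ->
  (forall t, a < t <= b -> (forall s, a <= s < t -> P s) -> P t) ->
  forall t, a <= t <= b -> P t.
Proof.
move=> ab Pa op cl.
pose S := [set t | a <= t <= b /\ forall s, a <= s <= t -> P s].
have Sa : S a.
  split; first by rewrite lexx.
  by move=> s /andP[h1 h2]; have -> : s = a by apply/eqP; rewrite eq_le h1 h2.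
have Sub : has_ubound S by exists b => t [/andP[]].
pose c := sup S.
have ac : a <= c by apply: ub_le_sup.
have cb : c <= b by apply: ge_sup; [exists a|move=> t [/andP[]]].
have Plt s : a <= s < c -> P s.
  move=> /andP[as_ sc]; have [|t [_ ht] st] := sup_adherent (eps := c - s) _ (conj (ex_intro _ a Sa) Sub).
    lra.
  by apply: ht; rewrite as_ /=; move: st; rewrite -/c; lra.
have Pc : P c.
  have [<- //|nac] := eqVneq a c.
  by apply: cl => //; rewrite cb andbT lt_neqAle nac.
have Sc : S c.
  split; first by rewrite ac cb.
  move=> s /andP[h1]; rewrite le_eqVlt => /orP[/eqP -> //|h2].
  by apply: Plt; rewrite h1.
have [ecb|ncb] := eqVneq c b; first by move=> t; rewrite -ecb; exact: Sc.2.
have cltb : c < b by rewrite lt_neqAle ncb.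
have [|t' ct' ht'] := op c _ Pc; first by rewrite ac.
pose m := Num.min t' b.
have cm : c < m by rewrite lt_min ct' cltb.
have [mt' mb] : m <= t' /\ m <= b by rewrite !ge_min !lexx orbT.
suff Sm : S m by have : m <= c by [apply: ub_le_sup]; lra.
split; first by rewrite mb andbT; lra.
move=> s /andP[h1 h2]; have [sc|sc] := leP s c; first by apply: Sc.2; rewrite h1.
by apply: ht'; lra.
Qed.

Definition hasder f z d := forall e : R, 0 < e -> exists2 r : R, 0 < r &
  forall w, nm (w - z) < r -> nm (f w - f z - d * (w - z)) <= e * nm (w - z).

Lemma ccont_cst c z : ccont (fun=> c) z.
Proof. by move=> e e0; exists 1 => // w _; rewrite subrr nm0. Qed.

Lemma ccont_id z : ccont id z.
Proof. by move=> e e0; exists e. Qed.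

Lemma ccontD f g z : ccont f z -> ccont g z -> ccont (fun w => f w + g w) z.
Proof. by move=> /ccontP hf /ccontP hg; apply/ccontP; exact: cvgD hf hg. Qed.

Lemma ccontM f g z : ccont f z -> ccont g z -> ccont (fun w => f w * g w) z.
Proof. by move=> /ccontP hf /ccontP hg; apply/ccontP; exact: (@cvgM C C (nbhs z) _ f g _ _ hf hg). Qed.

Lemma ccont_comp f g z : ccont f z -> ccont g (f z) -> ccont (fun w => g (f w)) z.
Proof.
move=> hf hg e e0; have [d d0 h] := hg e e0; have [r r0 h'] := hf d d0.
by exists r => // w wz; apply: h; apply: h'.
Qed.

Lemma ccontX f z n : ccont f z -> ccont (fun w => f w ^+ n) z.
Proof.
move=> hf; elim: n => [|n IH]; first exact: ccont_cst.
by have := ccontM hf IH; congr (ccont _ z); apply/funext => w; rewrite exprS.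
Qed.

Lemma ccont_ext f g z : (forall w, f w = g w) -> ccont f z -> ccont g z.
Proof. by move=> /funext ->. Qed.

Lemma ccont_horner (p : {poly C}) z : ccont (horner p) z.
Proof.
elim/poly_ind: p => [|p c IH].
  by apply: ccont_ext (ccont_cst 0 z) => w; rewrite horner0.
apply: ccont_ext (ccontD (ccontM IH (ccont_id z)) (ccont_cst c z)) => w.
by rewrite !hornerE.
Qed.

(** Caratheodory's form of the derivative: the slope [q] is continuous at [z]. Sums, products,
    compositions and implicit functions then reduce to algebra on slopes. *)
Lemma hasderP f z d : hasder f z d <->
  exists q, [/\ ccont q z, q z = d & forall w, f w = f z + q w * (w - z)].
Proof.
split=> [hf|[q [cq <- fq]] e e0].
  exists (fun w => if w == z then d else (f w - f z) / (w - z)); split.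
  - move=> e e0; have e20 : 0 < e / 2 by lra.
    have [r r0 h] := hf _ e20; exists r => // w wz; rewrite eqxx.
    have [_|wnz] := eqVneq w z; first by rewrite subrr nm0.
    have wz0 : w - z != 0 by rewrite subr_eq0.
    have -> : (f w - f z) / (w - z) - d = (f w - f z - d * (w - z)) / (w - z) by field.
    rewrite nmM nmV ltr_pdivrMr ?nm_gt0 //; apply: le_lt_trans (h w wz) _.
    by rewrite ltr_pM2r ?nm_gt0 //; lra.
  - by rewrite eqxx.
  - move=> w; have [->|wnz] := eqVneq w z; first by rewrite subrr mulr0 addr0.
    by rewrite divfK ?subr_eq0 // addrC subrK.
have [r r0 h] := cq e e0; exists r => // w wz; rewrite fq.
have -> : f z + q w * (w - z) - f z - q z * (w - z) = (q w - q z) * (w - z) by ring.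
by rewrite nmM ler_wpM2r ?nm_ge0 // ltW // h.
Qed.

Lemma hasder_ccont f z d : hasder f z d -> ccont f z.
Proof.
move/hasderP => [q [cq _ fq]].
apply: ccont_ext (ccontD (ccont_cst (f z) z) (ccontM cq (ccontD (ccont_id z) (ccont_cst (- z) z)))) => w.
by rewrite -fq.
Qed.

Lemma hasder_cst c z : hasder (fun=> c) z 0.
Proof. by apply/hasderP; exists (fun=> 0); split=> [|//|w]; [exact: ccont_cst|rewrite mul0r addr0]. Qed.

Lemma hasder_id z : hasder id z 1.
Proof. by apply/hasderP; exists (fun=> 1); split=> [|//|w]; [exact: ccont_cst|rewrite mul1r addrC subrK]. Qed.

Lemma hasderD f g z a b : hasder f z a -> hasder g z b -> hasder (fun w => f w + g w) z (a + b).
Proof.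
move=> /hasderP[p [cp <- fp]] /hasderP[q [cq <- gq]]; apply/hasderP.
exists (fun w => p w + q w); split => [|//|w]; first exact: ccontD.
rewrite {1}fp {1}gq; ring.
Qed.

Lemma hasderM f g z a b : hasder f z a -> hasder g z b ->
  hasder (fun w => f w * g w) z (a * g z + f z * b).
Proof.
move=> hf hg; have cg := hasder_ccont hg; move: hf hg.
move=> /hasderP[p [cp <- fp]] /hasderP[q [cq <- gq]]; apply/hasderP.
exists (fun w => p w * g w + f z * q w); split => [|//|w].
  exact: ccontD (ccontM cp cg) (ccontM (ccont_cst _ _) cq).
have gw := gq w; set G := g w in gw *; rewrite fp gw; ring.
Qed.

Lemma hasder_comp f g z a b : hasder f z a -> hasder g (f z) b ->
  hasder (fun w => g (f w)) z (b * a).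
Proof.
move=> hf hg; have cf := hasder_ccont hf; move: hf hg.
move=> /hasderP[p [cp <- fp]] /hasderP[q [cq <- gq]]; apply/hasderP.
exists (fun w => q (f w) * p w); split => [|//|w].
  exact: ccontM (ccont_comp cf cq) cp.
have fw : f w - f z = p w * (w - z) by rewrite {1}(fp w); ring.
by rewrite gq fw mulrA.
Qed.

Lemma hasder_ext f g z d : (forall w, f w = g w) -> hasder f z d -> hasder g z d.
Proof. by move=> /funext ->. Qed.

Lemma hasder_horner (p : {poly C}) z : hasder (horner p) z (p^`().[z]).
Proof.
elim/poly_ind: p => [|p c IH].
  by rewrite deriv0 horner0; apply: hasder_ext (hasder_cst 0 z) => w; rewrite horner0.
rewrite derivMXaddC hornerD hornerMX.
have -> : p.[z] + p^`().[z] * z = p^`().[z] * id z + p.[z] * 1 + 0 by rewrite /=; ring.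
apply: hasder_ext (hasderD (hasderM IH (hasder_id z)) (hasder_cst c z)) => w.
by rewrite hornerD hornerMX hornerC.
Qed.

Lemma hasder_uniq f z a b : hasder f z a -> hasder f z b -> a = b.
Proof.
move=> ha hb; apply/eqP; rewrite -subr_eq0 -nm_eq0 eq_le nm_ge0 andbT leNgt; apply/negP => ab0.
set s := nm (a - b) in ab0.
have [r1 r10 h1] := ha (s / 4) ltac:(lra).
have [r2 r20 h2] := hb (s / 4) ltac:(lra).
pose r := Num.min r1 r2.
have r0 : 0 < r by rewrite lt_min r10 r20.
have [rr1 rr2] : r <= r1 /\ r <= r2 by rewrite !ge_min !lexx orbT.
pose w := z + rC (r / 2).
have wz : w - z = rC (r / 2) by rewrite /w addrAC subrr add0r.
have nwz : nm (w - z) = r / 2 by rewrite wz nm_rC gtr0_norm; lra.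
have := h1 w; rewrite nwz => /(_ ltac:(lra)) k1.
have := h2 w; rewrite nwz => /(_ ltac:(lra)) k2.
have : nm ((a - b) * (w - z)) <= s / 4 * (r / 2) + s / 4 * (r / 2).
  have -> : (a - b) * (w - z) = (f w - f z - b * (w - z)) - (f w - f z - a * (w - z)) by ring.
  by apply: le_trans (nmB _ _) _; lra.
rewrite nmM nwz -/s; nra.
Qed.

Lemma hasder_derive f z d : hasder f z d -> is_derive (z : C) (1 : C) (f : C -> C) d.
Proof.
move=> hf.
suff h : h^-1 *: ((f \o shift z) (h *: (1 : C)) - f z) @[h --> (0:C)^'] --> d.
  split; last exact/cvg_lim.
  by apply: cvgP h.
apply/cvgrPdist_lt => _/rC_gt0P [e e0 ->].
have [r r0 hr] := hf (e / 2) ltac:(lra).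
apply/nbhsCP; exists r => // w; rewrite subr0 => wr w0.
rewrite nm_norm_lt /=.
have -> : d - w^-1 *: (f (w *: (1 : C) + z) - f z) = - (w^-1 * (f (w + z) - f z - d * (w + z - z))).
  rewrite /GRing.scale /= mulr1; rewrite addrK; field; exact: w0.
rewrite nmN nmM nmV mulrC ltr_pdivrMr ?nm_gt0 //.
have := hr (w + z); rewrite addrK => /(_ wr) h; apply: le_lt_trans h _.
by rewrite ltr_pM2r ?nm_gt0 //; lra.
Qed.

Lemma derivable_ccont f z : derivable f z (1 : C) -> ccont f z.
Proof.
move=> df; apply/ccontP.
by apply: differentiable_continuous; apply/derivable1_diffP.
Qed.

Definition segp (a b : C) (t : R) : C := a + rC t * (b - a).

Lemma segp0 a b : segp a b 0 = a. Proof. by rewrite /segp rC0 mul0r addr0. Qed.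
Lemma segp1 a b : segp a b 1 = b. Proof. by rewrite /segp rC1 mul1r addrC subrK. Qed.

Lemma segpB a b s t : segp a b s - segp a b t = rC (s - t) * (b - a).
Proof. by rewrite /segp rCD rCN; ring. Qed.

Lemma nm_segp a b t M : 0 <= t <= 1 -> nm a <= M -> nm b <= M -> nm (segp a b t) <= M.
Proof.
move=> /andP[t0 t1] aM bM.
have -> : segp a b t = rC (1 - t) * a + rC t * b by rewrite /segp rCD rCN rC1; ring.
apply: le_trans (nmD _ _) _; rewrite !nmM !nm_rC !ger0_norm //; nra.
Qed.

(** A complex function has no mean value point in general, so the inequality is propagated along the
    segment by real induction. The slope is relaxed to [M + e'], with [e'] chosen to cost at most
    [e] in total. *)
Lemma mvt_seg f a b (M : R) :
  (forall t, 0 <= t <= 1 -> exists2 d, hasder f (segp a b t) d & nm d <= M) ->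
  nm (f b - f a) <= M * nm (b - a).
Proof.
move=> hf; apply/ler_addgt0Pr => e e0.
pose L := nm (b - a); have L0 : 0 <= L := nm_ge0 _.
pose e' := e / (L + 1).
have e'0 : 0 < e' by rewrite divr_gt0 //; lra.
have Le : L * e' <= e.
  rewrite /e' mulrA ler_pdivrMr; nra.
suff : nm (f (segp a b 1) - f a) <= (M + e') * L * 1.
  by rewrite segp1 mulr1 => h; apply: le_trans h _; rewrite -/L; lra.
apply: (@real_ind 0 1 (fun t => nm (f (segp a b t) - f a) <= (M + e') * L * t)) => //.
- by rewrite segp0 subrr nm0 mulr0.
- move=> t /andP[t0 t1] Pt; have [|d hd dM] := hf t; first by rewrite t0 ltW.
  have [r r0 h] := hd e' e'0.
  exists (t + r / (2 * (L + 1))); first by rewrite ltrDl divr_gt0 //; lra.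
  move=> s /andP[ts st] s1.
  have stL : (s - t) * (2 * (L + 1)) <= r.
    by rewrite -ler_pdivlMr; lra.
  have nst : nm (segp a b s - segp a b t) = (s - t) * L.
    by rewrite segpB nmM nm_rC ger0_norm //; lra.
  have hr : nm (segp a b s - segp a b t) < r by rewrite nst; nra.
  have := h _ hr; rewrite nst => h1.
  have h2 : nm (d * (segp a b s - segp a b t)) <= M * ((s - t) * L).
    by rewrite nmM nst ler_wpM2r //; nra.
  have -> : f (segp a b s) - f a = (f (segp a b s) - f (segp a b t) - d * (segp a b s - segp a b t))
     + d * (segp a b s - segp a b t) + (f (segp a b t) - f a) by ring.
  apply: le_trans (nmD _ _) _; apply: le_trans (lerD (nmD _ _) (lexx _)) _.
  by move: h1 h2 Pt => /=; lra.
- move=> t /andP[t0 t1] Pt; apply/ler_addgt0Pr => k k0.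
  have [|d hd dM] := hf t; first by rewrite t1 ltW.
  have [r r0 h] := hasder_ccont hd k0.
  pose u := Num.min t (r / (2 * (L + 1))).
  have rL0 : 0 < r / (2 * (L + 1)) by rewrite divr_gt0 //; lra.
  have u0 : 0 < u by rewrite lt_min t0 rL0.
  have [ut ur] : u <= t /\ u <= r / (2 * (L + 1)) by rewrite !ge_min !lexx orbT.
  have uL : u * (2 * (L + 1)) <= r by rewrite -ler_pdivlMr //; lra.
  have := Pt (t - u) ltac:(lra) => P1.
  have := h (segp a b (t - u)); rewrite segpB nmM nm_rC -/L.
  have -> : t - u - t = - u by ring.
  rewrite normrN gtr0_norm // => /(_ ltac:(nra)) h1.
  have := nm_tri (f (segp a b t)) (f (segp a b (t - u))) (f a); rewrite (nmBC (f (segp a b t)) (f (segp a b (t - u)))).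
  have M0 : 0 <= M := le_trans (nm_ge0 d) dM.
  have : (M + e') * L * (t - u) <= (M + e') * L * t by rewrite ler_wpM2l ?mulr_ge0 //; lra.
  by move: P1 h1 => /=; lra.
- by rewrite ler01 lexx.
Qed.

End Calculus.

(** * Quantitative inverse function theorem *)

Section InverseFunction.
Variable R : realType.
Local Notation C := (Cplx R).
Variables (f df : C -> C) (M : R).
Hypothesis fd : forall z, hasder f z (df z).
Hypothesis dfc : forall z, ccont df z.
Hypothesis df0 : forall z, nm z <= M -> df z != 0.

(** Both constants are uniform over the disc of radius [M]. Injectivity comes from the mean value
    inequality for [f z - df a * z]. Surjectivity minimizes |f - w| over a closed disc: at an
    interior point with nonzero value, a Newton step would decrease it. *)
Lemma qift : exists2 r : R, 0 < r & exists2 c : R, 0 < c &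
  (forall a b, nm a <= M -> nm b <= M -> nm (a - b) <= r -> c * nm (a - b) <= nm (f a - f b)) /\
  (forall z s w, 0 < s <= r -> nm z + s <= M -> nm (w - f z) < c * s ->
     exists2 z', nm (z' - z) <= s & f z' = w).
Proof.
have [m m0 mdf] : exists2 m : R, 0 < m & forall z, disc M z -> m <= nm (df z).
  by apply: cpt_away0 => //; [exact: compact_disc|apply: ccont_on => z _; exact: dfc].
have m20 : 0 < m / 2 by lra.
have [d d0 ud] : exists2 d : R, 0 < d & forall z w, disc M z -> nm (w - z) < d ->
    nm (df w - df z) < m / 2.
  apply: (@cconton_unif R (disc M) setT) => //; first exact: compact_disc.
    by move=> z _; exists 1.
  by apply: ccont_on => z _; exact: dfc.
have inj a b : nm a <= M -> nm b <= M -> nm (a - b) <= d / 2 ->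
    m / 2 * nm (a - b) <= nm (f a - f b).
  move=> aM bM ab.
  have : nm ((f b - df a * b) - (f a - df a * a)) <= m / 2 * nm (b - a).
    apply: (@mvt_seg R (fun z => f z - df a * z)) => t t01.
    exists (df (segp a b t) - df a).
      have := hasderD (fd (segp a b t)) (hasderM (hasder_cst (- df a) (segp a b t)) (hasder_id (segp a b t))).
      rewrite mul0r add0r mulr1 => h; apply: hasder_ext h => w /=; ring.
    apply/ltW/ud => //; have := segpB a b t 0; rewrite segp0 subr0 => ->.
    rewrite nmM nm_rC nmBC; have := nm_ge0 (a - b); move: t01 => /andP[t0 t1].
    by rewrite ger0_norm //; nra.
  have -> : f b - df a * b - (f a - df a * a) = (f b - f a) - df a * (b - a) by ring.
  have := nm_subr_ge (df a * (b - a)) (f b - f a); rewrite nmM.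
  rewrite (nmBC (df a * _)) (nmBC b a) (nmBC (f b) (f a)).
  have := mdf a aM; have := nm_ge0 (a - b); nra.
(* Lowering the constant from m/2 to m/4 keeps the minimizer off the boundary: there |f z0 - f z| is
   at least (m/2)s, while |f z0 - w| and |w - f z| are below (m/4)s. *)
exists (d / 2); first lra; exists (m / 4); first lra.
split=> [a b aM bM ab|z s w /andP[s0 sd] zsM wz].
  by apply: le_trans (inj a b aM bM ab); rewrite ler_wpM2r ?nm_ge0 //; lra.
pose B : set C := [set z' | nm (z' - z) <= s].
have BM z' : B z' -> nm z' <= M.
  by move=> h; have := nm_subr_ge z' z; rewrite /B /= in h; lra.
have cB : compact B.
  apply: (subclosed_compact _ (@compact_disc R M)); last exact: BM.
  apply/closedCP => x h; rewrite /B /= leNgt; apply/negP => sx.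
  have [y yB yx] := h (nm (x - z) - s) ltac:(lra).
  by have := nm_tri x y z; rewrite nmBC /B /= in yx yB *; lra.
have cg : cconton B (fun z' => f z' - w).
  by apply: ccont_on => x _; apply: ccontD (ccont_cst _ _); apply: hasder_ccont (fd x).
have Bz : B z by rewrite /B /= subrr nm0 ltW.
have [z0 Bz0 mz0] := cpt_argmin cB cg (ex_intro _ z Bz).
exists z0 => //; apply/eqP; rewrite -subr_eq0; apply/negP => /negP g0.
have Mz0 := BM _ Bz0.
have zM : nm z <= M by lra.
have := mz0 z Bz => /= hz; rewrite nmBC in wz.
have z0s : nm (z0 - z) < s.
  rewrite lt_neqAle Bz0 andbT; apply/eqP => e.
  have := inj z0 z Mz0 zM ltac:(lra); rewrite e => k.
  by have := nm_tri (f z0) w (f z); rewrite (nmBC w); lra.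
have d0' := df0 Mz0.
(* The Newton direction: moving by [t v] multiplies [f - w] by 1 - t, up to an error of modulus at
   most [G t/2]. *)
pose v := - (f z0 - w) / df z0.
have v0 : 0 < nm v by rewrite nm_gt0 /v mulf_neq0 ?oppr_eq0 ?invr_eq0.
pose G := nm (f z0 - w); have G0 : 0 < G by rewrite nm_gt0.
have [r r0 hr] := fd z0 (e := G / (2 * nm v)) ltac:(by rewrite divr_gt0 //; lra).
pose t := Num.min (1 / 2) (Num.min (r / (2 * nm v)) ((s - nm (z0 - z)) / nm v)).
have t0 : 0 < t.
  rewrite !lt_min; apply/and3P; split; first lra.
    by rewrite divr_gt0 //; lra.
  by rewrite divr_gt0 //; lra.
have [th [tr ts]] : t <= 1 / 2 /\ t <= r / (2 * nm v) /\ t <= (s - nm (z0 - z)) / nm v.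
  by rewrite !ge_min !lexx !orbT.
have tr' : t * (2 * nm v) <= r by rewrite -ler_pdivlMr //; lra.
have ts' : t * nm v <= s - nm (z0 - z) by rewrite -ler_pdivlMr.
pose z1 := z0 + rC t * v.
have z10 : z1 - z0 = rC t * v by rewrite /z1 addrAC subrr add0r.
have n10 : nm (z1 - z0) = t * nm v by rewrite z10 nmM nm_rC gtr0_norm.
have Bz1 : B z1 by rewrite /B /=; have := nm_tri z1 z0 z; lra.
have := hr z1; rewrite n10 => /(_ ltac:(nra)) h1.
have := mz0 z1 Bz1 => /=; rewrite -/G => h2.
have : f z1 - w = (f z1 - f z0 - df z0 * (z1 - z0)) + rC (1 - t) * (f z0 - w).
  rewrite z10 /v rCD rCN rC1; field; exact: d0'.
move=> e; have := nmD (f z1 - f z0 - df z0 * (z1 - z0)) (rC (1 - t) * (f z0 - w)).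
rewrite -e nmM nm_rC -/G ger0_norm; last lra.
have : G / (2 * nm v) * (t * nm v) = G * t / 2.
  field; lra.
nra.
Qed.

End InverseFunction.

(** * Exponential and polar coordinates *)

Section Exp.
Variable R : realType.
Local Notation C := (Cplx R).

Definition cexp (z : C) : C :=
  Complex (expR (complex.Re z) * cos (complex.Im z)) (expR (complex.Re z) * sin (complex.Im z)).

Lemma complex_ext (z w : C) : complex.Re z = complex.Re w -> complex.Im z = complex.Im w -> z = w.
Proof. by case: z w => a b [c d] /= -> ->. Qed.

Lemma cReD (z w : C) : complex.Re (z + w) = complex.Re z + complex.Re w.
Proof. by case: z w => a b [c d]. Qed.
Lemma cImD (z w : C) : complex.Im (z + w) = complex.Im z + complex.Im w.
Proof. by case: z w => a b [c d]. Qed.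
Lemma cReM (z w : C) : complex.Re (z * w) = complex.Re z * complex.Re w - complex.Im z * complex.Im w.
Proof. by case: z w => a b [c d]. Qed.
Lemma cImM (z w : C) : complex.Im (z * w) = complex.Re z * complex.Im w + complex.Im z * complex.Re w.
Proof. by case: z w => a b [c d]. Qed.
Lemma cReN (z : C) : complex.Re (- z) = - complex.Re z. Proof. by case: z. Qed.
Lemma cImN (z : C) : complex.Im (- z) = - complex.Im z. Proof. by case: z. Qed.

Lemma cexp0 : cexp 0 = 1.
Proof. by rewrite /cexp /= expR0 cos0 sin0 mulr0 mulr1. Qed.

Lemma cexpD z w : cexp (z + w) = cexp z * cexp w.
Proof.
apply: complex_ext; rewrite ?cReM ?cImM /cexp /= cReD cImD expRD ?cosD ?sinD; ring.
Qed.

Lemma nm_cexp z : nm (cexp z) = expR (complex.Re z).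
Proof.
rewrite /nm /cexp /=.
have -> : (expR (complex.Re z) * cos (complex.Im z)) ^+ 2 + (expR (complex.Re z) * sin (complex.Im z)) ^+ 2
  = expR (complex.Re z) ^+ 2 * (cos (complex.Im z) ^+ 2 + sin (complex.Im z) ^+ 2) by ring.
by rewrite cos2Dsin2 mulr1 sqrtr_sqr ger0_norm // expR_ge0.
Qed.

Lemma cexp_neq0 z : cexp z != 0.
Proof. by rewrite -nm_gt0 nm_cexp expR_gt0. Qed.

Lemma cexpN z : cexp (- z) = (cexp z)^-1.
Proof.
by apply: (mulfI (cexp_neq0 z)); rewrite -cexpD subrr cexp0 divff ?cexp_neq0.
Qed.

Lemma cexpB z w : cexp (z - w) = cexp z / cexp w.
Proof. by rewrite cexpD cexpN. Qed.

Lemma cexpXn z n : cexp z ^+ n = cexp (z *+ n).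
Proof. by elim: n => [|n IH]; rewrite ?cexp0 // exprS mulrS cexpD IH. Qed.

Lemma real_derive_eps (g : R -> R) (x d : R) : is_derive x 1 g d -> forall e : R, 0 < e ->
  exists2 r : R, 0 < r & forall y, `|y| < r -> `|g (x + y) - g x - d * y| <= e * `|y|.
Proof.
move=> [dg dv] e e0.
have : h^-1 *: ((g \o shift x) (h *: (1:R)) - g x) @[h --> (0:R)^'] --> d.
  by rewrite -dv.
move=> /cvgrPdist_lt /(_ e e0) /nbhs_ballP [r r0 hr]; exists r => // y yr.
have [->|y0] := eqVneq y 0; first by rewrite addr0 subrr mulr0 subr0 normr0 mulr0.
have := hr y; rewrite /ball /= sub0r normrN => /(_ yr y0).
rewrite /GRing.scale /= mulr1 (addrC y x) => h.
have -> : g (x + y) - g x - d * y = - (y * (d - y^-1 * (g (x + y) - g x))) by field.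
by rewrite normrN normrM mulrC ler_wpM2r // ltW.
Qed.

Lemma hasder_cexp0 : hasder cexp 0 1.
Proof.
move=> e e0.
(* The five error terms below add up to at most 7 k |w|. *)
pose k := Num.min (e / 8) 1.
have k0 : 0 < k by rewrite lt_min; apply/andP; split; lra.
have [ke k1] : k <= e / 8 /\ k <= 1 by rewrite !ge_min !lexx orbT.
clearbody k.
have [r1 r10 h1] := real_derive_eps (is_derive_expR 0) k0.
have [r2 r20 h2] := real_derive_eps (is_derive_cos 0) k0.
have [r3 r30 h3] := real_derive_eps (is_derive_sin 0) k0.
pose r := Num.min (Num.min r1 r2) (Num.min r3 k).
have r0 : 0 < r by rewrite !lt_min r10 r20 r30 k0.
have [rr1 [rr2 [rr3 rk]]] : r <= r1 /\ r <= r2 /\ r <= r3 /\ r <= k.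
  by rewrite !ge_min !lexx !orbT.
exists r => // w; rewrite subr0 => wr; rewrite cexp0 mul1r.
have hx := Re_le_nm w; have hy := Im_le_nm w.
set x := complex.Re w in hx *; set y := complex.Im w in hy *.
have := h1 x ltac:(lra); rewrite add0r expR0 mul1r => k1x.
have := h2 y ltac:(lra); rewrite add0r cos0 sin0 oppr0 mul0r subr0 => k2y.
have := h3 y ltac:(lra); rewrite add0r cos0 sin0 mul1r subr0 => k3y.
set n := nm w in hx hy wr *.
have n0 : 0 <= n := nm_ge0 w.
have ax0 := normr_ge0 x; have ay0 := normr_ge0 y.
apply: le_trans (nm_le_ReIm _) _.
have -> : complex.Re (cexp w - 1 - w) = (expR x - 1 - x) * cos y + (1 + x) * (cos y - 1).
  rewrite !cReD !cReN /cexp /= -/x -/y; ring.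
have -> : complex.Im (cexp w - 1 - w) = (expR x - 1 - x) * sin y + x * sin y + (sin y - y).
  rewrite !cImD !cImN /cexp /= -/x -/y; ring.
have c1 : `|cos y| <= 1 by exact: cos_max.
have s1 : `|sin y| <= 1 by exact: sin_max.
have sy : `|sin y| <= 2 * n.
  have := ler_distD y (sin y) 0; rewrite !subr0; clear -k3y hy k1 k0 n0; nra.
have e1 : `|(expR x - 1 - x) * cos y| <= k * n.
  rewrite normrM; have := normr_ge0 (cos y); have := normr_ge0 (expR x - 1 - x); clear -k1x c1 hx ax0 k0; nra.
have e2 : `|(1 + x) * (cos y - 1)| <= 2 * (k * n).
  rewrite normrM; have := ler_normD 1 x; rewrite normr1.
  have := normr_ge0 (1 + x); have := normr_ge0 (cos y - 1); clear -k2y hy hx ax0 ay0 wr rk k1 k0; nra.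
have e3 : `|(expR x - 1 - x) * sin y| <= k * n.
  rewrite normrM; have := normr_ge0 (sin y); have := normr_ge0 (expR x - 1 - x); clear -k1x s1 hx ax0 k0; nra.
have e4 : `|x * sin y| <= 2 * (k * n).
  rewrite normrM; have := normr_ge0 (sin y); clear -hx sy wr rk k1 k0 n0 ax0; nra.
have := ler_normD ((expR x - 1 - x) * cos y) ((1 + x) * (cos y - 1)).
have := ler_normD ((expR x - 1 - x) * sin y + x * sin y) (sin y - y).
have := ler_normD ((expR x - 1 - x) * sin y) (x * sin y).
nra.
Qed.

Lemma hasder_cexp z : hasder cexp z (cexp z).
Proof.
move=> e e0; pose n := nm (cexp z).
have n0 : 0 < n by rewrite nm_gt0 cexp_neq0.
have [r r0 h] := hasder_cexp0 (e := e / n) ltac:(by rewrite divr_gt0).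
exists r => // w wz; have := h (w - z); rewrite subr0 => /(_ wz); rewrite cexp0 mul1r => hw.
have -> : cexp w - cexp z - cexp z * (w - z) = cexp z * (cexp (w - z) - 1 - (w - z)).
  by rewrite cexpB; field; exact: cexp_neq0.
rewrite nmM -/n mulrC -ler_pdivlMr //; apply: le_trans hw _.
by rewrite mulrAC.
Qed.

Lemma ccont_cexp z : ccont cexp z.
Proof. exact: hasder_ccont (hasder_cexp z). Qed.

Definition im (y : R) : C := Complex 0 y.

Lemma imD (a b : R) : im (a + b) = im a + im b.
Proof. by apply: complex_ext; rewrite ?cReD ?cImD /= ?addr0. Qed.
Lemma imN (a : R) : im (- a) = - im a.
Proof. by apply: complex_ext; rewrite ?cReN ?cImN /= ?oppr0. Qed.
Lemma imM (a b : R) : im (a * b) = rC a * im b.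
Proof. by apply: complex_ext; rewrite ?cReM ?cImM /=; ring. Qed.
Lemma nm_im (y : R) : nm (im y) = `|y|.
Proof. by rewrite /nm /= expr0n add0r sqrtr_sqr. Qed.

Lemma nm_cexp_im (y : R) : nm (cexp (im y)) = 1.
Proof. by rewrite nm_cexp /= expR0. Qed.

Lemma nm_cexp_im_sub1 (y : R) : nm (cexp (im y) - 1) <= `|y|.
Proof.
rewrite -cexp0; have -> : `|y| = 1 * nm (im y - 0) by rewrite subr0 nm_im mul1r.
apply: mvt_seg => t _; exists (cexp (segp 0 (im y) t)); first exact: hasder_cexp.
by rewrite nm_cexp /segp add0r subr0 -imM /= expR0.
Qed.

Lemma cexp_im2pi (k : int) : cexp (im (2 * pi * k%:~R)) = 1.
Proof.
suff nat_case n : cexp (im (2 * pi * n%:R)) = 1.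
  case: k => n; first exact: nat_case.
  rewrite NegzE mulrNz mulrN imN cexpN; have -> : n.+1%:~R = n.+1%:R :> R by [].
  by rewrite nat_case invr1.
elim: n => [|n IH]; first by rewrite mulr0 cexp0.
rewrite -(natr1 n) mulrDr mulr1 imD cexpD IH mul1r /cexp /= expR0 !mul1r.
by have := cos2pi R; have := sin2pi R; rewrite mulr_natl => -> ->.
Qed.

Lemma cos1_2pi (t : R) : cos t = 1 -> exists k : int, t = 2 * pi * k%:~R.
Proof.
move=> ct; have p0 := pi_gt0 R; have p20 : 0 < 2 * pi :> R by lra.
pose k := Num.floor (t / (2 * pi)).
exists k; have h1 := floor_le_tmp (t / (2 * pi)); have h2 := floorD1_gt (t / (2 * pi)).
rewrite -/k in h1 h2.
have k1 : k%:~R * (2 * pi) <= t by rewrite -ler_pdivlMr.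
have k2 : t < (k%:~R + 1) * (2 * pi).
  by rewrite -ltr_pdivrMr //; move: h2; rewrite intrD.
pose s := t - 2 * pi * k%:~R.
have cs : cos s = 1.
  have := cexpB (im t) (im (2 * pi * k%:~R)); rewrite cexp_im2pi divr1 -imN -imD -/s.
  by rewrite /cexp /= expR0 !mul1r => -[-> _].
have s0 : 0 <= s by rewrite /s; lra.
have s1 : s < 2 * pi by rewrite /s; lra.
have [sz|sz] := eqVneq s 0; first by move: sz; rewrite /s; lra.
(* The half-angle sine is positive on (0, 2 pi), while cos s = 1 - 2 sin^2(s/2). *)
have sh : 0 < sin (s / 2).
  by apply: sin_gt0_pi; lra.
have : cos (s / 2 + s / 2) = 1 by rewrite -splitr.
rewrite cosD; have := cos2Dsin2 (s / 2); nra.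
Qed.

Lemma cexp_eq z w : cexp z = cexp w ->
  complex.Re z = complex.Re w /\ exists k : int, complex.Im z = complex.Im w + 2 * pi * k%:~R.
Proof.
move=> e; have er : complex.Re z = complex.Re w.
  by apply: expR_inj; rewrite -!nm_cexp e.
split=> //; have : cexp (z - w) = 1 by rewrite cexpB e divff ?cexp_neq0.
rewrite /cexp cReD cReN er subrr expR0 !mul1r cImD cImN => -[/cos1_2pi [k ek] _].
by exists k; lra.
Qed.

Lemma cexp_surj (z : C) : z != 0 -> exists w, cexp w = z.
Proof.
move=> z0; have r0 : 0 < nm z by rewrite nm_gt0.
have er : expR (ln (nm z)) = nm z by rewrite lnK // posrE.
case: z z0 r0 er => a b z0; set r := nm _ => r0 er.
have r2 : r ^+ 2 = a ^+ 2 + b ^+ 2 by rewrite sqr_sqrtr // addr_ge0 // sqr_ge0.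
have ar : -1 <= a / r <= 1.
  have : `|a| <= r by exact: (Re_le_nm (Complex a b)).
  rewrite ler_norml => /andP[h1 h2].
  by rewrite ler_pdivlMr // ler_pdivrMr //; apply/andP; split; lra.
have sq : Num.sqrt (1 - (a / r) ^+ 2) = `|b| / r.
  have -> : 1 - (a / r) ^+ 2 = (b / r) ^+ 2.
    rewrite !expr_div_n; have -> : b ^+ 2 = r ^+ 2 - a ^+ 2 by rewrite r2; ring.
    by field; exact: lt0r_neq0.
  by rewrite sqrtr_sqr normrM normfV (gtr0_norm r0).
have [b0|b0] := leP 0 b.
  exists (Complex (ln r) (acos (a / r))); rewrite /cexp /= er sin_acos // sq.
  rewrite acosK ?in_itv //= ger0_norm //; congr Complex; field; exact: lt0r_neq0.
exists (Complex (ln r) (- acos (a / r))); rewrite /cexp /= er sinN cosN sin_acos // sq.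
rewrite acosK ?in_itv //= ltr0_norm //; congr Complex; field; exact: lt0r_neq0.
Qed.

Lemma cexp_surj_win (z : C) (c : R) : z != 0 ->
  exists2 w, cexp w = z & c <= complex.Im w < c + 2 * pi.
Proof.
move=> /cexp_surj [w ew]; have p0 := pi_gt0 R.
pose k := Num.floor ((complex.Im w - c) / (2 * pi)).
have h1 := floor_le_tmp ((complex.Im w - c) / (2 * pi)).
have h2 := floorD1_gt ((complex.Im w - c) / (2 * pi)).
rewrite -/k in h1 h2; have p20 : 0 < 2 * pi :> R by lra.
have k1 : k%:~R * (2 * pi) <= complex.Im w - c by rewrite -ler_pdivlMr.
have k2 : complex.Im w - c < (k%:~R + 1) * (2 * pi).
  by rewrite -ltr_pdivrMr //; move: h2; rewrite intrD.
exists (w - im (2 * pi * k%:~R)); first by rewrite cexpB cexp_im2pi divr1.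
by rewrite cImD cImN /=; lra.
Qed.

Lemma rot_multE (a : R) : rot_mult a = cexp (im (2 * pi * a)).
Proof. by rewrite /cexp /= expR0 !mul1r. Qed.

End Exp.

(** * Inverse branches *)

Section Branches.
Variable R : realType.
Local Notation C := (Cplx R).

Lemma ccontV (f : C -> C) z : ccont f z -> f z != 0 -> ccont (fun w => (f w)^-1) z.
Proof.
move=> cf f0 e e0; pose n := nm (f z); have n0 : 0 < n by rewrite nm_gt0.
pose k := Num.min (n / 2) (e * n * n / 4).
have k0 : 0 < k by rewrite lt_min; apply/andP; split; [lra|rewrite !mulr_gt0].
have [kn ke] : k <= n / 2 /\ k <= e * n * n / 4 by rewrite !ge_min !lexx orbT.
have [d d0 h] := cf k k0; exists d => // w wz.
have fw := h w wz; have := nm_subr_ge (f z) (f w); rewrite nmBC -/n => h2.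
have fw0 : f w != 0 by rewrite -nm_gt0; lra.
have -> : (f w)^-1 - (f z)^-1 = - (f w - f z) / (f w * f z) by field; rewrite fw0 f0.
rewrite nmM nmN nmV nmM ltr_pdivrMr -/n; last by rewrite mulr_gt0 // nm_gt0.
have : n / 2 <= nm (f w) by lra.
have : e * n * n / 4 < e * n * (n / 2) by rewrite [ltRHS](_ : _ = e * n * n / 2); [have := mulr_gt0 (mulr_gt0 e0 n0) n0; lra|lra].
move=> a b; have : e * n * (n / 2) <= e * n * nm (f w) by rewrite ler_wpM2l // ltW // mulr_gt0.
lra.
Qed.

Lemma hasder_near (f g : C -> C) z d : (exists2 r : R, 0 < r & forall w, nm (w - z) < r -> f w = g w) ->
  hasder f z d -> hasder g z d.
Proof.
move=> [r r0 fg] hf e e0; have [s s0 h] := hf e e0.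
exists (Num.min r s); first by rewrite lt_min r0 s0.
move=> w; rewrite lt_min => /andP[wr ws]; rewrite -(fg w wr) -(fg z); first exact: h.
by rewrite subrr nm0.
Qed.

Lemma hasder_implicit (f g k : C -> C) z d e : hasder f (g z) d -> d != 0 -> hasder k z e ->
  ccont g z -> (exists2 r : R, 0 < r & forall w, nm (w - z) < r -> f (g w) = k w) ->
  hasder g z (e / d).
Proof.
move=> /hasderP[q [cq qd fq]] d0 /hasderP[p [cp pe kp]] cg [r r0 fg].
have cqg : ccont (fun w => q (g w)) z by apply: ccont_comp.
have q0 : q (g z) != 0 by rewrite qd.
have cs := ccontM cp (ccontV cqg q0).
have [r1 r10 h1] := cqg (nm d) ltac:(by rewrite nm_gt0).
apply: (@hasder_near (fun w => g z + p w * (q (g w))^-1 * (w - z))).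
  exists (Num.min r r1); first by rewrite lt_min r0 r10.
  move=> w; rewrite lt_min => /andP[wr wr1].
  have qw : q (g w) != 0.
    apply/eqP => q00; have := h1 w wr1; rewrite q00 qd sub0r nmN; lra.
  have e1 : q (g w) * (g w - g z) = p w * (w - z).
    have := fg w wr; rewrite fq kp (fg z) ?subrr ?nm0 //.
    by move/addrI.
  by rewrite mulrAC -e1; field.
apply/hasderP; exists (fun w => p w * (q (g w))^-1); split => //.
  by rewrite pe qd.
by move=> w; rewrite subrr mulr0 addr0.
Qed.

Lemma conn_star (A : set C) (x0 : C) : A x0 ->
  (forall x t, A x -> 0 <= t <= 1 -> A (segp x0 x t)) -> connected A.
Proof.
move=> Ax0 st.
have -> : A = \bigcup_(x in A) (segp x0 x @` `[0, 1]).
  apply/seteqP; split=> [x Ax|x [y Ay [t]]].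
    by exists x => //; exists 1; rewrite ?segp1 //= in_itv /= ler01 lexx.
  by rewrite /= in_itv /= => t01 <-; apply: st.
apply: bigcup_connected.
  by exists x0 => x Ax; exists 0; rewrite ?segp0 //= in_itv /= ler01 lexx.
move=> x Ax.
suff cs : {within `[0, 1], continuous (segp x0 x)}.
  exact: (connected_continuous_connected (@segment_connected R 0 1) cs).
apply/pcontonP => t _ e e0; exists (e / (nm (x - x0) + 1)).
  by rewrite divr_gt0 //; have := nm_ge0 (x - x0); lra.
move=> s _; rewrite segpB nmM nm_rC ltr_pdivlMr; last by have := nm_ge0 (x - x0); lra.
by have := normr_ge0 (s - t); lra.
Qed.

Lemma conn_ball (z : C) (r : R) : 0 < r -> connected [set w | nm (w - z) < r].
Proof.
move=> r0; apply: (@conn_star _ z) => [|x t /= xr /andP[t0 t1]]; first by rewrite /= subrr nm0.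
have := segpB z x t 0; rewrite segp0 subr0 => ->; rewrite nmM nm_rC ger0_norm //.
have := nm_ge0 (x - z); nra.
Qed.

Lemma ccont_within (A : set C) (f : C -> C) : (forall z, ccont f z) -> {within A, continuous f}.
Proof. by move=> cf; apply: continuous_subspaceT => z; apply/ccontP. Qed.

(** [cexp] maps a closed half-plane, which is convex, onto the exterior of the disc. *)
Lemma conn_ext (r : R) : 0 < r -> connected [set z : C | r <= nm z].
Proof.
move=> r0.
have -> : [set z : C | r <= nm z] = @cexp R @` [set w | ln r <= complex.Re w].
  apply/seteqP; split => [z /= rz|_ [w /= rw <-]].
    have [w ew] : exists w, cexp w = z by apply: cexp_surj; rewrite -nm_gt0; lra.
    exists w => //=; rewrite -(expRK (complex.Re w)) -nm_cexp ew.
    by rewrite ler_ln // posrE; lra.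
  by rewrite /= nm_cexp -[leLHS](@lnK _ r) ?posrE // ler_expR.
apply: (@connected_continuous_connected C C); last by apply: ccont_within => z; exact: ccont_cexp.
apply: (@conn_star _ (rC (ln r))) => [|x t rx /andP[t0 t1]]; first by rewrite /=.
have {}rx : ln r <= complex.Re x := rx.
apply: (_ : ln r <= complex.Re (segp (rC (ln r)) x t)).
rewrite /segp cReD cReM cReD cReN /=; nra.
Qed.

Lemma comp_open (A : set C) x : open A -> open (connected_component A x).
Proof.
move=> /openCP oA; apply/openCP => z cz.
have Az : A z := connected_component_sub cz.
have [e e0 h] := oA z Az; exists e => // w wz.
have Ball : [set w | nm (w - z) < e] `<=` connected_component A z.
  apply: connected_component_max => //=; first by rewrite subrr nm0.
  exact: conn_ball.
by rewrite (same_connected_component cz); apply: Ball.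
Qed.

Section Lift.
Variables (f df : C -> C) (M : R).
Hypothesis fd : forall z, hasder f z (df z).
Hypothesis dfc : forall z, ccont df z.
Hypothesis df0 : forall z, nm z <= M -> df z != 0.

Lemma path_lift_uniq (p1 p2 : R -> C) (a b : R) : a <= b -> pconton a b p1 -> pconton a b p2 ->
  (forall t, a <= t <= b -> [/\ nm (p1 t) <= M, nm (p2 t) <= M & f (p1 t) = f (p2 t)]) ->
  p1 a = p2 a -> forall t, a <= t <= b -> p1 t = p2 t.
Proof.
move=> ab c1 c2 hp e0.
have [r r0 [c c0 [inj _]]] := qift fd dfc df0.
apply: (@real_ind R a b (fun t => p1 t = p2 t)) => // t.
- move=> /andP[ta tb] et; have tab : a <= t <= b by rewrite ta ltW.
  have [d1 d10 h1] := c1 t tab (r / 2) ltac:(lra).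
  have [d2 d20 h2] := c2 t tab (r / 2) ltac:(lra).
  exists (t + Num.min d1 d2 / 2).
    by rewrite ltrDl divr_gt0 // lt_min d10 d20.
  move=> s /andP[ts st] sb.
  have [m1 m2] : Num.min d1 d2 <= d1 /\ Num.min d1 d2 <= d2 by rewrite !ge_min !lexx orbT.
  have m0 : 0 < Num.min d1 d2 by rewrite lt_min d10.
  have sab : a <= s <= b by apply/andP; split; lra.
  have std : `|s - t| < Num.min d1 d2 by rewrite ger0_norm; lra.
  have k1 := h1 s sab (lt_le_trans std m1); have k2 := h2 s sab (lt_le_trans std m2).
  have [q1 q2 q3] := hp s sab.
  have := inj _ _ q1 q2; rewrite q3 subrr nm0 => /(_ _) h.
  apply/eqP; rewrite -subr_eq0 -nm_eq0 eq_le nm_ge0 andbT -(pmulr_rle0 _ c0); apply: h.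
  by have := nm_tri (p1 s) (p1 t) (p2 s); rewrite {2}et (nmBC (p2 t)); lra.
- move=> /andP[ta tb] et; have tab : a <= t <= b by rewrite tb ltW.
  apply/eqP; rewrite -subr_eq0 -nm_eq0 eq_le nm_ge0 andbT; apply/ler_addgt0Pr => e e0'.
  have [d1 d10 h1] := c1 t tab (e / 2) ltac:(lra).
  have [d2 d20 h2] := c2 t tab (e / 2) ltac:(lra).
  pose d := Num.min (t - a) (Num.min d1 d2).
  have d0 : 0 < d by rewrite !lt_min d10 d20 subr_gt0 ta.
  have [dt [m1 m2]] : d <= t - a /\ d <= d1 /\ d <= d2 by rewrite !ge_min !lexx !orbT.
  pose s := t - d / 2.
  have sab : a <= s <= b by apply/andP; rewrite /s; split; lra.
  have std : `|s - t| < d by rewrite /s addrAC subrr add0r normrN gtr0_norm; lra.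
  have k1 := h1 s sab (lt_le_trans std m1); have k2 := h2 s sab (lt_le_trans std m2).
  have es := et s ltac:(rewrite /s; apply/andP; split; lra).
  by have := nm_tri (p1 t) (p1 s) (p2 t); rewrite (nmBC (p1 t) (p1 s)) {2}es; lra.
Qed.

Definition bal (r : R) : set C := [set w | nm w < r].

(** Uniqueness along radii. As [f] need not be injective, this is the tool for identities between
    branches: both sides lift the same map and agree at 0. *)
Lemma lift_uniq (h1 h2 : C -> C) (r : R) :
  cconton (bal r) h1 -> cconton (bal r) h2 ->
  (forall w, nm w < r -> [/\ nm (h1 w) <= M, nm (h2 w) <= M & f (h1 w) = f (h2 w)]) ->
  h1 0 = h2 0 -> forall w, nm w < r -> h1 w = h2 w.
Proof.
move=> c1 c2 hh h0 w wr.
have rad t : 0 <= t <= 1 -> nm (rC t * w) < r.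
  by move=> /andP[t0 t1]; rewrite nmM nm_rC ger0_norm //; have := nm_ge0 w; nra.
have cont h : cconton (bal r) h -> pconton 0 1 (fun t => h (rC t * w)).
  move=> ch t t01 e e0; have [d d0 hd] := ch _ (rad t t01) e e0.
  exists (d / (nm w + 1)); first by rewrite divr_gt0 //; have := nm_ge0 w; lra.
  move=> s s01; rewrite ltr_pdivlMr; last by have := nm_ge0 w; lra.
  move=> st; apply: hd; first exact: rad.
  rewrite -mulrBl -rCN -rCD nmM nm_rC.
  by have := normr_ge0 (s - t); lra.
have := @path_lift_uniq _ _ 0 1 ler01 (cont _ c1) (cont _ c2) _ _ 1.
rewrite rC1 rC0 !mul1r !mul0r; apply => //; last by rewrite ler01 lexx.
by move=> t t01; apply: hh; apply: rad.
Qed.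

Section Inverse.
Variables (h : C -> C) (r : R).
Hypothesis hc : cconton (bal r) h.
Hypothesis fh : forall w, nm w < r -> f (h w) = w.
Hypothesis hM : forall w, nm w < r -> nm (h w) < M.

(** [h] is given only as a right inverse. At the uniform scale of local injectivity it is also a
    left inverse near its values, so its image is open. *)
Lemma branch_open w0 : nm w0 < r ->
  exists2 d : R, 0 < d & forall z, nm (z - h w0) < d -> nm (f z) < r /\ h (f z) = z.
Proof.
move=> w0r; have [s s0 [c c0 [inj _]]] := qift fd dfc df0.
have [d1 d10 h1] := hc w0r (e := s / 2) ltac:(lra).
pose k := Num.min d1 (r - nm w0).
have k0 : 0 < k by rewrite lt_min d10 subr_gt0.
have [kd kr] : k <= d1 /\ k <= r - nm w0 by rewrite !ge_min !lexx orbT.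
have [d2 d20 h2] := hasder_ccont (fd (h w0)) k0.
have hM0 := hM w0r.
pose d := Num.min d2 (Num.min (s / 2) (M - nm (h w0))).
exists d; first by rewrite !lt_min d20 subr_gt0 hM0 andbT; lra.
move=> z zd; have [dd2 [ds dM]] : d <= d2 /\ d <= s / 2 /\ d <= M - nm (h w0).
  by rewrite !ge_min !lexx !orbT.
have := h2 z ltac:(lra); rewrite fh // => fz.
have fzr : nm (f z) < r by have := nm_subr_ge (f z) w0; lra.
split=> //; have hz := h1 _ fzr ltac:(lra).
have zM : nm z <= M by have := nm_subr_ge z (h w0); lra.
have := inj (h (f z)) z (ltW (hM fzr)) zM; rewrite fh // subrr nm0 => /(_ _) hi.
apply/eqP; rewrite -subr_eq0 -nm_eq0 eq_le nm_ge0 andbT -(pmulr_rle0 _ c0); apply: hi.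
by have := nm_tri (h (f z)) (h w0) z; rewrite (nmBC (h w0)); lra.
Qed.

Lemma branch_ccont w0 : nm w0 < r -> ccont h w0.
Proof.
move=> w0r e e0; have [d d0 hd] := hc w0r e0.
exists (Num.min d (r - nm w0)); first by rewrite lt_min d0 subr_gt0.
move=> w; rewrite lt_min => /andP[wd wr]; apply: hd => //.
by rewrite /bal /=; have := nm_subr_ge w w0; lra.
Qed.

Lemma branch_hasder w0 : nm w0 < r -> hasder h w0 (df (h w0))^-1.
Proof.
move=> w0r; rewrite -[_^-1]mul1r.
apply: (hasder_implicit (f := f) (k := id)) => //.
- by apply: df0; apply/ltW/hM.
- exact: hasder_id.
- exact: branch_ccont.
- exists (r - nm w0); first by rewrite subr_gt0.
  by move=> w wr; apply: fh; have := nm_subr_ge w w0; lra.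
Qed.

Lemma branch_compact r' : r' < r -> compact (h @` disc r').
Proof.
move=> rr; apply: (@continuous_compact C C); last exact: compact_disc.
apply/subspace_continuousP => z zr.
have zr' : nm z < r by rewrite /disc /= in zr; lra.
by apply: cvg_within_filter; apply/ccontP; apply: branch_ccont.
Qed.

Lemma branch_conn r' : connected (h @` [set w | nm w <= r' /\ nm w < r]).
Proof.
have [r'0|r'0] := ltP r' 0.
  have -> : [set w : C | nm w <= r' /\ nm w < r] = set0.
    by apply/seteqP; split => // w [/= h1]; have := nm_ge0 w; lra.
  by rewrite image_set0; exact: connected0.
have [r0|r0] := leP r 0.
  have -> : [set w : C | nm w <= r' /\ nm w < r] = set0.
    by apply/seteqP; split => // w [/= _ h1]; have := nm_ge0 w; lra.
  by rewrite image_set0; exact: connected0.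
apply: (@connected_continuous_connected C C).
  apply: (@conn_star _ 0) => [|x t [/= x1 x2] /andP[t0 t1]].
    by rewrite /= nm0.
  have -> : segp 0 x t = rC t * x by rewrite /segp add0r subr0.
  by rewrite nmM nm_rC ger0_norm //; have := nm_ge0 x; split; nra.
apply/subspace_continuousP => z [_ zr].
by apply: cvg_within_filter; apply/ccontP; apply: branch_ccont.
Qed.

(* A bounded component of the complement would carry a maximum of [|f|], which
   openness of [f] forces onto [L = h(disc)]; near that point [h] inverts [f], so the
   points of the component would belong to [L]. *)
Lemma branch_full r' : 1 < M -> (forall w, nm w < r -> nm (h w) < 1) -> 0 <= r' < r ->
  connected (~` (h @` disc r')).
Proof.
move=> M1 h1 /andP[r'0 r'r].
set L := h @` disc r'.
have cL : compact L by apply: branch_compact.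
have L1 z : L z -> nm z < 1.
  by move=> [w wr <-]; apply: h1; rewrite /disc /= in wr; lra.
have clL : closed L by apply: compact_closed => //; exact: norm_hausdorff.
have oL : open (~` L) by apply: closed_openC.
pose E := [set z : C | 1 <= nm z].
have EL : E `<=` ~` L by move=> z; rewrite /E /= => zE /L1; lra.
have cE : connected E by apply: conn_ext.
have E1 : E 1 by rewrite /E /= nm1.
have meet z : (~` L) z -> connected_component (~` L) z 1.
  move=> zL; set O := connected_component (~` L) z.
  apply: contrapT => nO.
  have OE w : O w -> nm w < 1.
    move=> Ow; rewrite ltNge; apply/negP => w1; apply: nO.
    have EC : E `<=` connected_component (~` L) w by apply: connected_component_max.
    by have := EC _ E1; rewrite -(same_connected_component Ow).
  have oO : open O by apply: comp_open.
  have Oz : O z by apply: connected_component_refl.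
  have ccO : compact (closure O).
    apply: (subclosed_compact _ (@compact_disc R 1)); first exact: closed_closure.
    move=> w /closureCP hw; rewrite /disc /= leNgt; apply/negP => w1.
    have [y Oy yw] := hw (nm w - 1) ltac:(lra).
    by have := OE y Oy; have := nm_subr_ge w y; rewrite nmBC; lra.
  have cf : cconton (closure O) f by apply: ccont_on => w _; apply: hasder_ccont (fd w).
  have [B B0 fB] := cpt_bounded ccO cf.
  pose S := [set nm (f w) | w in closure O].
  have Sub : has_ubound S by exists B => _ [w Ow <-]; exact: fB.
  pose m := sup S.
  have mge w : closure O w -> nm (f w) <= m by move=> Ow; apply: ub_le_sup => //; exists w.
  have [[zs Ozs ms]|nomax] := pselect (exists2 zs, closure O zs & nm (f zs) = m); last first.
    have [|x Ox|d d0 hd] := @cpt_unif R (closure O) (fun d w => nm (f w) + d <= m) ccO.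
    - by move=> d d' x _ dd' hx; lra.
    - have fx : nm (f x) < m.
        by rewrite lt_neqAle mge // andbT; apply/eqP => ex; apply: nomax; exists x.
      have [d d0 hd] := cf x Ox ((m - nm (f x)) / 2) ltac:(lra).
      exists d => //; exists ((m - nm (f x)) / 2); first lra.
      by move=> y Oy yx; have := hd y Oy yx; have := nm_subr_ge (f y) (f x); lra.
    - have : sup S <= m - d.
        apply: ge_sup; first by exists (nm (f z)); exists z => //; apply: subset_closure.
        by move=> _ [w Ow <-]; have := hd w Ow; lra.
      by rewrite -/m; lra.
  have [Ozs'|nOzs] := pselect (O zs).
    have [e e0 he] := (openCP O).1 oO zs Ozs'.
    have [s s0 [c c0 [_ surj]]] := qift fd dfc df0.
    have zs1 := OE zs Ozs'.
    pose k := Num.min (e / 2) (Num.min s (M - 1)).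
    have k0 : 0 < k by rewrite !lt_min s0 subr_gt0 M1 andbT; lra.
    have [ke [ks kM]] : k <= e / 2 /\ k <= s /\ k <= M - 1 by rewrite !ge_min !lexx !orbT.
    (* A unit vector in the direction of [f zs], so that moving [f zs] along it increases the
       modulus; any direction will do when [f zs] is 0. *)
    pose u : C := if f zs == 0 then 1 else f zs / rC (nm (f zs)).
    have u1 : nm u = 1.
      rewrite /u; case: eqVneq => [_|fz0]; first exact: nm1.
      rewrite nmM nmV nm_rC ger0_norm ?nm_ge0 // divff // gt_eqF // nm_gt0 //.
    have fu : f zs = rC (nm (f zs)) * u.
      rewrite /u; case: eqVneq => [->|fz0]; first by rewrite nm0 rC0 mul0r.
      by rewrite mulrC divfK // -nm_gt0 nm_rC ger0_norm ?nm_ge0 // nm_gt0.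
    pose v := f zs + rC (c * k / 2) * u.
    have ck0 : 0 < c * k by rewrite mulr_gt0.
    have [|||z' z'z fz'] := surj zs k v.
    - by rewrite k0.
    - by lra.
    - rewrite /v addrAC subrr add0r nmM u1 mulr1 nm_rC gtr0_norm; nra.
    - have Oz' : O z' by apply: he; lra.
      have ev : v = rC (nm (f zs) + c * k / 2) * u by rewrite /v {1}fu rCD; ring.
      have := mge z' (subset_closure Oz'); rewrite fz' -ms ev nmM u1 mulr1 nm_rC.
      by rewrite ger0_norm; have := nm_ge0 (f zs); lra.
  have Lzs : L zs.
    apply: contrapT => nL; apply: nOzs.
    have [e e0 he] := (openCP _).1 oL zs nL.
    have [y Oy yz] := (closureCP _ _).1 Ozs e e0.
    have By : [set w | nm (w - zs) < e] `<=` connected_component (~` L) zs.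
      by apply: connected_component_max => //=; [rewrite subrr nm0|exact: conn_ball].
    rewrite /O (same_connected_component (Oy : connected_component _ z y)).
    rewrite -(same_connected_component (By y yz)).
    exact: connected_component_refl.
  have [ws wsr ezs] := Lzs; rewrite /disc /= in wsr.
  have wr : nm ws < r by lra.
  have [d d0 hd] := branch_open wr.
  have [y Oy yz] := (closureCP _ _).1 Ozs d d0.
  rewrite -ezs in yz; have [_ hy] := hd y yz.
  have yL : (~` L) y := connected_component_sub Oy.
  apply: yL; exists (f y) => //; rewrite /disc /=.
  by have := mge y (subset_closure Oy); rewrite -ms -ezs fh //; lra.
have -> : ~` L = \bigcup_(z in ~` L) connected_component (~` L) z.
  apply/seteqP; split=> [z Lz|z [w _]]; last exact: connected_component_sub.
  by exists z => //; exact: connected_component_refl.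
apply: bigcup_connected.
  by exists 1 => z Lz; exact: meet.
by move=> z _; exact: component_connected.
Qed.

End Inverse.
End Lift.
End Branches.

(** * Extending inverse branches up to the unit circle *)

Section MaxBranch.
Variable R : realType.
Local Notation C := (Cplx R).
Variables (f df : C -> C).
Hypothesis fd : forall z, hasder f z (df z).
Hypothesis dfc : forall z, ccont df z.
Hypothesis df0 : forall z, nm z <= 2 -> df z != 0.
Hypothesis f0 : f 0 = 0.

Definition branch (r : R) (h : C -> C) :=
  [/\ cconton (bal r) h, h 0 = 0 & forall w, nm w < r -> f (h w) = w /\ nm (h w) < 1].

(** The gain [d] does not depend on the branch. The new value at [w] is a solution of [f z' = w]
    near [h (t w)], where [t = r/(r+d)] brings [w] back into the old disc; local injectivity at
    scale [r0] makes these solutions fit together continuously. *)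
Lemma branch_extend (e : R) : 0 < e < 1 -> exists2 d : R, 0 < d & forall r h, 0 <= r ->
  branch r h -> (forall w, nm w < r -> nm (h w) <= 1 - e) -> exists h', branch (r + d) h'.
Proof.
move=> /andP[e0 e1].
have [r0 r00 [c c0 [inj surj]]] := qift fd dfc df0.
pose s := Num.min (e / 2) (r0 / 4).
have s0 : 0 < s by rewrite lt_min; apply/andP; split; lra.
have [se sr] : s <= e / 2 /\ s <= r0 / 4 by rewrite !ge_min !lexx orbT.
clearbody s.
have cs0 : 0 < c * s by rewrite mulr_gt0.
exists (c * s / 2); first lra.
move=> r h r_ge0 [hc h0 hr] he.
set d := c * s / 2.
have d0 : 0 < d by rewrite /d; lra.
pose t := r / (r + d).
have rd0 : 0 < r + d by lra.
have t0 : 0 <= t by rewrite divr_ge0 // ltW.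
have t1 : t < 1 by rewrite ltr_pdivrMr //; lra.
have tr : t * (r + d) = r by rewrite /t divfK // gt_eqF.
have small w : nm w < r + d -> f (h (rC t * w)) = rC t * w /\ nm (h (rC t * w)) <= 1 - e.
  move=> wr; have [e00|rn0] := eqVneq r 0.
    have -> : t = 0 by rewrite /t e00 mul0r.
    by rewrite rC0 mul0r h0 f0 nm0; split => //; lra.
  have rp : 0 < r by rewrite lt_def rn0.
  have tp : 0 < t by rewrite divr_gt0.
  have tw : nm (rC t * w) < r by rewrite nmM nm_rC ger0_norm //; nra.
  by split; [exact: (hr _ tw).1|exact: he].
have /choice [h' hh'] : forall w, exists z', nm w < r + d ->
    nm (z' - h (rC t * w)) <= s /\ f z' = w.
  move=> w; have [wr|wr] := ltP (nm w) (r + d); last by exists 0.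
  have [fw nw] := small w wr.
  have [|||z' z1 z2] := surj (h (rC t * w)) s w.
  - by rewrite s0 /=; lra.
  - lra.
  - rewrite fw; have -> : w - rC t * w = rC (1 - t) * w by rewrite rCD rCN rC1; ring.
    rewrite nmM nm_rC ger0_norm; last lra.
    have : (1 - t) * nm w < (1 - t) * (r + d) by rewrite ltr_pM2l //; lra.
    have ed : d = c * s / 2 by []. lra.
  - by exists z'.
exists h'.
have M2 w : nm w < r + d -> nm (h' w) < 1.
  move=> wr; have [k1 _] := hh' w wr; have [_ k2] := small w wr.
  have := nm_subr_ge (h' w) (h (rC t * w)); lra.
split; last by move=> w wr; split; [exact: (hh' w wr).2|exact: M2].
- move=> w wr k k0.
  have [d1 d10 hd1] : exists2 d1 : R, 0 < d1 & forall w1, nm w1 < r + d -> nm (w1 - w) < d1 ->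
      nm (h (rC t * w1) - h (rC t * w)) < r0 / 4.
    have [e00|rn0] := eqVneq r 0.
      exists 1 => // w1 _ _; rewrite /t e00 mul0r rC0 !mul0r subrr nm0; lra.
    have rp : 0 < r by rewrite lt_def rn0.
    have tp : 0 < t by rewrite divr_gt0.
    have twr w1 : nm w1 < r + d -> nm (rC t * w1) < r by move=> ?; rewrite nmM nm_rC ger0_norm //; nra.
    have [d1 d10 hd1] := hc (rC t * w) (twr _ wr) (r0 / 4) ltac:(lra).
    exists d1 => // w1 w1r w1w; apply: hd1; first exact: twr.
    rewrite -mulrBr nmM nm_rC ger0_norm //; have := nm_ge0 (w1 - w); nra.
  exists (Num.min d1 (c * k)); first by rewrite lt_min d10 mulr_gt0.
  move=> w1 w1r; rewrite lt_min => /andP[w1d w1k].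
  have [a1 a2] := hh' w wr; have [b1 b2] := hh' w1 w1r.
  have close : nm (h' w1 - h' w) <= r0.
    have := nm_tri (h' w1) (h (rC t * w1)) (h' w).
    have := nm_tri (h (rC t * w1)) (h (rC t * w)) (h' w).
    rewrite (nmBC (h (rC t * w)) (h' w)); have := hd1 w1 w1r w1d; lra.
  have := inj (h' w1) (h' w) ltac:(have := M2 _ w1r; lra) ltac:(have := M2 _ wr; lra) close.
  by rewrite a2 b2 => hh; rewrite -(ltr_pM2l c0); lra.
- have zr : nm 0 < r + d by rewrite nm0.
  have [a1 a2] := hh' 0 zr; rewrite mulr0 h0 subr0 in a1.
  have := inj (h' 0) 0 ltac:(lra) ltac:(rewrite nm0; lra) ltac:(rewrite subr0; lra).
  rewrite a2 f0 subrr subr0 nm0 pmulr_rle0 // => hh.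
  by apply/eqP; rewrite -nm_eq0 eq_le hh nm_ge0.
Qed.

(** If every branch stayed below 1 - e, its radius could always be enlarged by the same [d]; but the
    radii are bounded, because [f] is bounded on the unit disc. *)
Lemma max_branch (e : R) : 0 < e < 1 -> exists r r1 h, [/\ 0 < r, r < r1, branch r1 h &
  exists2 w, nm w <= r & 1 - e <= nm (h w)].
Proof.
move=> e01; have /andP[e0 e1] := e01.
have [[r1 [h [w [bh wr hw]]]]|no] := pselect (exists r1 h w, [/\ branch r1 h, nm w < r1 & 1 - e <= nm (h w)]).
  exists (nm w), r1, h; split => //; last by exists w.
  rewrite nm_gt0; apply/eqP => w0; have [_ h0 _] := bh.
  by rewrite w0 h0 nm0 in hw; lra.
have [d d0 ext] := branch_extend e01.
pose S := [set r : R | 0 <= r /\ exists h, branch r h].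
have [B B0 fB] : exists2 B : R, 0 < B & forall z, disc 1 z -> nm (f z) <= B.
  by apply: cpt_bounded; [exact: compact_disc|apply: ccont_on => z _; exact: hasder_ccont (fd z)].
(* At radius 0 the ball is empty, so the constant 0 counts as a branch and starts the extension. *)
have S0 : S 0.
  split=> //; exists (fun=> 0); split => // [z|w].
    by rewrite /bal /=; have := nm_ge0 z; lra.
  by have := nm_ge0 w; lra.
have Sub : has_ubound S.
  exists B => r [r0 [h [_ _ hr]]]; rewrite leNgt; apply/negP => Br.
  have nr : nm (rC ((r + B) / 2)) = (r + B) / 2 by rewrite nm_rC ger0_norm //; lra.
  have [|e2 h1] := hr (rC ((r + B) / 2)); first by rewrite nr; lra.
  by have := fB _ (ltW h1); rewrite e2 nr; lra.
have [r [r0 [h bh]] rs] := sup_adherent d0 (conj (ex_intro _ 0 S0) Sub).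
have [|h' bh'] := ext r h r0 bh.
  move=> w wr; rewrite leNgt; apply/negP => hw; apply: no.
  by exists r, h, w; split => //; exact: ltW.
have : r + d <= sup S.
  by apply: ub_le_sup => //; split; [lra|exists h'].
lra.
Qed.

End MaxBranch.

(** * Polynomial approximation off a spiral *)

Section Runge.
Variable R : realType.
Local Notation C := (Cplx R).

(** Polynomial approximation of 1/(z-b) on [E], written without division and with a relative
    error. *)
Definition approx_inv (E : set C) (b : C) := forall e : R, 0 < e ->
  exists p : {poly C}, forall z, E z -> nm (1 - (z - b) * p.[z]) <= e.

Lemma half_pow (e : R) : 0 < e -> exists n, (1 / 2) ^+ n <= e.
Proof.
move=> e0.
have /cvgrPdist_lt /(_ e e0) := @cvg_expr R (1 / 2) ltac:(rewrite ger0_norm; lra).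
move=> [n _ hn]; exists n; have := hn n (leqnn n).
rewrite sub0r normrN => h; apply: le_trans (ltW h); exact: ler_norm.
Qed.

Lemma geom_nm (r : C) n : nm r <= 1 / 2 -> nm (\sum_(i < n) r ^+ i) <= 4.
Proof.
move=> r2; have e := subrX1 r n.
have r1 : 1 / 2 <= nm (r - 1) by have := nm_subr_ge 1 r; rewrite nm1 nmBC; lra.
have rn : nm (r ^+ n) <= 1.
  by rewrite nmX exprn_ile1 ?nm_ge0 //; lra.
have : nm (r ^+ n - 1) <= 2 by apply: le_trans (nmB _ _) _; rewrite nm1; lra.
rewrite e nmM; have := nm_ge0 (\sum_(i < n) r ^+ i); nra.
Qed.

Lemma nmX_half (r : C) n : nm r <= 1 / 2 -> nm (r ^+ n) <= (1 / 2) ^+ n.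
Proof. by move=> h; rewrite nmX lerXn2r // nnegrE ?nm_ge0 //; lra. Qed.

Lemma horner_geom (c : C) (p : {poly C}) n z :
  (\sum_(i < n) (c *: p) ^+ i).[z] = \sum_(i < n) (c * p.[z]) ^+ i.
Proof.
rewrite horner_sum; apply: eq_bigr => i _.
by rewrite horner_exp hornerZ.
Qed.

(* Pole pushing: [1/(z-b)] is a geometric series in [1/(z-b')]. *)
Lemma approx_push (E : set C) (b b' : C) : approx_inv E b' ->
  (forall z, E z -> 4 * nm (b - b') <= nm (z - b')) -> approx_inv E b.
Proof.
move=> hb' far; have [-> //|bb] := eqVneq b b'.
have bb0 : 0 < nm (b - b') by rewrite nm_gt0 subr_eq0.
move=> e e0; pose e' := Num.min (e / 8) 1.
have e'0 : 0 < e' by rewrite lt_min; apply/andP; split; lra.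
have [e'e e'1] : e' <= e / 8 /\ e' <= 1 by rewrite !ge_min !lexx orbT.
have [p hp] := hb' e' e'0.
have [n hn] := half_pow (e := e / 2) ltac:(lra).
exists (p * \sum_(i < n) ((b - b') *: p) ^+ i) => z Ez.
rewrite hornerM horner_geom; have := hp z Ez; have := far z Ez.
set P := p.[z]; set u := (z - b') * P => fz hu.
set r := (b - b') * P.
have u2 : nm u <= 2.
  by have := nm_subr_ge u 1; rewrite nm1 (nmBC u); lra.
have r2 : nm r <= 1 / 2.
  have : nm r * nm (z - b') = nm (b - b') * nm u by rewrite -!nmM /r /u; congr nm; ring.
  have : nm (b - b') * nm u <= nm (b - b') * 2 by rewrite ler_wpM2l // nm_ge0.
  move=> h1 h2; rewrite -(ler_pM2r (x := nm (z - b'))); lra.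
set S := \sum_(i < n) r ^+ i.
have eS : (1 - r) * S = 1 - r ^+ n by have := subrX1 r n; rewrite -/S => h; rewrite -(opprB (r ^+ n)) h; ring.
have -> : 1 - (z - b) * (P * S) = r ^+ n - (u - 1) * S.
  have -> : (z - b) * (P * S) = (u - 1) * S + (1 - r) * S by rewrite /u /r; ring.
  rewrite eS; ring.
apply: le_trans (nmB _ _) _; rewrite nmM (nmBC u).
have := nmX_half n r2; have := geom_nm n r2; rewrite -/S.
have := nm_ge0 S; have := nm_ge0 (1 - u); nra.
Qed.

(** For a distant pole the approximants are partial sums of the geometric series in z/b. *)
Lemma approx_far (E : set C) (b : C) : b != 0 -> (forall z, E z -> 2 * nm z <= nm b) ->
  approx_inv E b.
Proof.
move=> b0 far e e0; have [n hn] := half_pow e0.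
exists ((- b^-1) *: \sum_(i < n) (b^-1 *: 'X) ^+ i) => z Ez.
rewrite hornerZ horner_geom hornerX; set t := b^-1 * z.
have t2 : nm t <= 1 / 2.
  rewrite /t nmM nmV mulrC ler_pdivrMr ?nm_gt0 //; have := far z Ez; lra.
set S := \sum_(i < n) t ^+ i.
have eS : (1 - t) * S = 1 - t ^+ n by have := subrX1 t n; rewrite -/S => h; rewrite -(opprB (t ^+ n)) h; ring.
have -> : (z - b) * (- b^-1 * S) = (1 - t) * S by rewrite /t; field.
rewrite eS opprB addrC subrK; exact: le_trans (nmX_half n t2) hn.
Qed.

(** The width is measured by a factor [u] near 1, hence is proportional to the modulus;
    multiplication by a point of the spiral then only translates [x]. *)
Definition spiral_nbhd (k : C) (t0 x0 x1 : R) : set C :=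
  [set z | exists x u, [/\ x0 <= x <= x1, nm (u - 1) <= t0 & z = cexp (rC x * k) * u]].

Lemma cexp_near1 (k : C) (e : R) : 0 < e -> exists2 d : R, 0 < d &
  forall s : R, `|s| <= d -> nm (cexp (rC s * k) - 1) <= e.
Proof.
move=> e0; have [d d0 h] := @ccont_cexp R 0 e e0.
exists (d / (2 * (nm k + 1))); first by rewrite divr_gt0 //; have := nm_ge0 k; lra.
move=> s; rewrite ler_pdivlMr; last by have := nm_ge0 k; lra.
move=> sd; have := h (rC s * k); rewrite cexp0 subr0 nmM nm_rC => /(_ _) hh.
by apply/ltW/hh; have := nm_ge0 k; have := normr_ge0 s; nra.
Qed.

(** A pole is pushed from far away to 0 along the opposite spiral -exp(xk), whose distance to the
    set is at least proportional to the modulus. This yields [p] with z p(z) close to 1 on the set,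
    and [B = 1 - z p]. The width [t0] depends on [k] only, not on the length of the spiral. *)
Lemma runge_spiral (k : C) : 0 < complex.Re k -> exists2 t0 : R, 0 < t0 <= 1 / 2 &
  forall x0 x1 : R, exists B : {poly C}, B.[0] = 1 /\
    forall z, spiral_nbhd k t0 x0 x1 z -> nm B.[z] <= 1 / 2.
Proof.
move=> k0; set kx := complex.Re k in k0.
have ncx (x : R) : nm (cexp (rC x * k)) = expR (x * kx).
  by rewrite nm_cexp cReM /= mul0r subr0.
have [d0 d00 hd0] := cexp_near1 k (e := 1 / 2) ltac:(lra).
pose E0 := expR (d0 * kx).
have E01 : 1 < E0 by rewrite expR_gt1 mulr_gt0.
have E0p : 0 < E0 by lra.
have Eq0 : 0 < (E0 - 1) / (4 * E0) by rewrite divr_gt0 //; lra.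
have Eq : (E0 - 1) / (4 * E0) * (4 * E0) = E0 - 1 by rewrite divfK //; apply/lt0r_neq0; lra.
set q := (E0 - 1) / (4 * E0) in Eq0 Eq.
pose t0 := Num.min (1 / 4) q.
have t00 : 0 < t0 by rewrite lt_min Eq0 andbT; lra.
have [t04 t0q] : t0 <= 1 / 4 /\ t0 <= q by rewrite !ge_min !lexx orbT.
clearbody t0 q.
exists t0; first by rewrite t00 /=; lra.
move=> x0 x1; set E := spiral_nbhd k t0 x0 x1.
pose b (x : R) := - cexp (rC x * k).
pose c := Num.min (1 / 2) q.
have c0 : 0 < c by rewrite lt_min Eq0 andbT; lra.
have [c2 cq] : c <= 1 / 2 /\ c <= q by rewrite !ge_min !lexx orbT.
clearbody c.
have qE : q * E0 <= (E0 - 1) / 4 by nra.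
have q1 : q <= E0 - 1 by nra.
(* Nearby parameters give almost antipodal points; parameters more than [d0] apart give spiral
   points whose moduli differ at least by the factor [E0]. *)
have away x z : E z -> c * nm (b x) <= nm (z - b x).
  move=> [x' [u [_ u1 ->]]]; rewrite /b nmN opprK.
  have -> : cexp (rC x' * k) * u + cexp (rC x * k) = cexp (rC x * k) * (cexp (rC (x' - x) * k) * u + 1).
    by rewrite rCD rCN mulrBl cexpB; field; exact: cexp_neq0.
  rewrite nmM mulrC ler_wpM2l ?nm_ge0 //.
  set s := x' - x; set v := cexp (rC s * k).
  have nv : nm v = expR (s * kx) := ncx s.
  have un : nm u <= 1 + t0 by have := nm_subr_ge u 1; rewrite nm1; lra.
  have un' : 1 - t0 <= nm u by have := nm_subr_ge 1 u; rewrite nm1 nmBC; lra.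
  have [sd|sd] := leP `|s| d0.
    have hv := hd0 s sd; rewrite -/v in hv.
    have -> : v * u + 1 = 1 + 1 - (- (v - 1) - v * (u - 1)) by ring.
    have := nm_subr_ge (1 + 1) (- (v - 1) - v * (u - 1)).
    have -> : nm (1 + 1 : C) = 2 by rewrite -rC1 -rCD nm_rC ger0_norm //; lra.
    have := nmB (- (v - 1)) (v * (u - 1)); rewrite nmN nmM.
    have nv2 : nm v <= 3 / 2 by have := nm_subr_ge v 1; rewrite nm1; lra.
    have := nm_ge0 v; have := nm_ge0 (u - 1); nra.
  have [s0|s0] := leP 0 s.
    have vE : E0 <= nm v by rewrite nv ler_expR ler_pM2r //; move: sd; rewrite ger0_norm //; lra.
    have := nm_subr_ge (v * u) (- 1); rewrite opprK nmM nmN nm1.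
    have : E0 * (1 - t0) <= nm v * nm u.
      by apply: ler_pM => //; lra.
    nra.
  have vE : nm v * E0 <= 1.
    rewrite nv -expRD -expR0 ler_expR -mulrDl; move: sd; rewrite ltr0_norm // => sd.
    by rewrite pmulr_lle0 //; lra.
  have := nm_subr_ge 1 (- (v * u)); rewrite opprK nmN nm1 nmM (addrC 1 (v * u)).
  have : nm v * nm u <= nm v * (1 + t0) by rewrite ler_wpM2l // nm_ge0.
  have nv0 := nm_ge0 v.
  have : nm v * (1 + t0) <= nm v + t0.
    have : nm v <= 1 by nra.
    nra.
  have : nm v <= 1 - 4 * q by rewrite -(ler_pM2r E0p); lra.
  lra.
(* c/4 answers the factor 4 required by [approx_push], so a step of length [d1] is allowed
   everywhere on the opposite spiral. *)
have [d1 d10 hd1] := cexp_near1 (- k) (e := c / 4) ltac:(lra).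
have push x : approx_inv E (b x) -> approx_inv E (b (x - d1)).
  move=> hx; apply: (approx_push hx) => z Ez; apply: le_trans (away x z Ez).
  have -> : b (x - d1) - b x = b x * (cexp (rC d1 * - k) - 1).
    by rewrite /b mulrN cexpN rCD rCN mulrBl cexpB; field; exact: cexp_neq0.
  rewrite nmM; have := hd1 d1 ltac:(rewrite ger0_norm; lra); have := nm_ge0 (b x); nra.
(* There |b X| = e^2 |b x1|, and e^2 >= 3 is twice the bound 3/2 on |u|. *)
pose X := x1 + 2 / kx.
have start : approx_inv E (b X).
  apply: approx_far => [|z [x [u [/andP[_ xx1] u1 ->]]]]; first by rewrite oppr_eq0 cexp_neq0.
  rewrite nmM nmN !ncx.
  have un : nm u <= 3 / 2 by have := nm_subr_ge u 1; rewrite nm1; lra.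
  have : expR (x * kx) <= expR (x1 * kx) by rewrite ler_expR ler_pM2r.
  have -> : expR (X * kx) = expR (x1 * kx) * expR 2.
    by rewrite -expRD; congr expR; rewrite /X; field; exact: lt0r_neq0.
  have := expR_ge1Dx (2 : R); have := expR_gt0 (x * kx); have := expR_gt0 (x1 * kx).
  have := nm_ge0 u; nra.
have iter n : approx_inv E (b (X - n%:R * d1)).
  elim: n => [|n IH]; first by rewrite mul0r subr0.
  have -> : X - n.+1%:R * d1 = X - n%:R * d1 - d1 by rewrite -(natr1 n); ring.
  exact: push.
(* Enough steps to reach e^(-10) times the modulus of the inner end, from where the pole can jump to
   0. *)
pose n := (Num.trunc ((X - (x0 - 10 / kx)) / d1)).+1.
have yn : X - n%:R * d1 <= x0 - 10 / kx.
  have : (X - (x0 - 10 / kx)) / d1 < n%:R by rewrite /n truncnS_gt.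
  rewrite ltr_pdivrMr //; lra.
have h0 : approx_inv E 0.
  apply: (approx_push (iter n)) => z [x [u [/andP[xx0 _] u1 ->]]].
  rewrite sub0r nmN; set y := X - n%:R * d1 in yn *.
  have nb : nm (b y) = expR (y * kx) by rewrite nmN ncx.
  have := nm_subr_ge (cexp (rC x * k) * u) (b y); rewrite nmM ncx nb.
  have un' : 3 / 4 <= nm u by have := nm_subr_ge 1 u; rewrite nm1 nmBC; lra.
  have k1 : expR (y * kx) * expR 10 <= expR (x * kx).
    rewrite -expRD ler_expR.
    have : y * kx <= (x - 10 / kx) * kx by rewrite ler_pM2r //; lra.
    have : 10 / kx * kx = 10 by rewrite divfK // lt0r_neq0.
    lra.
  have := expR_ge1Dx (10 : R); have := expR_gt0 (y * kx); have := expR_gt0 (x * kx).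
  nra.
have [p hp] := h0 (1 / 2) ltac:(lra).
exists (1 - 'X * p); split; first by rewrite hornerD hornerN hornerM hornerX hornerC mul0r subr0.
move=> z Ez; have := hp z Ez; rewrite subr0.
by rewrite hornerD hornerN hornerM hornerX hornerC.
Qed.

End Runge.

(** * A branch avoiding spiral channels *)

Section StepField.
Variable R : realType.
Local Notation C := (Cplx R).

Lemma hasderXn n (z : C) : hasder (fun w => w ^+ n) z (n%:R * z ^+ n.-1).
Proof.
have := hasder_horner 'X^n z; rewrite derivXn hornerMn hornerXn -mulr_natl => h.
by apply: hasder_ext h => w; rewrite hornerXn.
Qed.

Lemma natC_neq0 n : (n.+1%:R : C) != 0.
Proof. by rewrite pnatr_eq0. Qed.

Lemma im_mulrn (a : R) n : im a *+ n = im (n%:R * a).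
Proof.
elim: n => [|n IH]; first by rewrite mul0r.
by rewrite mulrS IH -imD -(natr1 n) mulrDl mul1r addrC.
Qed.

Lemma natC_mul n (z : C) : z *+ n = rC n%:R * z.
Proof.
elim: n => [|n IH]; first by rewrite rC0 mul0r.
by rewrite mulrS IH -(natr1 n) rCD rC1; ring.
Qed.

(** With this [g], the function phi = z exp(g(z)) satisfies z phi'/phi = D. *)
Lemma log_primitive (D : {poly C}) : D.[0] = 1 -> exists g : {poly C}, 'X * g^`() = D - 1.
Proof.
move=> D0; exists (\poly_(i < size D) (D`_i / i%:R)); apply/polyP => i.
rewrite coefXM coefB coef1; case: i => [|i] /=.
  by rewrite -horner_coef0 D0 subrr.
rewrite coef_deriv coef_poly subr0; case: ltnP => h.
  by rewrite -[(_ / _) *+ _]mulr_natr divfK // natC_neq0.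
by rewrite mul0rn nth_default.
Qed.

Lemma pow_near1 (e : C) n : n%:R * nm e <= 1 / 2 -> nm ((1 - e) ^+ n - 1) <= 2 * (n%:R * nm e).
Proof.
elim: n => [|n IH]; first by rewrite expr0 subrr nm0 mul0r mulr0.
rewrite -(natr1 n) => h; have e0 := nm_ge0 e; have n0 : 0 <= n%:R :> R by [].
have h' : n%:R * nm e <= 1 / 2 by lra.
have k := IH h'.
have -> : (1 - e) ^+ n.+1 - 1 = ((1 - e) ^+ n - 1) * (1 - e) - e by rewrite exprS; ring.
apply: le_trans (nmB _ _) _; rewrite nmM.
have : nm (1 - e) <= 1 + nm e by have := nmB 1 e; rewrite nm1.
have := nm_ge0 ((1 - e) ^+ n - 1); have := nm_ge0 (1 - e).
set a := nm e in e0 h h' k *; set b := nm (_ - 1) in k *; set c := nm (1 - e).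
set N := n%:R in n0 h h' k *.
move=> c0 b0 ca.
have : b * c <= 2 * (N * a) * (1 + a) by apply: ler_pM.
nra.
Qed.

(* The bound [2 eta] on [|U'|] is available only while [U] is [tau]-close to [1], so the
   estimate and its domain of validity are propagated together. *)
Lemma stay_close (U : C -> C) (S' tau eta : R) : 0 < S' -> 0 < tau -> 0 < eta -> 2 * eta * S' <= tau / 2 ->
  (forall s : R, ccont U (rC s)) -> U (rC 0) = 1 ->
  (forall s : R, 0 <= s <= S' -> nm (U (rC s) - 1) <= tau -> exists2 d, hasder U (rC s) d & nm d <= 2 * eta) ->
  forall s : R, 0 <= s <= S' -> nm (U (rC s) - 1) <= 2 * eta * s.
Proof.
move=> S'0 tau0 eta0 etaS cU U0 Ubound.
have seg (s t v : R) : segp (rC s) (rC t) v = rC (s + v * (t - s)).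
  by rewrite /segp -rCN -rCD -rCM -rCD.
apply: (@real_ind R 0 S' (fun s => nm (U (rC s) - 1) <= 2 * eta * s)).
- exact: ltW.
- by rewrite U0 subrr nm0 mulr0.
- move=> t /andP[t00' tS] Pt.
  have [d d0 hd] := cU t (tau / 2) ltac:(lra).
  have Ptau : 2 * eta * t <= tau / 2 by apply: le_trans etaS; rewrite ler_pM2l //; lra.
  exists (t + d / 2); first lra.
  move=> s /andP[ts sd] sS.
  have : nm (U (rC s) - U (rC t)) <= 2 * eta * nm (rC s - rC t).
    apply: mvt_seg => v /andP[v0 v1]; rewrite seg.
    apply: Ubound; first by apply/andP; split; nra.
    have := hd (rC (t + v * (s - t))); rewrite -rCN -rCD nm_rC.
    have -> : t + v * (s - t) - t = v * (s - t) by ring.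
    rewrite ger0_norm; last nra.
    move=> /(_ ltac:(nra)) h1.
    have := nm_tri (U (rC (t + v * (s - t)))) (U (rC t)) 1; lra.
  rewrite -rCN -rCD nm_rC ger0_norm; last lra.
  have := nm_tri (U (rC s)) (U (rC t)) 1; lra.
- move=> t /andP[t00' tS] Pt; apply/ler_addgt0Pr => e e0.
  have [d d0 hd] := cU t e e0.
  pose s := Num.max 0 (t - d / 2).
  have s00 : 0 <= s by rewrite le_max lexx.
  have st : s < t by rewrite gt_max t00' /=; lra.
  have sd : t - d / 2 <= s by rewrite le_max lexx orbT.
  have := Pt s ltac:(lra); have := hd (rC s).
  rewrite -rCN -rCD nm_rC distrC ger0_norm; last lra.
  move=> /(_ ltac:(lra)); rewrite nmBC => h1 h2.
  have := nm_tri (U (rC t)) (U (rC s)) 1.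
  have : 2 * eta * s <= 2 * eta * t by rewrite ler_pM2l //; lra.
  lra.
Qed.

Section Construction.
Variables (q : nat) (th x0 Mr : R).
Hypotheses (q0 : (0 < q)%N) (th0 : 0 < th < pi / 2) (x00 : x0 < 0) (Mr2 : 2 <= Mr).

Let sg : R := cos th / sin th.
Let k1 : C := Complex 1 sg.

(** D must pass from 1 at 0 to nearly e^(i th) on the spiral without vanishing on a large disc. The
    single factor 1 + (e^(i th) - 1)(1 - B^m) could vanish, so the passage is made in N equal
    factors, each with e^(i th/N), where N is large compared with the bound of 1 - B^m on the
    disc. *)
Lemma field_poly (t0 eta : R) (B : {poly C}) : 0 < eta -> B.[0] = 1 ->
  (forall z, spiral_nbhd (rC q%:R * k1) t0 x0 1 z -> nm B.[z] <= 1 / 2) ->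
  exists D : {poly C}, [/\ D.[0] = 1, forall z, nm z <= Mr -> D.[z ^+ q] != 0 &
    forall z, spiral_nbhd (rC q%:R * k1) t0 x0 1 z ->
      D.[z] != 0 /\ nm (D.[z]^-1 - cexp (im (- th))) <= eta].
Proof.
move=> eta0 B0 Bs.
pose y := Num.min (eta / 8) (1 / 8).
have y0 : 0 < y by rewrite lt_min; apply/andP; split; lra.
have [ye y8] : y <= eta / 8 /\ y <= 1 / 8 by rewrite !ge_min !lexx orbT.
have [m hm] := half_pow y0.
have [Bd Bd0 hBd] : exists2 Bd : R, 0 < Bd & forall z, disc Mr z -> nm (1 - B.[z ^+ q] ^+ m) <= Bd.
  apply: (cpt_bounded (f := fun z : C => 1 - B.[z ^+ q] ^+ m)); first exact: compact_disc.
  apply: ccont_on => z _.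
  have h1 := ccont_comp (ccontX q (ccont_id z)) (ccont_horner B (z ^+ q)).
  have h2 := ccontM (ccont_cst (-1) z) (ccontX m h1).
  have := ccontD (ccont_cst 1 z) h2; apply: ccont_ext => w; ring.
pose N := (Num.trunc (2 * Bd)).+1.
have NB : 2 * Bd < N%:R by rewrite /N truncnS_gt.
have N0 : (0 : R) < N%:R by [].
pose dl := cexp (im (th / N%:R)).
have th2 : th < 2.
  by have /andP[] := th0; have := @pihalf_lt2 R; lra.
have th0' : 0 < th by case/andP: th0.
have dl1 : nm (dl - 1) <= th / N%:R.
  by apply: le_trans (nm_cexp_im_sub1 _) _; rewrite ger0_norm // divr_ge0 // ltW.
have dl0 : dl != 0 by exact: cexp_neq0.
have ndl : nm dl = 1 by exact: nm_cexp_im.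
have dlN : dl ^+ N = cexp (im th).
  by rewrite cexpXn im_mulrn mulrC divfK // gt_eqF.
exists ((1 + (dl - 1)%:P * (1 - B ^+ m)) ^+ N).
have ev z : ((1 + (dl - 1)%:P * (1 - B ^+ m)) ^+ N).[z] = (1 + (dl - 1) * (1 - B.[z] ^+ m)) ^+ N.
  by rewrite horner_exp hornerD hornerM hornerD hornerN horner_exp !hornerC.
split=> [|z zM|z zs].
- by rewrite ev B0 expr1n subrr mulr0 addr0 expr1n.
- rewrite ev expf_neq0 //; apply/eqP => e.
  have : (dl - 1) * (1 - B.[z ^+ q] ^+ m) = - 1 by rewrite -[in LHS](addKr 1 (_ * _)) e addr0.
  move/(congr1 (@nm R)); rewrite nmN nm1 nmM => e1.
  have h1 := hBd z zM; have h2 := nm_ge0 (1 - B.[z ^+ q] ^+ m).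
  have : nm (dl - 1) * N%:R <= th by rewrite -ler_pdivlMr.
  have := nm_ge0 (dl - 1); nra.
- rewrite ev; have hB := Bs z zs; set b := B.[z] ^+ m.
  have hb : nm b <= y by apply: le_trans (nmX_half m hB) hm.
  pose e := (1 - dl^-1) * b.
  (* N |dl - 1| <= th < 2, so this bound on the error of the N-th power does not depend on [N];
     hence [m] could be fixed before [N]. *)
  have ne : N%:R * nm e <= 2 * y.
    have -> : e = (dl - 1) / dl * b by rewrite /e; field.
    rewrite !nmM nmV ndl invr1 mulr1.
    have : nm (dl - 1) * N%:R <= th by rewrite -ler_pdivlMr.
    have := nm_ge0 (dl - 1); have := nm_ge0 b; nra.
  have eD : 1 + (dl - 1) * (1 - b) = dl * (1 - e) by rewrite /e; field.
  have k := pow_near1 (e := e) (n := N) ltac:(lra).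
  rewrite eD exprMn dlN; set P := (1 - e) ^+ N in k *.
  have P2 : 1 / 2 <= nm P by have := nm_subr_ge 1 P; rewrite nm1 nmBC; lra.
  have Pn0 : P != 0 by rewrite -nm_gt0; lra.
  have cn0 := cexp_neq0 (im th).
  split; first by rewrite mulf_neq0.
  have -> : (cexp (im th) * P)^-1 - cexp (im (- th)) = - (cexp (im th))^-1 * (P - 1) / P.
    by rewrite imN cexpN; field; rewrite ?cn0 ?Pn0.
  rewrite !nmM nmN !nmV nm_cexp_im invr1 mul1r ler_pdivrMr; last lra.
  nra.
Qed.

(** The q-th powers of all the channels lie on the single spiral exp(x q k1), which is why the
    approximation is done in the variable z^q. *)
Definition on_channel (z : C) := exists x (k : int), x0 <= x <= 0 /\
  z = cexp (rC x * k1 + im (2 * pi * k%:~R / q%:R)).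

(* The rotation flow of [phi] in the disc follows the channel outwards, because there
   [z phi'/phi] is close to [exp(i th)]: a branch meeting a channel would leave the unit disc. *)
Lemma step_field : exists phi dphi : C -> C,
  [/\ forall z, hasder phi z (dphi z), forall z, ccont dphi z,
      forall z, nm z <= Mr -> dphi z != 0, phi 0 = 0 &
      (forall m z, m ^+ q = 1 -> phi (m * z) = m * phi z) /\
      (forall r h, branch phi r h -> forall w, nm w < r -> ~ on_channel (h w))].
Proof.
have th0' : 0 < th by case/andP: th0.
have x00' := x00; have Mr2' := Mr2.
have s0 : 0 < sin th by apply: sin_gt0_pi; have := pi_gt0 R; case/andP: th0; lra.
(* i e^(-i th) is the velocity of log z along the rotation flow of [phi] where z phi'/phi = e^(i
   th). Its direction is 1 + i cot(th), whence the slope [sg]. *)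
pose kap : C := Complex (sin th) (cos th).
have kapE : kap = rC (sin th) * k1.
  by apply: complex_ext; rewrite ?cReM ?cImM /=; rewrite /sg; field; exact: lt0r_neq0.
have kapE' : kap = im 1 * cexp (im (- th)).
  by apply: complex_ext; rewrite ?cReM ?cImM /cexp /= expR0 cosN sinN; ring.
have q0R : (0 : R) < q%:R by rewrite ltr0n.
have [|t0 /andP[t00 t02] hR] := @runge_spiral R (rC q%:R * k1).
  by rewrite cReM /= mul0r subr0 mulr1.
have [B [B0 Bs]] := hR x0 1.
have [t1 t10 ht1] := ccontX q (ccont_id (1 : C)) t00.
pose tau := Num.min (t1 / 2) (1 / 2).
have tau0 : 0 < tau by rewrite lt_min; apply/andP; split; lra.
have [taut tau2] : tau <= t1 / 2 /\ tau <= 1 / 2 by rewrite !ge_min !lexx orbT.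
clearbody tau.
(* The longest time needed, at the ideal speed [sin th], to bring the log-modulus from the channel
   up to 1; [eta] then makes the total deviation at most [tau / 2]. *)
pose S : R := (1 - x0) / sin th.
have S0 : 0 < S by rewrite divr_gt0 //; lra.
pose eta : R := tau / (4 * S).
have eta0 : 0 < eta by rewrite divr_gt0 //; lra.
have etaS : 2 * eta * S = tau / 2 by rewrite /eta; field; exact: lt0r_neq0.
have [D [D0 Dn0 Ds]] := field_poly eta0 B0 Bs.
have [g hg] := log_primitive D0.
pose cq : C := (q%:R)^-1.
have qC0 : (q%:R : C) != 0 by rewrite pnatr_eq0 -lt0n.
pose G z := cq * g.[z ^+ q].
pose phi z := z * cexp (G z); pose dphi z := cexp (G z) * D.[z ^+ q].
have hD z : z ^+ q * g^`().[z ^+ q] = D.[z ^+ q] - 1.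
  by have := congr1 (fun p => p.[z ^+ q]) hg; rewrite hornerM hornerX hornerD hornerN hornerC.
have dG z : hasder G z (cq * (g^`().[z ^+ q] * (q%:R * z ^+ q.-1))).
  have h1 := hasder_comp (hasderXn q z) (hasder_horner g (z ^+ q)).
  by have := hasderM (hasder_cst cq z) h1; rewrite mul0r add0r.
have dphiP z : hasder phi z (dphi z).
  have := hasderM (hasder_id z) (hasder_comp (dG z) (hasder_cexp (G z))).
  rewrite /dphi; congr (hasder _ _ _).
  have -> : D.[z ^+ q] = 1 + z ^+ q * g^`().[z ^+ q] by rewrite hD addrC subrK.
  set g1 := g^`().[z ^+ q]; set E := cexp (G z).
  have -> : z ^+ q = z * z ^+ q.-1 by rewrite -exprS prednK.
  by rewrite /cq /=; field.
have cG z : ccont G z := hasder_ccont (dG z).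
have cphi z : ccont dphi z.
  apply: ccontM; first exact: ccont_comp (cG z) (ccont_cexp _).
  exact: ccont_comp (ccontX q (ccont_id z)) (ccont_horner D _).
have dn0 z : nm z <= Mr -> dphi z != 0.
  by move=> zM; rewrite mulf_neq0 ?cexp_neq0 // Dn0.
exists phi, dphi; split => //; first by rewrite /phi mul0r.
split=> [m z m1|r h [hc h0 hr] w0 w0r [x [k [/andP[x0x x1] ez]]]].
  by rewrite /phi /G exprMn m1 mul1r mulrA.
set z0 := h w0 in ez.
have z00 : z0 != 0 by rewrite ez cexp_neq0.
have rot (s : R) : nm (w0 * cexp (im 1 * rC s)) < r.
  by rewrite nmM (mulrC (im 1)) -imM nm_cexp_im mulr1.
pose Z c := h (w0 * cexp (im 1 * c)).
(* Quotient of the true trajectory by the ideal one; its logarithmic derivative is i/D - kap. *)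
pose U c := Z c * (cexp (- (kap * c)) / z0).
have hM w : nm w < r -> nm (h w) < Mr by move=> wr; have [_] := hr w wr; lra.
have dZ (s : R) : hasder Z (rC s) ((dphi (Z (rC s)))^-1 * (w0 * (cexp (im 1 * rC s) * im 1))).
  have hh := branch_hasder dphiP dn0 hc (fun w wr => (hr w wr).1) hM (rot s).
  apply: hasder_comp (_ : hasder (fun c => w0 * cexp (im 1 * c)) (rC s) _) hh.
  have h1 := hasderM (hasder_cst (im 1) (rC s)) (hasder_id (rC s)).
  have := hasderM (hasder_cst w0 (rC s)) (hasder_comp h1 (hasder_cexp _)).
  by rewrite !mul0r !add0r mulr1.
have dU (s : R) : D.[Z (rC s) ^+ q] != 0 ->
    hasder U (rC s) ((im 1 / D.[Z (rC s) ^+ q] - kap) * U (rC s)).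
  move=> Dz.
  have h1 : hasder (fun c => cexp (- (kap * c)) / z0) (rC s) (cexp (- (kap * rC s)) * - kap / z0).
    have h2 := hasderM (hasder_cst (- kap) (rC s)) (hasder_id (rC s)).
    have := hasderM (hasder_comp h2 (hasder_cexp _)) (hasder_cst z0^-1 (rC s)).
    rewrite mul0r add0r mulr1 mulr0 addr0 mulNr.
    by apply: hasder_ext => c; rewrite mulNr.
  have := hasderM (dZ s) h1; rewrite /U; congr (hasder _ _ _).
  have dz : dphi (Z (rC s)) != 0 by apply: dn0; apply/ltW/hM/rot.
  have pz : w0 * cexp (im 1 * rC s) = phi (Z (rC s)) by rewrite (hr _ (rot s)).1.
  have -> : w0 * (cexp (im 1 * rC s) * im 1) = phi (Z (rC s)) * im 1 by rewrite -pz; ring.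
  rewrite /phi /dphi; field; rewrite z00 Dz cexp_neq0 //.
have ZU (s : R) : Z (rC s) = cexp (rC (x + s * sin th) * k1 + im (2 * pi * k%:~R / q%:R)) * U (rC s).
  rewrite /U.
  have -> : cexp (rC (x + s * sin th) * k1 + im (2 * pi * k%:~R / q%:R)) = z0 * cexp (kap * rC s).
    rewrite ez -cexpD; congr cexp; rewrite kapE rCD rCM; ring.
  by rewrite cexpN; field; rewrite z00 cexp_neq0.
pose S' : R := (1 - x) / sin th.
have S'0 : 0 < S' by rewrite divr_gt0 //; lra.
have S'S : S' <= S by rewrite ler_pM2r ?invr_gt0 //; lra.
have S's : S' * sin th = 1 - x by rewrite divfK // lt0r_neq0.
have inE (s : R) : 0 <= s <= S' -> nm (U (rC s) - 1) <= tau ->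
    spiral_nbhd (rC q%:R * k1) t0 x0 1 (Z (rC s) ^+ q).
  move=> /andP[s00 sS] Us; exists (x + s * sin th), (U (rC s) ^+ q); split.
  - by apply/andP; split; [|rewrite -[leRHS](subrKC x) lerD2l -S's ler_pM2r]; first nra.
  - apply: ltW; have := ht1 (U (rC s)); rewrite expr1n; apply; lra.
  - rewrite ZU exprMn cexpXn natC_mul; congr (_ * _).
    have -> : rC q%:R * (rC (x + s * sin th) * k1 + im (2 * pi * k%:~R / q%:R)) =
       rC (x + s * sin th) * (rC q%:R * k1) + im (2 * pi * k%:~R).
      rewrite mulrDr -imM; congr (_ + im _); last by field; exact: lt0r_neq0.
      by ring.
    by rewrite cexpD cexp_im2pi mulr1.
have Ubound (s : R) : 0 <= s <= S' -> nm (U (rC s) - 1) <= tau ->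
    exists2 d, hasder U (rC s) d & nm d <= 2 * eta.
  move=> ss Us; have [Dz De] := Ds _ (inE s ss Us).
  exists ((im 1 / D.[Z (rC s) ^+ q] - kap) * U (rC s)); first exact: dU.
  rewrite kapE' -mulrBr nmM nmM nm_im normr1 mul1r.
  have : nm (U (rC s)) <= 2 by have := nm_subr_ge (U (rC s)) 1; rewrite nm1; lra.
  by move=> Y2; rewrite [leLHS]mulrC; apply: ler_pM; rewrite ?nm_ge0 //; exact: De.
have cU (s : R) : ccont U (rC s).
  apply: ccontM; first exact: hasder_ccont (dZ s).
  apply: ccontM (ccont_cst _ _).
  apply: ccont_comp (ccont_cexp _).
  have := ccontM (ccont_cst (- kap) (rC s)) (ccont_id (rC s)); apply: ccont_ext => c; exact: mulNr.
have U0 : U (rC 0) = 1.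
  by rewrite /U /Z rC0 !mulr0 cexp0 mulr1 oppr0 cexp0 mul1r divff.
have S'le : 2 * eta * S' <= tau / 2 by rewrite -etaS ler_pM2l //; lra.
have main := stay_close S'0 tau0 eta0 S'le cU U0 Ubound.
(* At time [S'] the ideal trajectory has modulus e >= 2 and the quotient has modulus at least 1/2,
   contradicting |h| < 1. *)
have e2 := main S' ltac:(by rewrite lexx ltW).
have [_] := hr _ (rot S'); rewrite -/(Z (rC S')) ZU nmM nm_cexp cReD cReM /= mul0r subr0 mulr1 addr0.
rewrite S's subrKC => hh.
have : 1 / 2 <= nm (U (rC S')) by have := nm_subr_ge 1 (U (rC S')); rewrite nm1 nmBC; lra.
have := expR_ge1Dx (1 : R); nra.
Qed.

End Construction.
End StepField.

(** * Path lifting and a crossing lemma *)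

Section Crossing.
Variable R : realType.
Local Notation C := (Cplx R).

Lemma pconton_sub (a b c d : R) (g : R -> C) : a <= c -> d <= b -> pconton a b g -> pconton c d g.
Proof.
move=> ac db cg t tcd e e0; have [|r r0 h] := cg t _ e e0; first lra.
by exists r => // s scd; apply: h; lra.
Qed.

Lemma pconton_paste (a m b : R) (f g : R -> C) : pconton a m f -> pconton m b g -> f m = g m ->
  pconton a b (fun t => if t <= m then f t else g t).
Proof.
move=> cf cg fg t tab e e0; have [tm|tm|tm] := ltgtP t m.
- have [d d0 h] := cf t ltac:(lra) e e0.
  exists (Num.min d (m - t)); first by rewrite lt_min d0 subr_gt0.
  move=> s sab; rewrite lt_min => /andP[s1 s2].
  have s4 : s <= m by move: s2; rewrite ltr_norml; lra.
  by rewrite s4; apply: h => //; lra.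
- have [d d0 h] := cg t ltac:(lra) e e0.
  exists (Num.min d (t - m)); first by rewrite lt_min d0 subr_gt0.
  move=> s sab; rewrite lt_min => /andP[s1 s2].
  have s3 : m < s by move: s2; rewrite ltr_norml; lra.
  by rewrite leNgt s3 /=; apply: h => //; lra.
- move: tab; rewrite tm => /andP[am mb].
  have [d1 d10 h1] := cf m ltac:(lra) e e0.
  have [d2 d20 h2] := cg m ltac:(lra) e e0.
  exists (Num.min d1 d2); first by rewrite lt_min d10.
  move=> s sab; rewrite lt_min => /andP[s1 s2].
  case: (leP s m) => sm; first by apply: h1 => //; lra.
  by rewrite fg; apply: h2 => //; lra.
Qed.

(** The inverse function theorem at 0 gives a logarithm [l] near 1. Applied to g(u)/g(t0), it
    extends a lift past [t0] over a uniform length, because |g| is bounded below. *)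
Lemma cexp_lift (g : R -> C) (a b : R) (w0 : C) : a <= b -> pconton a b g ->
  (forall t, a <= t <= b -> g t != 0) -> cexp w0 = g a ->
  exists w : R -> C, [/\ pconton a b w, w a = w0 & forall t, a <= t <= b -> cexp (w t) = g t].
Proof.
move=> ab cg g0 ew.
have [r r0 [c c0 [inj surj]]] := qift (M := 3) (@hasder_cexp R) (@ccont_cexp R) (fun z _ => cexp_neq0 z).
pose s := Num.min (r / 2) 1.
have s0 : 0 < s by rewrite lt_min ltr01 andbT; lra.
have [sr s1] : s <= r / 2 /\ s <= 1 by rewrite !ge_min !lexx orbT.
clearbody s.
have /choice [l hl] : forall v : C, exists z, nm (v - 1) < c * s -> nm z <= s /\ cexp z = v.
  move=> v; have [h|h] := ltP (nm (v - 1)) (c * s); last by exists 0.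
  have [||z z1 z2] := surj 0 s v _ _ ltac:(by rewrite cexp0).
  - by rewrite s0; lra.
  - by rewrite nm0; lra.
  - by exists z; rewrite subr0 in z1.
have linj v v' : nm (v - 1) < c * s -> nm (v' - 1) < c * s -> c * nm (l v - l v') <= nm (v - v').
  move=> hv hv'; have [a1 a2] := hl v hv; have [b1 b2] := hl v' hv'.
  have := inj (l v) (l v') ltac:(lra) ltac:(lra); rewrite a2 b2; apply.
  by apply: le_trans (nmB _ _) _; lra.
have cs0 : 0 < c * s by rewrite mulr_gt0.
have l1 : l 1 = 0.
  have [|a1 a2] := hl 1; first by rewrite subrr nm0.
  have := inj (l 1) 0 ltac:(lra) ltac:(rewrite nm0; lra).
  rewrite subr0 a2 cexp0 subrr nm0 pmulr_rle0 // => /(_ ltac:(lra)) h.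
  by apply/eqP; rewrite -nm_eq0 eq_le h nm_ge0.
have [m m0 gm] : exists2 m : R, 0 < m & forall t, a <= t <= b -> m <= nm (g t).
  apply: (@itv_unif R a b (fun d t => d <= nm (g t))) => [d d' x _ h1 h2|x xab]; first exact: le_trans h1 h2.
  have gx : 0 < nm (g x) by rewrite nm_gt0 g0.
  have [d d0 h] := cg x xab (nm (g x) / 2) ltac:(lra).
  exists d => //; exists (nm (g x) / 2); first lra.
  by move=> y yab yx; have := h y yab yx; have := nm_subr_ge (g x) (g y); rewrite nmBC; lra.
have [d d0 gd] := pconton_unif (e := c * s * m) ltac:(by rewrite mulr_gt0) cg.
pose lift t := exists w : R -> C, [/\ pconton a t w, w a = w0 & forall u, a <= u <= t -> cexp (w u) = g u].
have ext t0 t1 : a <= t0 -> t0 <= t1 -> t1 <= b -> t1 - t0 < d -> lift t0 -> lift t1.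
  move=> at0 t01 t1b tt [w [cw wa hw]].
  have gt0 : g t0 != 0 by apply: g0; lra.
  have ratio u : t0 <= u <= t1 -> nm (g u / g t0 - 1) < c * s.
    move=> u01; have -> : g u / g t0 - 1 = (g u - g t0) / g t0 by field.
    rewrite nmM nmV ltr_pdivrMr ?nm_gt0 //.
    have /andP[u0 u1] := u01; have t0b := le_trans t01 t1b.
    have := gd u t0 ltac:(by rewrite (le_trans at0 u0) (le_trans u1 t1b)) ltac:(by rewrite at0).
    rewrite ger0_norm ?subr_ge0 // => /(_ (le_lt_trans (lerB u1 (lexx t0)) tt)) h1.
    apply: lt_le_trans h1 _; rewrite ler_pM2l ?mulr_gt0 //; apply: gm; by rewrite at0.
  exists (fun u => if u <= t0 then w u else w t0 + l (g u / g t0)); split.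
  - apply: pconton_paste cw _ _; last by rewrite divff // l1 addr0.
    move=> u u01 e e0; have [k k0 hk] := cg u ltac:(lra) (c * e * nm (g t0)) ltac:(by rewrite !mulr_gt0 // nm_gt0).
    exists k => // v v01 vu.
    have -> : w t0 + l (g v / g t0) - (w t0 + l (g u / g t0)) = l (g v / g t0) - l (g u / g t0) by ring.
    have := linj _ _ (ratio v v01) (ratio u u01).
    have -> : g v / g t0 - g u / g t0 = (g v - g u) / g t0 by field.
    rewrite nmM nmV => h1; rewrite -(ltr_pM2l c0); apply: le_lt_trans h1 _.
    by rewrite ltr_pdivrMr ?nm_gt0 //; apply: hk => //; lra.
  - by rewrite at0.
  - move=> u u01; case: leP => ut; first by apply: hw; lra.
    have ut1 : t0 <= u <= t1 by lra.
    rewrite cexpD hw ?(hl _ (ratio u ut1)).2; last lra.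
    by rewrite mulrC divfK.
apply: (@real_ind R a b lift) => //.
- exists (fun=> w0); split => //; first by move=> t _ e e0; exists 1 => // u _ _; rewrite subrr nm0.
  by move=> u /andP[u1 u2]; have -> : u = a by [apply/eqP; rewrite eq_le u1 u2].
- move=> t tab lt; exists (t + d / 2); first lra.
  by move=> u tu ub; apply: (ext t u) => //; lra.
- move=> t tab lt; pose u := Num.max a (t - d / 2).
  have au : a <= u by rewrite le_max lexx.
  have ut : u < t by rewrite gt_max; lra.
  have ud : t - d / 2 <= u by rewrite le_max lexx orbT.
  by apply: (ext u t) => //; [lra|lra|lra|apply: lt; lra].
- by rewrite lexx ab.
Qed.

Lemma ge0_near (x x1 mu : R) : mu <= `|x| -> `|x1 - x| < mu -> (0 <= x1) = (0 <= x).
Proof.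
rewrite ltr_norml => xm /andP[h1 h2].
have [x0|x0] := leP 0 x; [move: xm; rewrite ger0_norm // => xm|move: xm; rewrite ltr0_norm // => xm].
  lra.
by apply/negbTE; rewrite -ltNge; lra.
Qed.

Lemma gt0_near (x x1 mu : R) : mu <= `|x| -> `|x1 - x| < mu -> (0 < x1) = (0 < x).
Proof.
move=> xm h; rewrite !ltNge -(oppr_ge0 x) -(oppr_ge0 x1) (@ge0_near (- x) (- x1) mu) ?normrN //.
by rewrite -opprD normrN.
Qed.

Section Grid.
Variables (F : nat -> nat -> C) (N : nat) (mu : R).
Hypothesis mu0 : 0 < mu.
Hypothesis Fbig : forall i j, (i <= N)%N -> (j <= N)%N -> 4 * mu <= nm (F i j).
Hypothesis Fi : forall i j, (i < N)%N -> (j <= N)%N -> nm (F i.+1 j - F i j) < mu / 2.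
Hypothesis Fj : forall i j, (i <= N)%N -> (j < N)%N -> nm (F i j.+1 - F i j) < mu / 2.

Let up (z : C) := 0 <= complex.Im z.
Let rt (z : C) := 0 < complex.Re z.
Let crs (z w : C) := (up z (+) up w) && rt z.

(** On a small square all values are within [mu] of [F i j], whose modulus is at least [4 * mu].
    Either the imaginary parts keep their sign and nothing crosses, or the real parts keep theirs
    and the changes of side around the square are counted all or none. *)
Lemma grid_square i j : (i < N)%N -> (j < N)%N ->
  crs (F i j) (F i j.+1) (+) crs (F i.+1 j) (F i.+1 j.+1) =
  crs (F i j) (F i.+1 j) (+) crs (F i j.+1) (F i.+1 j.+1).
Proof.
move=> iN jN.
have m0 := mu0.
have k00 := Fbig (ltnW iN) (ltnW jN).
have n1 := Fi iN (ltnW jN); have n2 := Fj (ltnW iN) jN; have n3 := Fj iN jN.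
have n4 : nm (F i.+1 j.+1 - F i j) < mu.
  by have := nm_tri (F i.+1 j.+1) (F i.+1 j) (F i j); lra.
have close z : nm (z - F i j) < mu ->
   `|complex.Re z - complex.Re (F i j)| < mu /\ `|complex.Im z - complex.Im (F i j)| < mu.
  move=> h; have := Re_le_nm (z - F i j); have := Im_le_nm (z - F i j).
  by rewrite cReD cReN cImD cImN; lra.
have [a1 a2] := close (F i.+1 j) ltac:(lra).
have [b1 b2] := close (F i j.+1) ltac:(lra).
have [c1 c2] := close _ n4.
have big := nm_le_ReIm (F i j).
rewrite /crs /up /rt.
move: a1 a2 b1 b2 c1 c2 big; set x := complex.Re (F i j); set y := complex.Im (F i j).
set x1 := complex.Re _; set y1 := complex.Im (F i.+1 j).
set x2 := complex.Re (F i j.+1); set y2 := complex.Im (F i j.+1).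
set x3 := complex.Re (F i.+1 j.+1); set y3 := complex.Im (F i.+1 j.+1).
move=> a1 a2 b1 b2 c1 c2 big.
have [yb|ys] := leP mu `|y|.
  by rewrite !(ge0_near yb a2, ge0_near yb b2, ge0_near yb c2) !addbb.
have xb : mu <= `|x| by lra.
rewrite !(gt0_near xb a1, gt0_near xb b1).
by move: (0 < x) (0 <= y) (0 <= y1) (0 <= y2) (0 <= y3) => [] [] [] [] [].
Qed.

(* The parity of the number of crossings of the positive real axis along a vertical
   grid line does not depend on the line. *)
Lemma grid_parity :
  (forall j, (j <= N)%N -> 0 < complex.Re (F 0 j)) -> (forall j, (j <= N)%N -> complex.Re (F N j) < 0) ->
  (forall i, (i <= N)%N -> complex.Im (F i 0) < 0) -> (forall i, (i <= N)%N -> 0 < complex.Im (F i N)) ->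
  False.
Proof.
move=> left right bot top.
pose V i n := \big[addb/false]_(j < n) crs (F i j) (F i j.+1).
have col i n : (i < N)%N -> (n <= N)%N ->
    V i n (+) V i.+1 n = crs (F i 0) (F i.+1 0) (+) crs (F i n) (F i.+1 n).
  move=> iN; elim: n => [|n IH] nN; first by rewrite /V !big_ord0 !addbb.
  rewrite /V !big_ord_recr /= addbACA -/(V i n) -/(V i.+1 n) IH; last exact: ltnW.
  rewrite grid_square //.
  by case: (crs (F i 0) _); case: (crs (F i n) (F i.+1 n)); case: (crs (F i n.+1) _).
have col0 i : (i < N)%N -> V i N = V i.+1 N.
  move=> iN; have := col i N iN (leqnn N).
  rewrite /crs /up; have := bot i (ltnW iN); have := bot i.+1 iN.
  have := top i (ltnW iN); have := top i.+1 iN.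
  move=> h1 h2 h3 h4; rewrite !(ltW h1) !(ltW h2) (leNgt 0 (complex.Im (F i 0))) h4.
  rewrite (leNgt 0 (complex.Im (F i.+1 0))) h3 /=.
  by case: (V i N); case: (V i.+1 N).
have all_eq i : (i <= N)%N -> V 0 N = V i N.
  elim: i => [//|i IH iN]; exact: etrans (IH (ltnW iN)) (col0 i iN).
have VN : V N N = false.
  rewrite /V big1 // => j _; rewrite /crs /rt; have := right j (ltnW (ltn_ord j)).
  by move=> h; rewrite (ltNge 0) (ltW h) /= andbF.
have V0 n : (n <= N)%N -> V 0 n = up (F 0 0) (+) up (F 0 n).
  elim: n => [|n IH] nN; first by rewrite /V big_ord0 addbb.
  rewrite /V big_ord_recr /= -/(V 0 n) IH; last exact: ltnW.
  rewrite /crs /rt left ?(ltnW nN) // andbT.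
  by case: (up (F 0 0)); case: (up (F 0 n)); case: (up (F 0 n.+1)).
have := all_eq N (leqnn N); rewrite VN V0 // /up.
by rewrite (leNgt 0 (complex.Im (F 0 0))) bot // (ltW (top 0%N isT)).
Qed.

End Grid.

(** For disjoint paths [P s - Q t] has no zero on the rectangle of parameters, while on the four
    sides its values stay in four successive half-planes, as for a curve winding once around 0. On a
    fine grid [grid_parity] excludes this. *)
Lemma crossing (P Q : R -> C) (a b c d A B Y1 Y2 : R) : a <= b -> c <= d ->
  pconton a b P -> pconton c d Q ->
  B <= complex.Re (P a) -> complex.Re (P b) <= A ->
  (forall s, a <= s <= b -> Y1 < complex.Im (P s) < Y2) ->
  (forall t, c <= t <= d -> A < complex.Re (Q t) < B) ->
  Y2 <= complex.Im (Q c) -> complex.Im (Q d) <= Y1 ->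
  exists s t, [/\ a <= s <= b, c <= t <= d & P s = Q t].
Proof.
move=> ab cd cP cQ Pa Pb PY QX Qc Qd; apply: contrapT => no.
have ne s t : a <= s <= b -> c <= t <= d -> P s - Q t != 0.
  by move=> sab tcd; rewrite subr_eq0; apply/eqP => e; apply: no; exists s, t.
have loc s : a <= s <= b -> exists2 m : R, 0 < m & forall t, c <= t <= d -> m <= nm (P s - Q t).
  move=> sab; apply: (@itv_unif R c d (fun m t => m <= nm (P s - Q t))) => [m m' x _ h1 h2|t tcd]; first exact: le_trans h1 h2.
  have n0 : 0 < nm (P s - Q t) by rewrite nm_gt0 ne.
  have [e e0 h] := cQ t tcd (nm (P s - Q t) / 2) ltac:(lra).
  exists e => //; exists (nm (P s - Q t) / 2); first lra.
  by move=> y ycd yt; have := h y ycd yt; have := nm_tri (P s) (Q y) (Q t); lra.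
have [m m0 hm] : exists2 m : R, 0 < m & forall s, a <= s <= b -> forall t, c <= t <= d -> m <= nm (P s - Q t).
  apply: (@itv_unif R a b (fun m s => forall t, c <= t <= d -> m <= nm (P s - Q t))) => [m m' x _ h1 h2 t tcd|s sab].
    exact: le_trans h1 (h2 t tcd).
  have [m m0 hm] := loc s sab; have [e e0 h] := cP s sab (m / 2) ltac:(lra).
  exists e => //; exists (m / 2); first lra.
  move=> y yab ys t tcd; have := h y yab ys; have := hm t tcd; have := nm_tri (P s) (P y) (Q t).
  by rewrite (nmBC (P s) (P y)); lra.
pose mu := m / 4.
have mu20 : 0 < mu / 2 by rewrite /mu; lra.
have [d1 d10 h1] := pconton_unif mu20 cP.
have [d2 d20 h2] := pconton_unif mu20 cQ.
pose N := (Num.trunc (Num.max ((b - a) / d1) ((d - c) / d2))).+1.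
have hN : Num.max ((b - a) / d1) ((d - c) / d2) < N%:R by rewrite /N truncnS_gt.
have N0 : (0 : R) < N%:R by [].
have [N1 N2] : b - a < N%:R * d1 /\ d - c < N%:R * d2.
  by move: hN; rewrite gt_max !ltr_pdivrMr // => /andP.
pose x i := a + i%:R * ((b - a) / N%:R); pose y j := c + j%:R * ((d - c) / N%:R).
have ba0 : 0 <= (b - a) / N%:R by rewrite divr_ge0 //; lra.
have dc0 : 0 <= (d - c) / N%:R by rewrite divr_ge0 //; lra.
have xN : x N = b by rewrite /x mulrC divfK ?gt_eqF // subrKC.
have yN : y N = d by rewrite /y mulrC divfK ?gt_eqF // subrKC.
have x0 : x 0%N = a by rewrite /x mul0r addr0.
have y0 : y 0%N = c by rewrite /y mul0r addr0.
have xab i : (i <= N)%N -> a <= x i <= b.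
  move=> iN; rewrite /x lerDl mulr_ge0 //= -[leRHS]xN /x lerD2l ler_wpM2r // ler_nat //.
have ycd j : (j <= N)%N -> c <= y j <= d.
  move=> jN; rewrite /y lerDl mulr_ge0 //= -[leRHS]yN /y lerD2l ler_wpM2r // ler_nat //.
have xs i : x i.+1 - x i = (b - a) / N%:R by rewrite /x -(natr1 i); ring.
have ys j : y j.+1 - y j = (d - c) / N%:R by rewrite /y -(natr1 j); ring.
apply: (@grid_parity (fun i j => P (x i) - Q (y j)) N mu).
- by rewrite /mu; lra.
- by move=> i j iN jN; have := hm _ (xab i iN) _ (ycd j jN); rewrite /mu; lra.
- move=> i j iN jN; have -> : P (x i.+1) - Q (y j) - (P (x i) - Q (y j)) = P (x i.+1) - P (x i) by ring.
  apply: h1; [exact: xab|exact: xab (ltnW iN)|].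
  by rewrite xs ger0_norm // ltr_pdivrMr // mulrC.
- move=> i j iN jN; have -> : P (x i) - Q (y j.+1) - (P (x i) - Q (y j)) = - (Q (y j.+1) - Q (y j)) by ring.
  rewrite nmN; apply: h2; [exact: ycd|exact: ycd (ltnW jN)|].
  by rewrite ys ger0_norm // ltr_pdivrMr // mulrC.
- by move=> j jN; rewrite x0 cReD cReN; have := QX _ (ycd j jN); lra.
- by move=> j jN; rewrite xN cReD cReN; have := QX _ (ycd j jN); lra.
- by move=> i iN; rewrite y0 cImD cImN; have := PY _ (xab i iN); lra.
- by move=> i iN; rewrite yN cImD cImN; have := PY _ (xab i iN); lra.
Qed.

End Crossing.

(** * The Anosov-Katok induction *)

Section Levels.
Variable R : realType.
Local Notation C := (Cplx R).

(** [lH] is defined on the whole plane but only locally injective, so its inverse [lh] on the disc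
    of radius [lr] is part of the data. This radius is to exceed 1, which keeps the closed unit disc
    in the interior of the domain. *)
Record lev := Lev {
  lH : C -> C; ldH : C -> C; lh : C -> C; lr : R;
  lf : C -> C; ldf : C -> C; lq : nat; la : R; lb : R }.

(* [H] straightens the invariant disc [h(disc 1)], on which [f] is the rotation of
   rational angle [la]; [lb] is the total size allowed to all later perturbations. *)
Record level_ok (s : lev) : Prop := Inv {
  inv_d : forall z, hasder (lH s) z (ldH s z);
  inv_dc : forall z, ccont (ldH s) z;
  inv_d0 : forall z, nm z <= 5 -> ldH s z != 0;
  inv_0 : lH s 0 = 0;
  inv_r : 1 < lr s;
  inv_h : branch (lH s) (lr s) (lh s);
  inv_q : (0 < lq s)%N;
  inv_a : exists p : int, la s * (lq s)%:R = p%:~R;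
  inv_f : forall z, nm z < 3 -> [/\ lH s (lf s z) = rot_mult (la s) * lH s z,
    nm (lf s z - z) <= 1 - lb s, hasder (lf s) z (ldf s z) & nm (ldf s z - 1) <= 1 / 2 - lb s];
  inv_f0 : lf s 0 = 0;
  inv_b : 0 < lb s <= 1 / 4 }.

(** The first disc has radius 1/2. With the budget 1/4, each of its points will have points of [K]
    within 1/12, so [K] does not shrink to 0. *)
Definition lev0 : lev :=
  Lev (fun z => rC 2 * z) (fun=> rC 2) (fun z => rC (1 / 2) * z) (3 / 2) id (fun=> 1) 1 0 (1 / 4).

Lemma rot_mult0 : rot_mult (0 : R) = 1.
Proof. by rewrite rot_multE mulr0 cexp0. Qed.

Lemma rC_neq0 (a : R) : a != 0 -> rC a != 0 :> C.
Proof. by move=> a0; rewrite -nm_gt0 nm_rC normr_gt0. Qed.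

Lemma inv_lev0 : level_ok lev0.
Proof.
split=> //=.
- move=> z; have := hasderM (hasder_cst (rC 2) z) (hasder_id z).
  by rewrite mul0r add0r mulr1.
- by move=> z; exact: ccont_cst.
- by move=> z _; apply: rC_neq0.
- by rewrite mulr0.
- lra.
- split=> [||w wr].
  + by apply: ccont_on => z _; apply: ccontM (ccont_cst _ _) (ccont_id _).
  + by rewrite mulr0.
  + split; first by rewrite mulrA -rCM (_ : 2 * (1 / 2) = 1) ?rC1 ?mul1r //; lra.
    by rewrite nmM nm_rC ger0_norm; lra.
- by exists 0; rewrite mul0r.
- move=> z _; rewrite rot_mult0 mul1r !subrr nm0; split => //; try lra.
  exact: hasder_id.
- lra.
Qed.

Lemma rot_mult_dist (a b : R) : nm (rot_mult a - rot_mult b) <= 2 * pi * `|a - b|.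
Proof.
rewrite !rot_multE; have p0 := pi_gt0 R.
have -> : cexp (im (2 * pi * a)) - cexp (im (2 * pi * b)) =
  cexp (im (2 * pi * b)) * (cexp (im (2 * pi * (a - b))) - 1).
  by rewrite mulrBr (mulrBr (2 * pi)) imD imN cexpB; field; exact: cexp_neq0.
rewrite nmM nm_cexp_im mul1r; apply: le_trans (nm_cexp_im_sub1 _) _.
by rewrite normrM ger0_norm //; lra.
Qed.

Lemma nm_rot_mult (a : R) : nm (rot_mult a) = 1.
Proof. by rewrite rot_multE nm_cexp_im. Qed.

Lemma rot_mult_pow (a : R) (q : nat) (p : int) : a * q%:R = p%:~R -> rot_mult a ^+ q = 1.
Proof.
move=> e; rewrite rot_multE cexpXn im_mulrn.
by have -> : q%:R * (2 * pi * a) = 2 * pi * p%:~R by [rewrite -e; ring]; exact: cexp_im2pi.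
Qed.

Section Step.
Variable s : lev.
Hypothesis I : level_ok s.
Let H := lH s.
Let dH := ldH s.
Let h := lh s.

(** [f' z] is the solution of [H (f' z) = rot_mult a' * H z] near [lf s z]. As [lf s] moves a point
    with |z| < 3 by at most 1, the solutions stay in the disc of radius 5, where [dH] is nonzero. *)
Lemma perturb_f (e : R) : 0 < e <= 1 -> exists2 t0 : R, 0 < t0 &
  forall a', `|a' - la s| <= t0 -> exists f' df' : C -> C,
    [/\ forall z, nm z < 3 -> H (f' z) = rot_mult a' * H z,
        forall z, nm z < 3 -> nm (f' z - lf s z) <= e /\ nm (df' z - ldf s z) <= e,
        forall z, nm z < 3 -> hasder f' z (df' z) & f' 0 = 0].
Proof.
move=> /andP[e0 e1]; have [b0 b4] := andP (inv_b I).
have Hd : forall z, hasder H z (dH z) := inv_d I.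
have dHc : forall z, ccont dH z := inv_dc I.
have dH0 : forall z, nm z <= 5 -> dH z != 0 := inv_d0 I.
have [r r0 [c c0 [inj surj]]] := qift Hd dHc dH0.
have cd := @compact_disc R 5.
have [B B0 hB] : exists2 B : R, 0 < B & forall z, disc 5 z -> nm (H z) <= B.
  by apply: cpt_bounded cd _; apply: ccont_on => z _; exact: hasder_ccont (Hd z).
have [B1 B10 hB1] : exists2 B : R, 0 < B & forall z, disc 5 z -> nm (dH z) <= B.
  by apply: cpt_bounded cd _; apply: ccont_on => z _.
have [m m0 hm] : exists2 m : R, 0 < m & forall z, disc 5 z -> m <= nm (dH z).
  by apply: cpt_away0 cd _ _ => //; apply: ccont_on => z _.
pose eta := m * m * e / (2 * B1).
have eta0 : 0 < eta by rewrite divr_gt0 ?mulr_gt0.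
have [d d0 hd] : exists2 d : R, 0 < d & forall z w, disc 5 z -> nm (w - z) < d -> nm (dH w - dH z) < eta.
  apply: (@cconton_unif R (disc 5) setT) => //; first by move=> z _; exists 1.
  by apply: ccont_on => z _.
pose t := Num.min (Num.min (r / 4) (d / 2)) e.
have t0 : 0 < t by rewrite !lt_min e0 andbT; apply/andP; split; lra.
have [tr [td te]] : t <= r / 4 /\ t <= d / 2 /\ t <= e by rewrite !ge_min !lexx !orbT.
clearbody t.
have p0 := pi_gt0 R.
(* The first bound makes the equation solvable within distance [t]; the second, together with [eta],
   keeps each of the two terms of the derivative error below e/2. *)
pose T := Num.min (c * t / (4 * pi * B)) (m * e / (4 * pi * B1)).
have T0 : 0 < T by rewrite lt_min !divr_gt0 ?mulr_gt0 //; lra.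
have [T1 T2] : T <= c * t / (4 * pi * B) /\ T <= m * e / (4 * pi * B1) by rewrite !ge_min !lexx orbT.
exists T => // a' aa.
pose l := rot_mult (la s); pose l' := rot_mult a'.
have ll : nm (l' - l) <= 2 * pi * T.
  by apply: le_trans (rot_mult_dist _ _) _; rewrite ler_pM2l //; lra.
have TB : 2 * pi * T * B <= c * t / 2.
  have : T * (4 * pi * B) <= c * t by rewrite -ler_pdivlMr // ?mulr_gt0 //; lra.
  lra.
have TB1 : 2 * pi * T * B1 <= m * e / 2.
  have : T * (4 * pi * B1) <= m * e by rewrite -ler_pdivlMr // ?mulr_gt0 //; lra.
  lra.
have f4 z : nm z < 3 -> nm (lf s z) < 4.
  by move=> z3; have [_ h1 _ _] := inv_f I z3; have := nm_subr_ge (lf s z) z; lra.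
clear b0 b4 T0 T1 T2 aa.
have D5 (z : C) : nm z < 3 -> disc 5 z by move=> z3; apply: le_trans (ltW z3) _; rewrite ler_nat.
have Df5 z : nm z < 3 -> disc 5 (lf s z) by move=> /f4 z4; apply: le_trans (ltW z4) _; rewrite ler_nat.
have /choice [f' hf'] : forall z, exists z', nm z < 3 -> nm (z' - lf s z) <= t /\ H z' = l' * H z.
  move=> z; have [z3|z3] := ltP (nm z) 3; last by exists 0.
  have [Hf _ _ _] := inv_f I z3.
  have [|||z' h1 h2] := surj (lf s z) t (l' * H z).
  - by rewrite t0 /=; apply: le_trans tr _; rewrite ler_pdivrMr // ler_peMr ?ler1n // ltW.
  - by have := f4 z z3; lra.
  - have -> : H (lf s z) = l * H z := Hf.
    rewrite -mulrBl nmM.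
    have : nm (l' - l) * nm (H z) <= 2 * pi * T * B.
      by apply: ler_pM; [exact: nm_ge0|exact: nm_ge0|exact: ll|exact: hB (D5 z z3)].
    by have := mulr_gt0 c0 t0; lra.
  - by exists z'.
have f'5 z : nm z < 3 -> nm (f' z) <= 5.
  by move=> z3; have [k1 _] := hf' z z3; have := nm_subr_ge (f' z) (lf s z); have := f4 z z3; lra.
clear surj TB e1.
have cf' z : nm z < 3 -> ccont f' z.
  move=> z3 k k0; have [_ _ dfz _] := inv_f I z3.
  have [d1 d10 h1] := hasder_ccont dfz (e := r / 4) ltac:(lra).
  have [d2 d20 h2] := hasder_ccont (Hd z) (e := c * k) ltac:(by rewrite mulr_gt0).
  exists (Num.min (3 - nm z) (Num.min d1 d2)); first by rewrite !lt_min d10 d20 subr_gt0 z3.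
  move=> w; rewrite !lt_min => /and3P[w1 w2 w3].
  have w3' : nm w < 3 := nm_lt_near w1.
  have [a1 a2] := hf' z z3; have [b1 b2] := hf' w w3'.
  have close : nm (f' w - f' z) <= r.
    have := nm_tri (f' w) (lf s w) (f' z); have := nm_tri (lf s w) (lf s z) (f' z).
    by rewrite (nmBC (lf s z) (f' z)); have := h1 w w2; lra.
  have := inj _ _ (f'5 w w3') (f'5 z z3) close; rewrite a2 b2 -mulrBr nmM nm_rot_mult mul1r => hh.
  by rewrite -(ltr_pM2l c0); apply: le_lt_trans hh (h2 w w3).
have t_lt_d : t < d by lra.
clear f4 td.
pose df' z := l' * dH z / dH (f' z).
exists f', df'; split.
- by move=> z z3; exact: (hf' z z3).2.
- move=> z z3; have [a1 a2] := hf' z z3; split; first exact: le_trans a1 te.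
  have dfz : ldf s z = l * dH z / dH (lf s z).
    have [_ _ dfz _] := inv_f I z3; apply: hasder_uniq dfz _.
    have hk : hasder (fun w => l * H w) z (l * dH z).
      by have := hasderM (hasder_cst l z) (Hd z); rewrite mul0r add0r.
    apply: (hasder_implicit (Hd (lf s z)) (dH0 _ (Df5 z z3)) hk).
      by have [_ _ dfz _] := inv_f I z3; exact: hasder_ccont dfz.
    exists (3 - nm z); first by rewrite subr_gt0.
    by move=> w /nm_lt_near w3; have [] := inv_f I w3.
  have f0 := dH0 _ (Df5 z z3); have f'0 := dH0 _ (f'5 z z3).
  have -> : df' z - ldf s z = (l' - l) * dH z / dH (f' z)
     - l * dH z * (dH (f' z) - dH (lf s z)) / (dH (f' z) * dH (lf s z)).
    by rewrite dfz /df'; field; rewrite ?f0 ?f'0.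
  apply: le_trans (nmB _ _) _; rewrite !nmM !nmV nmM nm_rot_mult mul1r.
  have z5 := hB1 z (D5 z z3); have m1 := hm _ (f'5 z z3 : disc 5 _); have m2 := hm _ (Df5 z z3).
  have hdd := hd (lf s z) (f' z) (Df5 z z3) (le_lt_trans a1 t_lt_d).
  set X := nm (dH z) in z5 *; set Y := nm (dH (f' z)) in m1 *; set Z := nm (dH (lf s z)) in m2 *.
  have X0 : 0 <= X := nm_ge0 _.
  have Y0 : 0 < Y := lt_le_trans m0 m1; have Z0 : 0 < Z := lt_le_trans m0 m2.
  have p1 : nm (l' - l) * X / Y <= e / 2.
    rewrite ler_pdivrMr //.
    have : nm (l' - l) * X <= 2 * pi * T * B1 by apply: ler_pM => //; exact: nm_ge0.
    have : m * e <= Y * e by rewrite ler_wpM2r // ltW.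
    lra.
  have p2 : X * nm (dH (f' z) - dH (lf s z)) / (Y * Z) <= e / 2.
    rewrite ler_pdivrMr ?mulr_gt0 //.
    have : X * nm (dH (f' z) - dH (lf s z)) <= B1 * eta by apply: ler_pM => //; [exact: nm_ge0|exact: ltW].
    have -> : B1 * eta = m * m * e / 2 by rewrite /eta; field; exact: lt0r_neq0.
    have : m * m <= Y * Z by apply: ler_pM => //; exact: ltW.
    move=> q1 q2; have : m * m * e <= Y * Z * e by rewrite ler_wpM2r // ltW.
    lra.
  lra.
- move=> z z3.
  have hk : hasder (fun w => l' * H w) z (l' * dH z).
    by have := hasderM (hasder_cst l' z) (Hd z); rewrite mul0r add0r.
  apply: (hasder_implicit (Hd (f' z)) (dH0 _ (f'5 z z3)) hk (cf' z z3)).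
  exists (3 - nm z); first by rewrite subr_gt0.
  by move=> w /nm_lt_near w3; exact: (hf' w w3).2.
- have z3 : nm (0 : C) < 3 by rewrite nm0.
  have [a1 a2] := hf' 0 z3; rewrite (inv_f0 I) subr0 in a1.
  have H0 : H 0 = 0 := inv_0 I.
  have := inj (f' 0) 0 (f'5 0 z3) ltac:(by rewrite nm0 ler0n) ltac:(rewrite subr0; lra).
  rewrite a2 H0 mulr0 !subr0 nm0 pmulr_rle0 // => hh.
  by apply/eqP; rewrite -nm_eq0 eq_le hh nm_ge0.
Qed.

(** A point near the image of the closed unit disc is itself a value of [h], with a nearby
    coordinate. This gives [st_tip] its room for later perturbations. *)
Lemma unif_open (e : R) : 0 < e -> exists2 b : R, 0 < b & forall w0 z, nm w0 <= 1 ->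
  nm (z - h w0) <= b -> [/\ nm (H z - w0) < e, nm (H z) < lr s & h (H z) = z].
Proof.
move=> e0; have [hc h0 hr] := inv_h I; have r1 := inv_r I.
have Hd : forall z, hasder H z (dH z) := inv_d I.
have [r r0 [c c0 [inj surj]]] := qift Hd (inv_dc I) (inv_d0 I).
have [d d0 hd] : exists2 d : R, 0 < d & forall z w, disc 1 z -> nm (w - z) < d -> nm (h w - h z) < r / 2.
  apply: (@cconton_unif R (disc 1) (bal (lr s))) => //; [exact: compact_disc|lra|].
  move=> z z1; exists (lr s - 1); first lra.
  by move=> w wz; rewrite /bal /=; rewrite /disc /= in z1; have := nm_subr_ge w z; lra.
pose e' := Num.min e (Num.min d (lr s - 1)).
have e'0 : 0 < e' by rewrite !lt_min e0 d0 subr_gt0.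
have [e1 [e2 e3]] : e' <= e /\ e' <= d /\ e' <= lr s - 1 by rewrite !ge_min !lexx !orbT.
clearbody e'.
have [b b0 hb] : exists2 b : R, 0 < b & forall z w, disc 1 z -> nm (w - z) < b -> nm (H w - H z) < e'.
  apply: (@cconton_unif R (disc 1) setT) => //; [exact: compact_disc|by move=> z _; exists 1|].
  by apply: ccont_on => z _; exact: hasder_ccont (Hd z).
pose b' := Num.min (b / 2) (Num.min (r / 2) 1).
have b'0 : 0 < b' by rewrite !lt_min ltr01 andbT; apply/andP; split; lra.
have [b1 [b2 b3]] : b' <= b / 2 /\ b' <= r / 2 /\ b' <= 1 by rewrite !ge_min !lexx !orbT.
exists b' => // w0 z w01 zw.
have w0r : nm w0 < lr s by lra.
have [Hh h1] := hr w0 w0r.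
have Hh' : H (h w0) = w0 := Hh.
have := hb (h w0) z (ltW h1) ltac:(lra); rewrite Hh' => k1.
have k2 : nm (H z) < lr s by have := nm_subr_ge (H z) w0; lra.
split => //; first lra.
have k3 := hd w0 (H z) w01 ltac:(lra).
have [k4 k5] := hr _ k2.
have k4' : H (h (H z)) = H z := k4.
have := inj (h (H z)) z ltac:(lra) ltac:(have := nm_subr_ge z (h w0); lra).
rewrite k4' subrr nm0 pmulr_rle0 // => hh.
have := hh ltac:(have := nm_tri (h (H z)) (h w0) z; rewrite (nmBC (h w0)); lra).
by move=> h6; apply/eqP; rewrite -subr_eq0 -nm_eq0 eq_le h6 nm_ge0.
Qed.

End Step.
End Levels.

(** * Construction of the next level *)

Section StepExistence.
Variable R : realType.
Local Notation C := (Cplx R).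
Local Notation lev := (lev R).

Definition chan (q : nat) (sg x0 : R) (z : C) := exists x (k : int), x0 <= x <= 0 /\
  z = cexp (rC x * Complex 1 sg + im (2 * pi * k%:~R / q%:R)).

(* [st_wall]: the sector around a channel mouth, down to the radius reached after one turn,
   has small image; [st_tip]: a point of the new disc, stable under later perturbations, at
   the outer end of the arm between two given channels. *)
Record step (n : nat) (s s' : lev) (hs : C -> C) (sg x0 : R) : Prop := Step {
  st_f : forall z, nm z < 3 ->
    nm (lf s' z - lf s z) <= lb s / 4 /\ nm (ldf s' z - ldf s z) <= lb s / 4;
  st_q : exists N, [/\ (n.+2 <= N)%N, lq s' = (lq s * N)%N & la s' = la s + (lq s')%:R^-1];
  st_b : lb s' <= lb s / 4;
  st_h : forall w, nm w < lr s' -> lh s' w = lh s (hs w) /\ nm (hs w) < 1;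
  st_dens : forall w, nm w <= 1 -> exists2 w', nm w' <= 1 & nm (lh s w - lh s' w') <= lb s / 4;
  st_chan : forall w, nm w < lr s' -> ~ chan (lq s') sg x0 (hs w);
  st_fill : forall (k : int) w, nm w <= 1 -> exists2 x, x0 <= x <= 0 &
    nm (lh s (cexp (rC x * Complex 1 sg + im (2 * pi * k%:~R / (lq s')%:R))) - lh s w) <= lb s / 4;
  st_wall : forall r y y', expR (- (2 * pi / sg)) <= r <= 1 ->
    `|y - y'| <= 8 * pi / (lq s')%:R ->
    nm (lh s (rC r * cexp (im y)) - lh s (cexp (im y'))) <= lb s / 4;
  st_x0 : x0 <= - (2 * pi / sg);
  st_sg : 0 < sg;
  st_tip : forall k : int, exists2 w', nm w' <= 1 &
    forall z, nm (z - lh s' w') <= lb s' -> exists w, [/\ z = lh s (cexp w),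
      - (2 * pi / (lq s')%:R) < sg * complex.Re w, complex.Re w < 0 &
      - (2 * pi * k%:~R / (lq s')%:R) < sg * complex.Re w - complex.Im w
        < - (2 * pi * k%:~R / (lq s')%:R) + 2 * pi / (lq s')%:R] }.

Lemma ivt_C (g : R -> C) (F : C -> R) (a b L v : R) : a <= b -> 0 < L -> pconton a b g ->
  (forall z w, `|F z - F w| <= L * nm (z - w)) -> F (g a) <= v <= F (g b) ->
  exists2 t, a <= t <= b & F (g t) = v.
Proof.
move=> ab L0 cg FL /andP[va vb].
have cF : {within `[a, b], continuous (F \o g)}.
  apply/subspace_continuousP => t; rewrite /= in_itv /= => tab.
  apply/cvgrPdist_lt => e e0; have [d d0 hd] := cg t tab (e / L) ltac:(by rewrite divr_gt0).
  apply/nbhs_ballP; exists d => // x; rewrite /ball /= distrC => xt.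
  rewrite in_itv /= => xab; rewrite distrC; apply: le_lt_trans (FL _ _) _.
  by rewrite mulrC -ltr_pdivlMr //; exact: hd.
have [|t] := IVT ab cF (v := v).
  by rewrite /= ge_min va le_max vb orbT.
by rewrite in_itv /= => tab; exists t.
Qed.

Lemma polar (z : C) : exists t : R, z = rC (nm z) * cexp (im t).
Proof.
have [->|z0] := eqVneq z 0; first by exists 0; rewrite nm0 mul0r.
have [w <-] := cexp_surj z0; exists (complex.Im w); rewrite nm_cexp.
by apply: complex_ext; rewrite ?cReM ?cImM /cexp /= expR0; ring.
Qed.

Lemma rC_cexp (x y : R) : rC (expR x) * cexp (im y) = cexp (rC x + im y).
Proof. by apply: complex_ext; rewrite ?cReM ?cImM /cexp /= expR0 ?addr0 ?add0r; ring. Qed.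

Lemma expRN_ge (x : R) : 1 - x <= expR (- x).
Proof. by have := expR_ge1Dx (- x). Qed.

Lemma pi_lt4 : pi < 4 :> R.
Proof. by have := @pihalf_lt2 R; lra. Qed.

Lemma branch_sym (f df : C -> C) (q : nat) r (h : C -> C) (m : C) : (forall z, hasder f z (df z)) ->
  (forall z, ccont df z) -> (forall z, nm z <= 2 -> df z != 0) ->
  (forall m z, m ^+ q = 1 -> f (m * z) = m * f z) -> branch f r h -> m ^+ q = 1 -> nm m = 1 ->
  forall w, nm w < r -> h (m * w) = m * h w.
Proof.
move=> fd dfc df0 eq [hc h0 hr] mq m1.
have mr w : nm w < r -> nm (m * w) < r by rewrite nmM m1 mul1r.
apply: (lift_uniq fd dfc df0) => [z zr e e0|z zr e e0|w wr|].
- have [d d0 hd] := hc _ (mr z zr) e e0; exists d => // w wr wz.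
  apply: hd; first exact: mr.
  by rewrite -mulrBr nmM m1 mul1r.
- have [d d0 hd] := hc z zr e e0; exists d => // w wr wz.
  by rewrite -mulrBr nmM m1 mul1r; apply: hd.
- have [e1 h1] := hr _ (mr w wr); have [e2 h2] := hr _ wr.
  by rewrite eq // e1 e2 nmM m1 mul1r; split => //; lra.
- by rewrite mulr0 h0 mulr0.
Qed.

Lemma near_rotation (q : nat) (rad : R) (y w : C) : (0 < q)%N -> 0 < rad -> nm y = rad -> rad <= nm w ->
  exists j : int, nm (cexp (im (2 * pi * j%:~R / q%:R)) * y - w) <= (nm w - rad) + rad * (2 * pi / q%:R).
Proof.
move=> q0 rad0 ny rw; have p0 := pi_gt0 R.
have q0R : (0 : R) < q%:R by rewrite ltr0n.
have [a ea] := polar y; have [b eb] := polar w.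
pose u : R := 2 * pi / q%:R; have u0 : 0 < u by rewrite divr_gt0 //; lra.
pose j := Num.floor ((b - a) / u).
have h1 := floor_le_tmp ((b - a) / u); have h2 := floorD1_gt ((b - a) / u).
rewrite -/j in h1 h2.
have k1 : j%:~R * u <= b - a by rewrite -ler_pdivlMr.
have k2 : b - a < (j%:~R + 1) * u by rewrite -ltr_pdivrMr //; move: h2; rewrite intrD.
exists j; have -> : 2 * pi * j%:~R / q%:R = j%:~R * u by rewrite /u; ring.
pose t := b - a - j%:~R * u.
have -> : cexp (im (j%:~R * u)) * y - w =
   - ((rC (nm w - rad) + rC rad * (cexp (im t) - 1) - rC (nm w - rad) * (1 - cexp (im t))) * cexp (im (a + j%:~R * u))).
  rewrite {1}ea {1}eb ny.
  have -> : b = t + (a + j%:~R * u) by rewrite /t; ring.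
  rewrite (imD t) (imD a) !cexpD rCD rCN; ring.
have -> : rC (nm w - rad) + rC rad * (cexp (im t) - 1) - rC (nm w - rad) * (1 - cexp (im t)) =
   rC (nm w - rad) * cexp (im t) + rC rad * (cexp (im t) - 1) by ring.
rewrite nmN nmM nm_cexp_im mulr1; apply: le_trans (nmD _ _) _; rewrite !nmM !nm_rC nm_cexp_im mulr1.
rewrite !ger0_norm; [|lra|lra].
rewrite lerD2l ler_pM2l //; apply: le_trans (nm_cexp_im_sub1 _) _.
have eu : u = 2 * pi / q%:R by []; rewrite ger0_norm /t; lra.
Qed.


(** The spiral passes through the argument of [w] once per turn, and a turn changes the modulus by
    the factor exp(2 pi/sg), close to 1. If [w] is too small for this, the inner end of the spiral
    is close to 0, hence to [w]. *)
Lemma step_fill (d sg x0 : R) (k : int) (q : nat) (w : C) : 0 < d <= 1 -> 0 < sg -> 2 * pi / sg <= d / 8 ->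
  x0 < 0 -> expR x0 <= d / 8 -> nm w <= 1 -> exists2 x, x0 <= x <= 0 &
    nm (cexp (rC x * Complex 1 sg + im (2 * pi * k%:~R / q%:R)) - w) < d.
Proof.
move=> /andP[d0 d1] sg0 sgd x00 x0d w1; have p0 := pi_gt0 R.
set tk := 2 * pi * k%:~R / q%:R; set v := 2 * pi / sg in sgd.
have form x : cexp (rC x * Complex 1 sg + im tk) = rC (expR x) * cexp (im (sg * x + tk)).
  by rewrite rC_cexp; congr cexp; apply: complex_ext; rewrite ?cReD ?cImD ?cReM ?cImM /=; ring.
have v0 : 0 < v by rewrite divr_gt0 //; lra.
have [t et] := polar w; set r := nm w in et w1.
have r0 : 0 <= r := nm_ge0 w.
have [rbig|rsmall] := leP (expR (x0 + v)) r; last first.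
  exists x0; first by rewrite lexx ltW.
  rewrite form; apply: le_lt_trans (nmB _ _) _; rewrite nmM nm_cexp_im mulr1 nm_rC ger0_norm ?expR_ge0 //.
  rewrite -/r; move: rsmall; rewrite expRD => rsmall.
  have : expR v <= 2.
    have := expRN_ge v; rewrite expRN => h.
    have : 1 / 2 <= (expR v)^-1 by lra.
    have ev0 := expR_gt0 v; rewrite -[leRHS]mul1r ler_pdivlMr //; lra.
  have := expR_gt0 x0; have := expR_gt0 v; nra.
have rp : 0 < r by apply: lt_le_trans rbig; exact: expR_gt0.
have lr1 : ln r <= 0 by rewrite -ln1 ler_ln // ?posrE //.
have elr : expR (ln r) = r by rewrite lnK // posrE.
have lrx : x0 + v <= ln r by rewrite -ler_expR elr.
pose j := Num.floor ((sg * ln r - t + tk) / (2 * pi)).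
have h1 := floor_le_tmp ((sg * ln r - t + tk) / (2 * pi)).
have h2 := floorD1_gt ((sg * ln r - t + tk) / (2 * pi)).
rewrite -/j in h1 h2; have p20 : 0 < 2 * pi :> R by lra.
have k1 : j%:~R * (2 * pi) <= sg * ln r - t + tk by rewrite -ler_pdivlMr.
have k2 : sg * ln r - t + tk < (j%:~R + 1) * (2 * pi) by rewrite -ltr_pdivrMr //; move: h2; rewrite intrD.
have svp : sg * v = 2 * pi by rewrite /v mulrC divfK // gt_eqF.
pose x := (t - tk + j%:~R * (2 * pi)) / sg.
have sx : sg * x = t - tk + j%:~R * (2 * pi) by rewrite /x mulrC divfK // gt_eqF.
have xle : x <= ln r by rewrite -(ler_pM2l sg0); lra.
have xge : ln r - v <= x by rewrite -(ler_pM2l sg0); lra.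
exists x; first by apply/andP; split; lra.
rewrite form sx; have -> : t - tk + j%:~R * (2 * pi) + tk = t + 2 * pi * j%:~R by ring.
rewrite imD cexpD cexp_im2pi mulr1 et -mulrBl -rCN -rCD nmM nm_cexp_im mulr1 nm_rC.
have e1 : expR x <= r by rewrite -elr ler_expR.
rewrite distrC ger0_norm; last lra.
have e2 : r * expR (- v) <= expR x by rewrite -elr -expRD ler_expR.
have := expRN_ge v; nra.
Qed.


(** [sg = 16 pi/d] makes one turn multiply the modulus by e^(d/8), and exp(8/d + 1) >= 8/d makes the
    inner end small. *)
Lemma step_scales (d : R) : 0 < d <= 1 -> exists th x0, [/\ 0 < th < pi / 2, 0 < cos th / sin th,
  2 * pi / (cos th / sin th) = d / 8, x0 <= - 1 & expR x0 <= d / 8].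
Proof.
move=> /andP[d0 d1]; have p0 := pi_gt0 R.
pose sg : R := 16 * pi / d.
have sg0 : 0 < sg by rewrite divr_gt0 //; lra.
have sge : 2 * pi = d / 8 * sg by rewrite /sg; field; exact: lt0r_neq0.
have sgd : 2 * pi / sg = d / 8 by rewrite sge mulfK // gt_eqF.
have isg : 0 < sg^-1 by rewrite invr_gt0.
have th0 : 0 < atan sg^-1 < pi / 2.
  by rewrite atan_ltpi2 andbT -(@atan0 R); apply: lt_atan.
have sgE : cos (atan sg^-1) / sin (atan sg^-1) = sg.
  have := @atanK R sg^-1; rewrite /tan => et.
  by rewrite -invf_div et invrK.
have d8 : 0 < 8 / d by rewrite divr_gt0.
exists (atan sg^-1), (- (8 / d + 1)); rewrite sgE; split => //; first lra.
have dd : 0 < d / 8 by lra.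
rewrite expRN -[leRHS]invrK lef_pV2 ?posrE ?invr_gt0 ?expR_gt0 //.
by rewrite invf_div; have := expR_ge1Dx (8 / d + 1 : R); lra.
Qed.

(** Since [p] avoids the channels, the quantity sg Re - Im of its logarithm lies strictly between
    two multiples of 2 pi/q, and a rotation by a multiple of 2 pi/q shifts it into the prescribed
    interval. The strict inequalities persist on a small disc. *)
Lemma step_tip (q : nat) (sg x0 u : R) (p : C) : (0 < q)%N -> 0 < sg -> sg * u <= pi / q%:R ->
  x0 <= - u -> expR (- u) <= nm p < 1 -> ~ chan q sg x0 p ->
  exists2 eta : R, 0 < eta & forall k : int, exists j : int, forall y,
    nm (y - cexp (im (2 * pi * j%:~R / q%:R)) * p) < eta -> exists w, [/\ y = cexp w,
      - (2 * pi / q%:R) < sg * complex.Re w, complex.Re w < 0 &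
      - (2 * pi * k%:~R / q%:R) < sg * complex.Re w - complex.Im w
        < - (2 * pi * k%:~R / q%:R) + 2 * pi / q%:R].
Proof.
move=> q0 sg0 squ x0u /andP[pu p1] nchan; have p0 := pi_gt0 R.
have q0R : (0 : R) < q%:R by rewrite ltr0n.
have np0 : 0 < nm p := lt_le_trans (expR_gt0 _) pu.
have pn0 : p != 0 by rewrite -nm_gt0.
have [om eo] := cexp_surj pn0.
have ro0 : complex.Re om < 0 by rewrite -expR_lt1 -nm_cexp eo.
have rou : - u <= complex.Re om by rewrite -ler_expR -nm_cexp eo.
pose v : R := 2 * pi / q%:R; have v0 : 0 < v by rewrite divr_gt0 //; lra.
have v2 : v / 2 = pi / q%:R by rewrite /v; field; exact: lt0r_neq0.
have ek (k : int) : 2 * pi * k%:~R / q%:R = k%:~R * v by rewrite /v; ring.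
have ev : 2 * pi / q%:R = v by [].
clearbody v.
pose ps := sg * complex.Re om - complex.Im om.
have eps : ps = sg * complex.Re om - complex.Im om by [].
clearbody ps.
have [fl [k1 k2]] : exists fl : int, fl%:~R * v <= ps /\ ps < (fl%:~R + 1) * v.
  exists (Num.floor (ps / v)); split; first by rewrite -ler_pdivlMr // floor_le_tmp.
  by rewrite -ltr_pdivrMr //; have := floorD1_gt (ps / v); rewrite intrD.
have k1' : fl%:~R * v < ps.
  rewrite lt_neqAle k1 andbT; apply/eqP => epv.
  apply: nchan; rewrite -eo; exists (complex.Re om), (- fl); split.
    by rewrite (ltW ro0) andbT (le_trans x0u).
  congr cexp; apply: complex_ext; rewrite ?cReD ?cImD ?cReM ?cImM /=; first by ring.
  by rewrite ek mulrNz mulNr epv eps; ring.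
have [g g0 [g1 g2 g3 g4]] : exists2 g : R, 0 < g & [/\ g <= ps - fl%:~R * v,
    g <= (fl%:~R + 1) * v - ps, g <= v / 4 & g <= - complex.Re om].
  exists (Num.min (Num.min (ps - fl%:~R * v) ((fl%:~R + 1) * v - ps)) (Num.min (v / 4) (- complex.Re om))).
    by rewrite !lt_min !subr_gt0 k1' k2 oppr_gt0 ro0 andbT divr_gt0.
  by rewrite !ge_min !lexx !orbT.
have [eta eta0 [eta1 eta3]] : exists2 eta : R, 0 < eta & eta <= g / 2 /\ eta * (4 * (sg + 1)) <= g.
  have sg4 : 0 < 4 * (sg + 1) by lra.
  exists (Num.min (g / 2) (g / (4 * (sg + 1)))).
    by rewrite lt_min !divr_gt0.
  by rewrite -ler_pdivlMr // !ge_min !lexx orbT.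
have [lr0 lr00 [lc lc0 [_ lsurj]]] := qift (M := 3) (@hasder_cexp R) (@ccont_cexp R) (fun z _ => cexp_neq0 z).
have [st st0 [st1 st2 st3]] : exists2 st : R, 0 < st & [/\ st <= eta, st <= lr0 & st <= 1].
  exists (Num.min eta (Num.min lr0 1)); first by rewrite !lt_min eta0 lr00 ltr01.
  by rewrite !ge_min !lexx !orbT.
exists (lc * st * nm p); first by rewrite !mulr_gt0.
move=> k; exists (fl + k) => y yb; set m := cexp _ in yb.
have [|||zt zt1 zt2] := lsurj 0 st (y / (m * p)).
+ by rewrite st0.
+ by rewrite nm0; lra.
+ rewrite cexp0; have -> : y / (m * p) - 1 = (y - m * p) / (m * p) by field; rewrite pn0 cexp_neq0.
  have mp0 : 0 < nm (m * p) by rewrite nmM nm_cexp_im mul1r.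
  by rewrite nmM nmV ltr_pdivrMr // (nmM m) nm_cexp_im mul1r.
rewrite subr0 in zt1; rewrite ek ev.
have := Re_le_nm zt; have := Im_le_nm zt; rewrite !ler_norml => /andP[i1 i2] /andP[c1 c2].
have A1 : sg * complex.Re zt <= sg * eta by rewrite ler_pM2l //; clear -c2 zt1 st1; lra.
have A2 : - (sg * eta) <= sg * complex.Re zt by rewrite -mulrN ler_pM2l //; clear -c1 zt1 st1; lra.
have A3 : sg * - u <= sg * complex.Re om by rewrite ler_pM2l.
exists (om + im (2 * pi * (fl + k)%:~R / q%:R) + zt); split.
+ have m0 : m != 0 by exact: cexp_neq0.
  by rewrite cexpD zt2 cexpD eo -/m; field; rewrite m0 pn0.
+ rewrite !cReD /= addr0; lra.
+ rewrite !cReD /= addr0; lra.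
+ rewrite !cReD !cImD /= addr0 ek intrD; lra.
Qed.

(** The image of the radius of [wq] takes every modulus up to that of [hs wq]; rotations by
    multiples of 2 pi/q then approach every argument. *)
Lemma step_dens (q : nat) (hs : C -> C) (r' : R) (wq : C) : (0 < q)%N -> cconton (bal r') hs ->
  1 < r' -> hs 0 = 0 -> nm wq <= 1 -> 0 < nm (hs wq) <= 1 ->
  (forall (j : int) w, nm w < r' ->
     hs (cexp (im (2 * pi * j%:~R / q%:R)) * w) = cexp (im (2 * pi * j%:~R / q%:R)) * hs w) ->
  forall w, nm w <= 1 -> exists2 w', nm w' <= 1 & nm (w - hs w') <= (1 - nm (hs wq)) + 2 * pi / q%:R.
Proof.
move=> q0 chs r'1 hs0 wq1 /andP[p0 p1] sym w w1; have pi0 := pi_gt0 R.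
have q0R : (0 : R) < q%:R by rewrite ltr0n.
have v0 : 0 < 2 * pi / q%:R :> R by rewrite divr_gt0 //; lra.
have [w00|wn0] := eqVneq w 0.
  by exists 0; rewrite ?nm0 // w00 hs0 subrr nm0 addr_ge0 ?subr_ge0 // ltW.
have nw0 : 0 < nm w by rewrite nm_gt0.
set np := nm (hs wq) in p0 p1 *.
have [rad [rad0 radw radp wrad]] : exists rad, [/\ 0 < rad, rad <= nm w, rad <= np & nm w - rad <= 1 - np].
  by have [h|h] := leP (nm w) np; [exists (nm w)|exists np]; split => //; lra.
pose path t := hs (rC t * wq).
have tw t : 0 <= t <= 1 -> nm (rC t * wq) <= 1.
  by move=> /andP[t1 t2]; rewrite nmM nm_rC ger0_norm //; have := nm_ge0 wq; nra.
have cp : pconton 0 1 path.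
  move=> t t01 k k0; have tr' : bal r' (rC t * wq) := le_lt_trans (tw t t01) r'1.
  have [d3 d30 h3] := chs _ tr' k k0.
  exists d3 => // t2 t201 tt; apply: h3; first exact: le_lt_trans (tw t2 t201) r'1.
  rewrite -mulrBl -rCN -rCD nmM nm_rC.
  by have := normr_ge0 (t2 - t); have := nm_ge0 wq; nra.
have [||t t01 et] := @ivt_C path (@nm R) 0 1 1 rad ler01 ltr01 cp.
+ by move=> z1 z2; rewrite mul1r; exact: nm_dist.
+ by rewrite /path rC0 rC1 mul0r mul1r hs0 nm0 (ltW rad0) /=; exact: radp.
have tr' := le_lt_trans (tw t t01) r'1.
have [j hj] := near_rotation q0 rad0 et radw.
exists (cexp (im (2 * pi * j%:~R / q%:R)) * (rC t * wq)).
  by rewrite nmM nm_cexp_im mul1r; exact: tw.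
rewrite nmBC sym //; apply: le_trans hj _; nra.
Qed.

Section Next.
Variables (s : lev) (f' df' : C -> C) (q : nat) (a' : R) (phi dphi : C -> C) (r r1 b' : R) (hb : C -> C).
Hypothesis I : level_ok s.
Hypothesis q0 : (0 < q)%N.
Hypothesis ra' : exists p : int, a' * q%:R = p%:~R.
Hypothesis Hf' : forall z, nm z < 3 -> lH s (f' z) = rot_mult a' * lH s z.
Hypothesis ff' : forall z, nm z < 3 -> nm (f' z - lf s z) <= lb s / 4 /\ nm (df' z - ldf s z) <= lb s / 4.
Hypothesis dff' : forall z, nm z < 3 -> hasder f' z (df' z).
Hypothesis f'0 : f' 0 = 0.
Hypothesis phid : forall z, hasder phi z (dphi z).
Hypothesis dphic : forall z, ccont dphi z.
Hypothesis dphi0 : forall z, nm z <= 5 -> dphi (lH s z) != 0.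
Hypothesis phi0 : phi 0 = 0.
Hypothesis phieq : forall m z, m ^+ q = 1 -> phi (m * z) = m * phi z.
Hypothesis r0 : 0 < r.
Hypothesis rr1 : r < r1.
Hypothesis bhb : branch phi r1 hb.
Hypothesis b'0 : 0 < b' <= lb s / 4.

Lemma scaled_bal w : nm w < r1 / r -> nm (rC r * w) < r1.
Proof. by have r0' := r0; rewrite ltr_pdivlMr // nmM nm_rC gtr0_norm // mulrC. Qed.

Lemma scaled_cont : cconton (bal (r1 / r)) (fun w => hb (rC r * w)).
Proof.
have r0' := r0; have [hbc _ _] := bhb.
move=> z zr k k0; have [d3 d30 h3] := hbc _ (scaled_bal zr) k k0.
exists (d3 / r); first by rewrite divr_gt0.
move=> w wr; rewrite ltr_pdivlMr // => wz; apply: h3; first exact: scaled_bal.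
by rewrite -mulrBr nmM nm_rC gtr0_norm // mulrC.
Qed.

(** The rotation by [a'] has order dividing [q], hence commutes with [phi]; this carries the
    conjugacy of [f'] from [H] over to [phi(H)/r]. *)
Lemma next_ok : level_ok (Lev (fun z => phi (lH s z) / rC r)
  (fun z => dphi (lH s z) * ldH s z / rC r) (fun w => lh s (hb (rC r * w))) (r1 / r) f' df' q a' b').
Proof.
have Hd : forall z, hasder (lH s) z (ldH s z) := inv_d I.
have /andP[b0 b4] := inv_b I; have /andP[b'0' b'4] := b'0; have r0' := r0.
have rC0' : rC r != 0 by apply: rC_neq0; rewrite gt_eqF.
have [hc h0 hr] := inv_h I; have r1s := inv_r I; have [hbc hb0 hbr] := bhb.
have in_h w : nm w < r1 / r -> nm (hb (rC r * w)) < lr s.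
  by move=> wr; have [_ h] := hbr _ (scaled_bal wr); apply: lt_trans h r1s.
split=> /=.
- move=> z; have h1 := hasder_comp (Hd z) (phid (lH s z)).
  by have := hasderM h1 (hasder_cst (rC r)^-1 z); rewrite mulr0 addr0.
- move=> z; apply: ccontM (ccont_cst _ _); apply: ccontM; last exact: inv_dc I z.
  exact: ccont_comp (hasder_ccont (Hd z)) (dphic _).
- by move=> z z5; rewrite !mulf_neq0 ?invr_eq0 // ?(inv_d0 I) // dphi0.
- by rewrite (inv_0 I) phi0 mul0r.
- by rewrite ltr_pdivlMr // mul1r.
- split=> [z zr k k0||w wr].
  + have [d2 d20 h2] := hc _ (in_h z zr) k k0.
    have [d3 d30 h3] := scaled_cont zr d20.
    by exists d3 => // w wr wz; apply: h2; [exact: in_h|exact: h3].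
  + by rewrite mulr0 hb0.
  + have [e2 h2] := hbr _ (scaled_bal wr); have [e3 h3] := hr _ (in_h w wr).
    by rewrite e3 e2; split => //; rewrite mulrC mulKf.
- exact: q0.
- exact: ra'.
- have [p hp] := ra'.
  move=> z z3; have [q1 q2] := ff' z3; have [_ q3 _ q4] := inv_f I z3; split.
  + by rewrite Hf' // phieq ?(rot_mult_pow hp) // mulrA.
  + by have := nm_tri (f' z) (lf s z) z; lra.
  + exact: dff'.
  + by have := nm_tri (df' z) (ldf s z) 1; lra.
- exact: f'0.
- lra.
Qed.

End Next.

(** Order of choices: [d] from the uniform continuity of [h], then [q] and [a'], which determine
    [f'], then [phi] for this [q], then the radius [r], and last the budget [b'], small enough for
    the tips of the new disc to stay between their channels. *)
Lemma step_exists (s : lev) (n : nat) : level_ok s ->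
  exists s' hs sg x0, level_ok s' /\ step n s s' hs sg x0.
Proof.
move=> I; have /andP[b0 b4] := inv_b I.
have e01 : 0 < lb s / 4 <= 1 by lra.
have p0 := pi_gt0 R; have p4 := pi_lt4.
have [hc h0 hr] := inv_h I; have r1s := inv_r I.
have [d [d0 d1 hd]] : exists d : R, [/\ 0 < d, d <= 1 &
    forall z w, disc 1 z -> nm (w - z) < d -> nm (lh s w - lh s z) < lb s / 4].
  have [d d0 hd] : exists2 d : R, 0 < d & forall z w, disc 1 z -> nm (w - z) < d -> nm (lh s w - lh s z) < lb s / 4.
    apply: (@cconton_unif R (disc 1) (bal (lr s))) => //; [exact: compact_disc|lra|].
    move=> z z1; exists (lr s - 1); first lra.
    by move=> w wz; rewrite /bal /=; rewrite /disc /= in z1; have := nm_subr_ge w z; lra.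
  exists (Num.min d 1); split; first by rewrite lt_min d0 ltr01.
    by rewrite ge_min lexx orbT.
  by move=> z w z1; rewrite lt_min => /andP[w1 _]; exact: hd.
have d01 : 0 < d <= 1 by rewrite d0.
have [t0 t00 ht0] := @perturb_f R s I (lb s / 4) e01.
(* q >= 200/d gives 2 pi/q <= d/4 and 8 pi/q < d/4, within the tolerances of [st_dens] and
   [st_wall]. *)
have [N [q [N2 eq q0 qt qd]]] : exists N q : nat, [/\ (n.+2 <= N)%N, q = (lq s * N)%N, (0 < q)%N,
    q%:R^-1 <= t0 & q%:R^-1 <= d / 200].
  have [T T0 [Tt Td]] : exists2 T : R, 0 < T & T <= t0 /\ T <= d / 200.
    exists (Num.min t0 (d / 200)); last by rewrite !ge_min !lexx orbT.
    by rewrite lt_min t00 /=; lra.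
  pose N := (n.+2 + (Num.trunc T^-1).+1)%N.
  have N2 : (n.+2 <= N)%N by rewrite leq_addr.
  have q0 : (0 < lq s * N)%N by rewrite muln_gt0 (inv_q I) /= (leq_trans _ N2).
  have qT : ((lq s * N)%N%:R)^-1 <= T.
    rewrite -[leRHS]invrK lef_pV2 ?posrE ?invr_gt0 ?ltr0n //.
    have h : T^-1 < (Num.trunc T^-1).+1%:R by rewrite truncnS_gt.
    apply: le_trans (ltW h) _; rewrite ler_nat.
    by apply: (@leq_trans N); [exact: leq_addl|rewrite leq_pmull // (inv_q I)].
  by exists N, (lq s * N)%N; split => //; [exact: le_trans qT Tt|exact: le_trans qT Td].
have q0R : (0 : R) < q%:R by rewrite ltr0n.
have qi0 : (0 : R) < q%:R^-1 by rewrite invr_gt0.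
have [a' ea'] : exists a', a' = la s + q%:R^-1 by eexists.
have [|f' [df' [Hf' ff' dff' f'0]]] := ht0 a'.
  by rewrite ea' addrAC subrr add0r gtr0_norm.
have ra' : exists p : int, a' * q%:R = p%:~R.
  have [p hp] := inv_a I; exists (p * (N%:Z) + 1)%R.
  rewrite ea' mulrDl mulVf ?gt_eqF // intrD intrM -hp eq natrM; congr (_ + _).
  by rewrite -mulrA.
have [th [x0 [th0 sg0 sgd x01 x0d]]] := step_scales d01.
have [sg esg] : exists sg, sg = cos th / sin th by eexists.
rewrite -esg in sg0 sgd.
have [B B0 hB] : exists2 B : R, 0 < B & forall z, disc 5 z -> nm (lH s z) <= B.
  apply: cpt_bounded; first exact: compact_disc.
  by apply: ccont_on => z _; exact: hasder_ccont (inv_d I z).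
have Mr2 : 2 <= Num.max 2 B by rewrite le_max lexx.
have MrB : B <= Num.max 2 B by rewrite le_max lexx orbT.
have x00 : x0 < 0 by apply: le_lt_trans x01 _; rewrite oppr_lt0.
have [phi [dphi [phid dphic dphi0 phi0 [phieq phibar]]]] := step_field q0 th0 x00 Mr2.
(* A point of modulus at least e^(-u) in the new disc serves twice: [u <= d / 8] for the density,
   [sg * u <= pi / q] for the position of the tip. *)
have [u [u0 squ u2]] : exists u : R, [/\ 0 < u, sg * u <= pi / q%:R & u <= d / 8].
  exists (Num.min (pi / q%:R / sg) (d / 8)); split; last by rewrite ge_min lexx orbT.
    by rewrite lt_min !divr_gt0.
  by rewrite mulrC -ler_pdivlMr // ge_min lexx.
have dphi02 z : nm z <= 2 -> dphi z != 0 by move=> z2; apply: dphi0; exact: le_trans z2 Mr2.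
have eu0 : 0 < expR (- u) by exact: expR_gt0.
have eu1 : expR (- u) < 1 by rewrite -expR0 ltr_expR oppr_lt0.
have eu01 : 0 < 1 - expR (- u) < 1 by rewrite subr_gt0 eu1 ltrBlDr ltrDl.
have [r [r1 [hb [r0 rr1 bhb [wp wpr hwp]]]]] := max_branch phid dphic dphi02 phi0 eu01.
have {}hwp : expR (- u) <= nm (hb wp) by move: hwp; rewrite opprB addrC subrK.
have rC0' : rC r != 0 by apply: rC_neq0; rewrite gt_eqF.
have [hs ehs] : exists hs : C -> C, hs = fun w => hb (rC r * w) by eexists.
have [wq wq1 hwq] : exists2 wq, nm wq <= 1 & hs wq = hb wp.
  exists (wp / rC r); last by rewrite ehs mulrC divfK.
  by rewrite nmM nmV nm_rC gtr0_norm // ler_pdivrMr // mul1r.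
have r'1 : 1 < r1 / r by rewrite ltr_pdivlMr // mul1r.
have hs1 w : nm w < r1 / r -> nm (hs w) < 1.
  move=> wr; rewrite ehs; have [_ _ hbr] := bhb.
  by have [] := hbr _ (scaled_bal r0 wr).
have hs0 : hs 0 = 0 by rewrite ehs mulr0; have [] := bhb.
have chs : cconton (bal (r1 / r)) hs by rewrite ehs; exact: (scaled_cont r0 bhb).
have rot1 (j : int) : @cexp R (im (2 * pi * j%:~R / q%:R)) ^+ q = 1.
  rewrite cexpXn im_mulrn.
  have -> : q%:R * (2 * pi * j%:~R / q%:R) = 2 * pi * j%:~R :> R by rewrite mulrC divfK // gt_eqF.
  exact: cexp_im2pi.
have hsym (j : int) w : nm w < r1 / r -> hs (cexp (im (2 * pi * j%:~R / q%:R)) * w) = cexp (im (2 * pi * j%:~R / q%:R)) * hs w.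
  move=> wr; rewrite ehs mulrCA.
  by apply: (branch_sym phid dphic dphi02 phieq bhb); [exact: rot1|exact: nm_cexp_im|exact: (scaled_bal r0 wr)].
have hschan w : nm w < r1 / r -> ~ chan q sg x0 (hs w).
  move=> wr [x [k [xx ez]]]; rewrite ehs in ez.
  apply: (phibar r1 hb bhb (rC r * w) (scaled_bal r0 wr)).
  by exists x, k; rewrite -esg.
have wqr : nm wq < r1 / r := le_lt_trans wq1 r'1.
have hwq01 : expR (- u) <= nm (hs wq) < 1 by rewrite hs1 // andbT hwq.
have x0u : x0 <= - u by clear -x01 u2 d1; lra.
have [eta eta0 htip] := step_tip q0 sg0 squ x0u hwq01 (hschan wq wqr).
have [bo bo0 hbo] := @unif_open R s I eta eta0.
have [b' b'0 [b'1 b'2]] : exists2 b' : R, 0 < b' & b' <= bo /\ b' <= lb s / 4.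
  exists (Num.min bo (lb s / 4)); last by rewrite !ge_min !lexx orbT.
  by rewrite lt_min bo0 divr_gt0.
have dphi5 z : nm z <= 5 -> dphi (lH s z) != 0.
  by move=> z5; apply: dphi0; apply: le_trans MrB; exact: hB.
have ok := next_ok I q0 ra' Hf' ff' dff' f'0 phid dphic dphi5 phi0 phieq r0 rr1 bhb (b' := b') ltac:(by rewrite b'0 b'2).
exists (Lev (fun z => phi (lH s z) / rC r) (fun z => dphi (lH s z) * ldH s z / rC r)
  (fun w => lh s (hb (rC r * w))) (r1 / r) f' df' q a' b'), hs, sg, x0; split => //.
have pq : 2 * pi / q%:R <= d / 4.
  have : pi * q%:R^-1 <= 4 * (d / 200) by apply: ler_pM => //; exact: ltW.
  clear -d0; lra.
have eh' w : lh s (hb (rC r * w)) = lh s (hs w) by rewrite ehs.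
clear ht0 Hf' dff' phid dphic dphi0 phi0 phieq phibar dphi02 bhb dphi5 ok rot1.
split=> /=.
- exact: ff'.
- by exists N.
- exact: b'2.
- by move=> w wr; split => //; exact: hs1.
- move=> w w1; have p01 : 0 < nm (hs wq) <= 1.
    by have /andP[h1 h2] := hwq01; rewrite (lt_le_trans eu0 h1) ltW.
  have [w' w'1 hw'] := step_dens q0 chs r'1 hs0 wq1 p01 hsym w1.
  exists w' => //; rewrite eh' nmBC; apply/ltW/hd; first exact: w1.
  rewrite nmBC; apply: le_lt_trans hw' _.
  have := expRN_ge u; have /andP[h1 _] := hwq01.
  clear -h1 pq u2 d0; lra.
- exact: hschan.
- move=> k w w1; have [x xx hx] := @step_fill d sg x0 k q w d01 sg0 ltac:(by rewrite sgd) x00 x0d w1.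
  by exists x => //; apply/ltW/hd.
- move=> rr y y'; rewrite sgd => /andP[rr1' rr2] yy.
  apply/ltW/hd; first by rewrite /disc /= nm_cexp_im.
  have -> : rC rr * cexp (im y) - cexp (im y') = - (rC (1 - rr) * cexp (im y)) + cexp (im y') * (cexp (im (y - y')) - 1).
    by rewrite imD imN cexpB rCD rCN rC1; field; exact: cexp_neq0.
  apply: le_lt_trans (nmD _ _) _; rewrite nmN !nmM !nm_cexp_im mulr1 mul1r nm_rC ger0_norm ?subr_ge0 //.
  have := nm_cexp_im_sub1 (y - y'); have := expRN_ge (d / 8).
  have : pi * q%:R^-1 <= 4 * (d / 200) by apply: ler_pM => //; exact: ltW.
  clear -yy rr1' d0; lra.
- rewrite sgd; clear -x01 d1; lra.
- exact: sg0.
- move=> k; have [j hj] := htip k.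
  exists (cexp (im (2 * pi * j%:~R / q%:R)) * wq); first by rewrite nmM nm_cexp_im mul1r.
  move=> z; rewrite eh' hsym // => zb.
  have mp1 : nm (cexp (im (2 * pi * j%:~R / q%:R)) * hs wq) <= 1.
    by rewrite nmM nm_cexp_im mul1r ltW // hs1.
  have [z1 z2 z3] := hbo _ z mp1 (le_trans zb b'1).
  have [w [ew c1 c2 c3]] := hj (lH s z) z1.
  by exists w; split => //; rewrite -ew z3.
Qed.

End StepExistence.

(** * Paths and discs *)

Section Paths.
Variable R : realType.
Local Notation C := (Cplx R).

Lemma nested_cpt (A : nat -> set C) : (forall n, compact (A n)) -> (forall n, A n !=set0) ->
  (forall n, A n.+1 `<=` A n) -> exists x, forall n, A n x.
Proof.
move=> cA A0 sA; apply: contrapT => no.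
have mono m n : (m <= n)%N -> A n `<=` A m.
  elim: n => [|n IH]; first by rewrite leqn0 => /eqP ->.
  by rewrite leq_eqVlt => /orP[/eqP -> //|mn] x /sA; exact: IH.
have clA n : closed (A n) by apply: compact_closed => //; exact: norm_hausdorff.
have [d d' x d'0 dd h|x _|d d0 h] := @cpt_unif R (A 0%N) (fun d x => ~ A (Num.trunc d^-1) x) (cA 0%N).
- move=> Ax; apply: h; apply: (mono _ (Num.trunc d'^-1)) => //.
  by apply: le_truncn; rewrite lef_pV2 ?posrE //; exact: lt_le_trans d'0 dd.
- have [n nAx] : exists n, ~ A n x.
    by apply: contrapT => all; apply: no; exists x => n; apply: contrapT => nA; apply: all; exists n.
  have oA : open (~` A n) by apply: closed_openC.
  have [e e0 he] := (openCP _).1 oA x nAx.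
  exists e => //; exists (n.+1%:R^-1); first by rewrite invr_gt0.
  move=> y _ yx; rewrite invrK => Ay; apply: (he y yx).
  apply: (mono n _ _ y Ay); rewrite truncn_ge_nat //.
    by rewrite ler_nat.
- have [x Ax] := A0 (Num.trunc d^-1).
  by apply: (h x) => //; apply: mono Ax.
Qed.

Lemma closed_ball_cpt (z : C) (r : R) : compact [set w | nm (w - z) <= r].
Proof.
apply: (subclosed_compact _ (@compact_disc R (nm z + r))).
  apply/closedCP => x h /=; rewrite leNgt; apply/negP => sx.
  have [y /= yB yx] := h (nm (x - z) - r) ltac:(lra).
  by have := nm_tri x y z; rewrite nmBC in yx *; lra.
by move=> w /= h; rewrite /disc /=; have := nm_subr_ge w z; lra.
Qed.

(** At the exit time the path is still in the closed set, but it leaves the set arbitrarily soon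
    after; for a disc [L n] this forces a boundary point. *)
Lemma first_exit (g : R -> C) (a b : R) (A : set C) : a <= b -> pconton a b g -> closed A ->
  A (g a) -> ~ A (g b) -> exists t, [/\ a <= t <= b, forall s, a <= s <= t -> A (g s) &
    forall e, 0 < e -> exists s, [/\ t <= s <= b, s < t + e & ~ A (g s)]].
Proof.
move=> ab cg clA Aa nAb.
pose E := [set s | a <= s <= b /\ forall u, a <= u <= s -> A (g u)].
have Ea : E a.
  by split=> [|u]; [rewrite lexx|move=> /andP[u1 u2]; rewrite (le_anti (introT andP (conj u2 u1)))].
have uE : ubound E b by move=> s [/andP[]].
have hE : has_sup E by split; [exists a|exists b].
have tb : sup E <= b by apply: ge_sup => //; exists a.
have at_ : a <= sup E by apply: ub_le_sup => //; exists b.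
have below s : a <= s -> s < sup E -> A (g s).
  move=> as_ st; have [u [_ hu] su] := @sup_gt R E s (ex_intro _ a Ea) st.
  by apply: hu; rewrite as_ ltW.
have At : A (g (sup E)).
  apply: (closedCP A).1 => // e e0; have [d d0 hd] := cg (sup E) ltac:(by rewrite at_) e e0.
  move: at_; rewrite le_eqVlt => /orP[/eqP ea|at'].
    by exists (g a) => //; rewrite -ea subrr nm0.
  have [s [s1 s2 s3]] : exists s, [/\ a <= s, s < sup E & sup E - d < s].
    have [h|h] := leP a (sup E - d / 2); first by exists (sup E - d / 2); split; lra.
    by exists a; split; lra.
  exists (g s); first exact: below.
  by apply: hd; [rewrite s1 (le_trans (ltW s2))|rewrite ltr_norml; lra].
exists (sup E); split; first by rewrite at_.
  move=> s /andP[s1]; rewrite le_eqVlt => /orP[/eqP -> //|]; exact: below.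
move=> e e0; apply: contrapT => no.
have all s : sup E <= s <= b -> s < sup E + e -> A (g s).
  by move=> h1 h2; apply: contrapT => nA; apply: no; exists s.
have tb' : sup E < b.
  by rewrite lt_neqAle tb andbT; apply/eqP => etb; apply: nAb; rewrite -etb.
pose t' := Num.min b (sup E + e / 2).
have [t1 t2 t3] : [/\ sup E < t', t' <= b & t' < sup E + e].
  by rewrite /t' lt_min gt_min ge_min lexx tb' /=; split => //; lra.
suff /(@ub_le_sup _ E) : E t' by move=> /(_ (ex_intro _ b uE)); lra.
split; first lra.
move=> u /andP[u1 u2]; have [h|h] := ltP u (sup E); first exact: below.
by apply: all; lra.
Qed.

Lemma nm_ge_closed (v : R) : closed [set z : C | v <= nm z].
Proof.
apply/closedCP => z hz /=; rewrite leNgt; apply/negP => zv.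
have [w /= wv wz] := hz (v - nm z) ltac:(by rewrite subr_gt0).
by have := nm_subr_ge w z; lra.
Qed.

Lemma first_hit (g : R -> C) (a b v : R) : a <= b -> pconton a b g -> v <= nm (g a) ->
  nm (g b) <= v -> exists2 t, a <= t <= b & nm (g t) = v /\ forall s, a <= s <= t -> v <= nm (g s).
Proof.
move=> ab cg va vb.
have [all|/existsNP [s0 /not_implyP [/andP[s1 s2] /negP]]] := pselect (forall s, a <= s <= b -> v <= nm (g s)).
  by exists b; rewrite ?lexx ?ab //; split => //; apply/eqP; rewrite eq_le vb all // ab lexx.
rewrite -ltNge => s0v.
have cg' : pconton a s0 g := pconton_sub (lexx a) s2 cg.
have [|t [/andP[t1 t2] ht hx]] := first_exit s1 cg' (@nm_ge_closed v) va.
  by rewrite /= leNgt s0v.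
exists t; first by rewrite t1 (le_trans t2).
split=> //; apply/eqP; rewrite eq_le ht ?lexx ?t1 // andbT leNgt; apply/negP => vt.
have [d d0 hd] := cg' t ltac:(by rewrite t1) (nm (g t) - v) ltac:(by rewrite subr_gt0).
have [s [/andP[s3 s4] s5 /negP]] := hx d d0; rewrite -ltNge => sv.
have := hd s ltac:(by rewrite s4 (le_trans t1)) ltac:(by rewrite ltr_norml; lra).
by rewrite nmBC; have := nm_subr_ge (g t) (g s); lra.
Qed.

Lemma between_walls (y th p g : R) : th - p <= y < th -> 2 * g < `|y - th| -> 2 * g < `|y + p - th| ->
  th - p + 2 * g < y < th - 2 * g.
Proof. by move=> ?; rewrite !lter_normr => /orP[] ? /orP[] ?; lra. Qed.

Lemma pconton_cpt (g : R -> C) (a b : R) : pconton a b g -> compact (g @` `[a, b]).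
Proof. by move=> /pcontonP cg; apply: continuous_compact => //; exact: segment_compact. Qed.

Lemma pconton_comp (g : R -> C) (h : C -> C) (A : set C) (a b : R) : pconton a b g ->
  (forall t, a <= t <= b -> A (g t)) -> cconton A h -> pconton a b (h \o g).
Proof.
move=> cg gA ch t tab e e0; have [d1 d10 h1] := ch _ (gA t tab) e e0.
have [d2 d20 h2] := cg t tab d1 d10; exists d2 => // s sab st.
by apply: h1; [exact: gA|exact: h2].
Qed.

(* The logarithmic coordinate of a spiral [cexp (x * (1 + i sg) + i t)] is [Re = - t]. *)
Definition shear (sg : R) (w : C) : C := Complex (sg * complex.Re w - complex.Im w) (complex.Im w).

Lemma shear_inj (sg : R) : 0 < sg -> injective (shear sg).
Proof.
move=> sg0 z w [e1 e2]; apply: complex_ext => //.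
by apply: (mulfI (lt0r_neq0 sg0)); move: e1; rewrite e2; lra.
Qed.

Lemma shear_cont (sg : R) z : 0 < sg -> ccont (shear sg) z.
Proof.
move=> sg0 e e0; exists (e / (sg + 2)); first by rewrite divr_gt0 //; lra.
move=> w; rewrite ltr_pdivlMr; last lra.
move=> wz; apply: le_lt_trans wz; apply: le_trans (nm_le_ReIm _) _.
rewrite !cReD !cImD !cReN !cImN /shear /=.
have := Re_le_nm (w - z); have := Im_le_nm (w - z); rewrite !cReD !cImD !cReN !cImN.
set u := nm _; set x := complex.Re w - _; set y := complex.Im w - _ => h1 h2.
have -> : sg * complex.Re w - complex.Im w - (sg * complex.Re z - complex.Im z) = sg * x - y by rewrite /x /y; ring.
apply: le_trans (lerD (ler_normB _ _) (lexx _)) _; rewrite normrM gtr0_norm //.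
have : sg * `|x| <= sg * u by rewrite ler_pM2l.
lra.
Qed.

Lemma pconton_rev (g : R -> C) (a b : R) : pconton a b g -> pconton (- b) (- a) (fun t => g (- t)).
Proof.
move=> cg t tab e e0; have [d d0 hd] := cg (- t) ltac:(by rewrite lerNr lerNl andbC) e e0.
exists d => // s sab st; apply: hd; first by rewrite lerNr lerNl andbC.
by rewrite -opprD normrN.
Qed.

Lemma path_component (A : set C) (p : R -> C) (a b : R) : pconton a b p ->
  (forall t, a <= t <= b -> A (p t)) -> forall s t, a <= s <= b -> a <= t <= b ->
  connected_component A (p s) (p t).
Proof.
move=> /pcontonP cp pA s t sab tab.
apply: (@connected_component_max _ A (p @` `[a, b])).
- by exists s => //=; rewrite in_itv.
- by move=> _ [u /= uab <-]; apply: pA; rewrite in_itv in uab.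
- by apply: connected_continuous_connected => //; exact: segment_connected.
- by exists t => //=; rewrite in_itv.
Qed.

Lemma nm_argmax (A : set C) : compact A -> A !=set0 -> A `<=` disc 1 ->
  exists2 z, A z & forall w, A w -> nm w <= nm z.
Proof.
move=> cA A0 A1; have [|z Az hz] := @cpt_argmin R A (fun w => rC (1 - nm w)) cA _ A0.
  move=> z _ e e0; exists e => // w _ wz; apply: le_lt_trans wz.
  by rewrite -rCN -rCD nm_rC (_ : _ - _ + _ = - (nm w - nm z)) ?normrN ?nm_dist //; ring.
exists z => // w Aw; have := hz w Aw; have := A1 _ Az; have := A1 _ Aw; rewrite /disc /= => w1 z1.
by rewrite !nm_rC !ger0_norm; lra.
Qed.

Lemma bal_open (r : R) : open (@bal R r).
Proof.
apply/openCP => z zr; exists (r - nm z); first by rewrite subr_gt0.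
by move=> w wz; rewrite /bal /=; have := nm_subr_ge w z; lra.
Qed.

Lemma disc_closed (r : R) : closed (@disc R r).
Proof. by apply: compact_closed; [exact: norm_hausdorff|exact: compact_disc]. Qed.

Lemma bal_closure (r : R) : 0 < r -> closure (@bal R r) = disc r.
Proof.
move=> r0; apply/seteqP; split.
  apply: subset_trans (closure_subset (_ : bal r `<=` disc r)) _; first by move=> z /ltW.
  by rewrite -((closure_id _).1 (@disc_closed r)).
move=> z zr; apply/closureCP => e e0; rewrite /disc /= in zr.
pose t := Num.min (1 / 2) (e / (2 * r)).
have [t0 t1 te] : [/\ 0 < t, t < 1 & t * r < e].
  have e2 : 0 < e / (2 * r) by rewrite divr_gt0 ?mulr_gt0.
  have h1 : t <= 1 / 2 by rewrite ge_min lexx.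
  have h2 : t <= e / (2 * r) by rewrite ge_min lexx orbT.
  split; first by rewrite lt_min e2 andbT; lra.
    by lra.
  rewrite ler_pdivlMr ?mulr_gt0 // in h2; lra.
exists (rC (1 - t) * z).
  rewrite /bal /= nmM nm_rC ger0_norm ?subr_ge0 ?(ltW t1) //.
  by have := nm_ge0 z; nra.
have -> : rC (1 - t) * z - z = rC (- t) * z by rewrite rCD rCN rC1; ring.
by rewrite nmM nm_rC normrN gtr0_norm //; nra.
Qed.

Lemma bal_jordan (r : R) : 0 < r -> jordan_domain (@bal R r).
Proof.
move=> r0; pose g t : C := rC r * cexp (im (2 * pi * t)); have p0 := pi_gt0 R.
have ng t : nm (g t) = r by rewrite nmM nm_cexp_im mulr1 nm_rC gtr0_norm.
have img : g @` `[0, 1] = [set z | nm z = r].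
  apply/seteqP; split=> [_ [t _ <-]|z /= zr]; first exact: ng.
  have z0 : z / rC r != 0 by rewrite -nm_gt0 nmM nmV nm_rC zr gtr0_norm // divff ?gt_eqF.
  have rn : rC r != 0 :> C by rewrite -nm_gt0 nm_rC gtr0_norm.
  have [w ew /andP[w0 w1]] := @cexp_surj_win R (z / rC r) 0 z0.
  exists (complex.Im w / (2 * pi)).
    rewrite /= in_itv /= divr_ge0 ?mulr_ge0 ?(ltW p0) //= ler_pdivrMr ?mulr_gt0 // mul1r; lra.
  have Rw : complex.Re w = 0.
    by apply: expR_inj; rewrite -nm_cexp ew nmM nmV nm_rC zr gtr0_norm // divff ?expR0 // gt_eqF.
  have e2 : 2 * pi * (complex.Im w / (2 * pi)) = complex.Im w by rewrite mulrC divfK // gt_eqF ?mulr_gt0.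
  rewrite /g e2 (_ : im _ = w) ?ew 1?mulrC ?divfK //.
  by apply: complex_ext => /=; rewrite ?Rw.
exists g; split.
  apply/pcontonP => t _ e e0.
  have [d d0 hd] := @ccont_cexp R (im (2 * pi * t)) (e / r) ltac:(by rewrite divr_gt0).
  exists (d / (2 * pi)); first by rewrite divr_gt0 // mulr_gt0.
  move=> s _; rewrite ltr_pdivlMr ?mulr_gt0 // => st.
  rewrite -mulrBr nmM nm_rC gtr0_norm // mulrC -ltr_pdivlMr //; apply: hd.
  rewrite -imN -imD nm_im -mulrBr normrM mulrC (gtr0_norm (_ : 0 < 2 * pi)) // mulr_gt0 //; lra.
split.
  by have e1 : @cexp R (im (2 * pi * 1)) = 1 := cexp_im2pi _ 1; rewrite /g e1 mulr0 cexp0.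
split.
  move=> s t; rewrite /= !in_itv /= => /andP[s0 s1] /andP[t0 t1] egst.
  have rn : rC r != 0 :> C by rewrite -nm_gt0 nm_rC gtr0_norm.
  have [_ [k /= ek]] := cexp_eq (mulfI rn egst).
  have est : s = t + k%:~R.
    have pn : 2 * pi != 0 :> R by rewrite gt_eqF // mulr_gt0 //; lra.
    by apply: (mulfI pn); rewrite ek; ring.
  have k1 : (k%:~R : R) < 1%:~R by rewrite est in s1; lra.
  have k2 : ((-1)%:~R : R) < k%:~R by rewrite est in s0; rewrite mulrN1z; lra.
  rewrite !ltr_int in k1 k2; have k0 : k = 0 by lia.
  by rewrite est k0 addr0.
exists 0; rewrite img; split; first by rewrite /= nm0 => e; move: r0; rewrite -e ltxx.
have bC : bal r `<=` ~` [set z | nm z = r] by move=> z; rewrite /bal /= => zr e; rewrite e ltxx in zr.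
have b0 : bal r (0 : C) by rewrite /bal /= nm0.
split; last first.
  exists (rC r); split; first by rewrite realE -rC0 rC_le ltW.
  move=> M rM z zr /=; apply: le_trans (ltW rM); rewrite normE rC_le; exact: ltW.
apply/seteqP; split.
  apply: connected_component_max => //.
  have -> : bal r = [set w : C | nm (w - 0) < r] by apply/seteqP; split=> z; rewrite /bal /= subr0.
  exact: conn_ball.
set D := connected_component _ _.
have D0 : D 0 by apply: connected_component_refl; exact: bC.
have sub : D `<=` ~` [set z | nm z = r] := @connected_component_sub _ _ _.
(* Off the circle the open ball is also closed, so it exhausts the connected set [D]. *)
have eD : D `&` bal r = D.
  apply: (@component_connected _ (~` [set z | nm z = r]) 0).
  - by exists 0.
  - by exists (bal r) => //; exact: bal_open.
  - exists (disc r); first exact: disc_closed.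
    apply/seteqP; split=> z [Dz zr]; split => //; first exact: ltW.
    by rewrite /bal /= lt_neqAle [_ <= _]zr andbT; apply/eqP; exact: sub.
by rewrite -eD => z [].
Qed.

End Paths.

(** * The limit map and its hedgehog *)

Section Limit.
Variable R : realType.
Local Notation C := (Cplx R).
Local Notation lev := (lev R).

Lemma tower : exists (S : nat -> lev) (hs : nat -> C -> C) (sg x0 : nat -> R), S 0%N = lev0 R /\
  forall n, level_ok (S n) /\ step n (S n) (S n.+1) (hs n) (sg n) (x0 n).
Proof.
have /choice [F hF] : forall p : nat * lev, exists t : lev * ((C -> C) * (R * R)),
    level_ok p.2 -> level_ok t.1 /\ step p.1 p.2 t.1 t.2.1 t.2.2.1 t.2.2.2.
  move=> [n s]; have [ok|nok] := pselect (level_ok s); last by exists (s, (id, (0, 0))).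
  by have [s' [hs [sg [x0 h]]]] := step_exists n ok; exists (s', (hs, (sg, x0))).
pose S := fix S n := if n is n'.+1 then (F (n', S n')).1 else lev0 R.
have ok n : level_ok (S n).
  by elim: n => [|n IH]; [exact: inv_lev0|have [] := hF (n, S n) IH].
exists S, (fun n => (F (n, S n)).2.1), (fun n => (F (n, S n)).2.2.1), (fun n => (F (n, S n)).2.2.2).
by split => // n; split; [exact: ok|have [] := hF (n, S n) (ok n)].
Qed.

Variables (S : nat -> lev) (hs : nat -> C -> C) (sg x0 : nat -> R).
Hypothesis S0 : S 0%N = lev0 R.
Hypothesis okS : forall n, level_ok (S n).
Hypothesis stS : forall n, step n (S n) (S n.+1) (hs n) (sg n) (x0 n).

Local Notation H n := (lH (S n)).
Local Notation h n := (lh (S n)).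
Local Notation f n := (lf (S n)).
Local Notation df n := (ldf (S n)).
Local Notation q n := (lq (S n)).
Local Notation al n := (la (S n)).
Local Notation b n := (lb (S n)).

(** * Budgets and the limit angle *)

Lemma b_gt0 n : 0 < b n. Proof. by have /andP[] := inv_b (okS n). Qed.

Lemma b_step n : b n.+1 <= b n / 4. Proof. exact: st_b (stS n). Qed.

Lemma b_small n : b n <= n.+1%:R^-1.
Proof.
suff hh : b n * n.+1%:R <= 1 by rewrite -[leRHS]mul1r ler_pdivlMr.
elim: n => [|n IH].
  by rewrite mulr1; have /andP[_] := inv_b (okS 0%N); lra.
have := b_step n; have := b_gt0 n; have n0 : (0 : R) <= n%:R by [].
move: IH; rewrite -(natr1 n.+1) -(natr1 n); nra.
Qed.

Lemma b_cvg (e : R) : 0 < e -> exists n0, forall n, (n0 <= n)%N -> b n < e.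
Proof.
move=> e0; exists (Num.trunc e^-1) => n en; apply: le_lt_trans (b_small n) _.
rewrite invf_plt ?posrE //; apply: lt_le_trans (truncnS_gt _) _.
by rewrite ler_nat ltnS.
Qed.

Lemma q_gt0 n : (0 : R) < (q n)%:R.
Proof. by rewrite ltr0n; exact: inv_q (okS n). Qed.

Lemma q_step n : (n.+2)%:R * (q n)%:R <= (q n.+1)%:R :> R.
Proof.
have [N [N2 -> _]] := st_q (stS n).
by rewrite natrM mulrC ler_wpM2l ?ler_nat.
Qed.

Lemma q_big n : n.+1%:R <= (q n)%:R :> R.
Proof.
elim: n => [|n IH]; first by rewrite ler_nat; exact: inv_q (okS 0%N).
apply: le_trans (q_step n); have n0 : (0 : R) <= n%:R by [].
by move: IH; rewrite -(natr1 n.+1) -(natr1 n); nra.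
Qed.

Lemma al_step n : al n.+1 = al n + (q n.+1)%:R^-1.
Proof. by have [N []] := st_q (stS n). Qed.

(** The term - 1/q_m closes the induction, because 2/q_(m+1) <= 1/q_m. *)
Lemma al_bound n m : (n < m)%N -> al n < al m /\ al m <= al n + 2 / (q n.+1)%:R - (q m)%:R^-1.
Proof.
elim: m => [//|m IH]; rewrite ltnS leq_eqVlt => /orP[/eqP ->|nm].
  by rewrite al_step ltrDl invr_gt0 q_gt0; split => //; lra.
have [h1 h2] := IH nm; rewrite al_step; have qi : (0 : R) < (q m.+1)%:R^-1 by rewrite invr_gt0 q_gt0.
split; first lra.
have : 2 * (q m.+1)%:R^-1 <= (q m)%:R^-1 :> R.
  rewrite ler_pdivrMr ?q_gt0 // mulrC ler_pdivlMr ?q_gt0 //.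
  have := q_step m; have := q_gt0 m; have n0 : (0 : R) <= m%:R by [].
  by rewrite -(natr1 m.+1) -(natr1 m); nra.
lra.
Qed.

Lemma angle_limit : exists a : R, forall n, al n < a <= al n + 2 / (q n.+1)%:R.
Proof.
pose A := [set al n | n in setT].
have A0 : A !=set0 by exists (al 0%N); exists 0%N.
have le m n : (n <= m)%N -> al n <= al m.
  by rewrite leq_eqVlt => /orP[/eqP -> //|nm]; have [/ltW] := al_bound nm.
have ub n : ubound A (al n + 2 / (q n.+1)%:R).
  move=> _ [m _ <-]; have [nm|mn] := ltnP n m.
    have [_ h2] := al_bound nm; have := q_gt0 m; rewrite -invr_gt0; lra.
  have := le _ _ mn; have := q_gt0 n.+1; rewrite -invr_gt0; lra.
have hub : has_ubound A by exists (al 0%N + 2 / (q 1)%:R); exact: ub.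
exists (sup A) => n; apply/andP; split; last by apply: ge_sup.
have [h1 _] := al_bound (ltnSn n); apply: lt_le_trans h1 _.
by apply: ub_le_sup => //; exists n.+1.
Qed.

Variable a : R.
Hypothesis alim : forall n, al n < a <= al n + 2 / (q n.+1)%:R.

(** A Liouville argument: for a = P/Q the number (a - al n) Q q_n is a positive integer, yet it is
    at most 2 Q q_n/q_(n+1) <= 2Q/(n+2) < 1 for n = 2Q. *)
Lemma a_irrational : irrational a.
Proof.
rewrite irrationalE => r _ /= [_ -> era].
have d0 : (0 < denq r)%R := denq_gt0 r.
pose Q := `|denq r|%N.
have eQ : (denq r) = Q%:Z by rewrite /Q gez0_abs // ltW.
have Q0 : (0 : R) < Q%:R by rewrite ltr0n /Q absz_gt0 gt_eqF.
have aQ : a * Q%:R = (numq r)%:~R.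
  rewrite -era /ratr eQ; have -> : (Q%:Z)%:~R = Q%:R :> R by [].
  by rewrite divfK // gt_eqF.
pose n := (2 * Q)%N.
have /andP[h1 h2] := alim n.
have [p hp] := inv_a (okS n).
have key : (a - al n) * (Q%:R * (q n)%:R) = (numq r * (q n)%:Z - p * Q%:Z)%:~R.
  rewrite intrB !intrM -aQ -hp; have -> : (Q%:Z)%:~R = Q%:R :> R by [].
  by have -> : ((q n)%:Z)%:~R = (q n)%:R :> R by []; ring.
have Qq0 : 0 < Q%:R * (q n)%:R :> R by rewrite mulr_gt0 // q_gt0.
have pos : 0 < (a - al n) * (Q%:R * (q n)%:R) by rewrite mulr_gt0 // subr_gt0.
have ge1 : 1 <= (a - al n) * (Q%:R * (q n)%:R).
  rewrite key; rewrite key (ltr_int R 0) in pos.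
  by rewrite (ler_int R 1).
have : (a - al n) * (q n.+1)%:R <= 2.
  by rewrite -ler_pdivlMr ?q_gt0 //; lra.
have := q_step n; have -> : n.+2%:R = 2 * Q%:R + 2 :> R by rewrite /n -(natr1 (2 * Q).+1) -(natr1 (2 * Q)) natrM; ring.
have an0 : 0 < a - al n by rewrite subr_gt0.
move=> k1 k2.
have : (a - al n) * ((2 * Q%:R + 2) * (q n)%:R) <= (a - al n) * (q n.+1)%:R by rewrite ler_pM2l.
have : 0 < (a - al n) * (q n)%:R by rewrite mulr_gt0 // q_gt0.
move: ge1 k2; nra.
Qed.

Lemma al_cvg (e : R) : 0 < e -> exists n0, forall n, (n0 <= n)%N -> `|a - al n| < e.
Proof.
move=> e0; exists (Num.trunc (2 / e)) => n en.
have /andP[h1 h2] := alim n; rewrite ger0_norm ?subr_ge0 ?(ltW h1) //.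
apply: le_lt_trans (_ : 2 / (q n.+1)%:R < e); first by rewrite lerBlDl.
rewrite ltr_pdivrMr ?q_gt0 // mulrC -ltr_pdivrMr //.
apply: lt_le_trans (truncnS_gt _) _; apply: le_trans (q_big n.+1).
by rewrite ler_nat ltnS (leq_trans en).
Qed.

(** * The limit map *)

Lemma tail_limit (g : nat -> C) : (forall n, nm (g n.+1 - g n) <= b n / 4) ->
  (* These discs are nested, since b_n/4 + b_(n+1)/3 <= b_n/3. *)
  exists l, forall n, nm (l - g n) <= b n / 3.
Proof.
move=> hg; apply: (@nested_cpt R (fun n => [set w | nm (w - g n) <= b n / 3])) => n.
- exact: closed_ball_cpt.
- by exists (g n); rewrite /= subrr nm0; have := b_gt0 n; lra.
- move=> x /= hx; have := nm_tri x (g n.+1) (g n); have := hg n; have := b_step n; lra.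
Qed.

Lemma limit_exists : exists F dF : C -> C, forall z, nm z < 3 -> forall n,
  nm (F z - f n z) <= b n / 3 /\ nm (dF z - df n z) <= b n / 3.
Proof.
have /choice [F hF] : forall z, exists l, nm z < 3 -> forall n, nm (l - f n z) <= b n / 3.
  move=> z; have [z3|z3] := ltP (nm z) 3; last by exists 0.
  have [l hl] := tail_limit (g := fun n => f n z) (fun n => (st_f (stS n) z3).1).
  by exists l.
have /choice [dF hdF] : forall z, exists l, nm z < 3 -> forall n, nm (l - df n z) <= b n / 3.
  move=> z; have [z3|z3] := ltP (nm z) 3; last by exists 0.
  have [l hl] := tail_limit (g := fun n => df n z) (fun n => (st_f (stS n) z3).2).
  by exists l.
by exists F, dF => z z3 n; split; [exact: hF|exact: hdF].
Qed.

Variables F dF : C -> C.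
Hypothesis FP : forall z, nm z < 3 -> forall n,
  nm (F z - f n z) <= b n / 3 /\ nm (dF z - df n z) <= b n / 3.

(** The differences f_(m+1) - f_m are Lipschitz by the mean value inequality, and their constants
    add up to at most b_n/3. Both the derivative and the injectivity of the limit follow from this
    bound. *)
Lemma F_lip z w n : nm z < 3 -> nm w < 3 -> nm ((F w - f n w) - (F z - f n z)) <= b n / 3 * nm (w - z).
Proof.
move=> z3 w3.
have fin m : (n <= m)%N -> nm ((f m w - f n w) - (f m z - f n z)) <= (b n - b m) / 3 * nm (w - z).
  elim: m => [|m IH].
    by rewrite leqn0 => /eqP ->; rewrite !subrr nm0 mul0r mul0r.
  rewrite leq_eqVlt => /orP[/eqP ->|nm'].
    by rewrite !subrr nm0 mul0r mul0r.
  have -> : f m.+1 w - f n w - (f m.+1 z - f n z) =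
     ((f m.+1 w - f m w) - (f m.+1 z - f m z)) + (f m w - f n w - (f m z - f n z)) by ring.
  apply: le_trans (nmD _ _) _; have := IH nm'.
  have : nm ((f m.+1 w - f m w) - (f m.+1 z - f m z)) <= b m / 4 * nm (w - z).
    apply: (@mvt_seg R (fun x => f m.+1 x - f m x)) => t t01.
    have s3 : nm (segp z w t) < 3.
      have := @nm_segp R z w t (Num.max (nm z) (nm w)) t01 ltac:(by rewrite le_max lexx) ltac:(by rewrite le_max lexx orbT).
      by move=> k; apply: le_lt_trans k _; rewrite gt_max z3.
    exists (df m.+1 (segp z w t) - df m (segp z w t)); last exact: (st_f (stS m) s3).2.
    have [_ _ d1 _] := inv_f (okS m.+1) s3; have [_ _ d2 _] := inv_f (okS m) s3.
    have := hasderD d1 (hasderM (hasder_cst (-1) (segp z w t)) d2).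
    rewrite mul0r add0r mulN1r; apply: hasder_ext => x; by rewrite mulN1r.
  have := b_step m; have := nm_ge0 (w - z); set X := nm (w - z) => X0.
  move: (b n) (b m) (b m.+1) => bn bm bm1 h1 h2 h3.
  have : (bm - bm1) / 3 * X >= bm / 4 * X by rewrite ler_wpM2r //; lra.
  lra.
apply/ler_addgt0Pr => e e0; have [n0 hn0] := b_cvg e0.
pose m := maxn n n0.
have k1 := fin m (leq_maxl _ _); have k2 := hn0 m (leq_maxr _ _).
have [k3 _] := FP z3 m; have [k4 _] := FP w3 m.
have -> : F w - f n w - (F z - f n z) = (f m w - f n w - (f m z - f n z)) + ((F w - f m w) - (F z - f m z)) by ring.
apply: le_trans (nmD _ _) _; have := nmB (F w - f m w) (F z - f m z).
have : (b n - b m) / 3 * nm (w - z) <= b n / 3 * nm (w - z).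
  by rewrite ler_wpM2r ?nm_ge0 //; have := b_gt0 m; lra.
have := b_gt0 m; lra.
Qed.

Lemma F_hasder z : nm z < 3 -> hasder F z (dF z).
Proof.
move=> z3 e e0; have [n hn] := b_cvg (e := e / 2) ltac:(lra).
have bn := hn n (leqnn n); have b0 := b_gt0 n.
have [_ _ d _] := inv_f (okS n) z3.
have [r r0 hr] := d (e / 4) ltac:(lra).
exists (Num.min r (3 - nm z)); first by rewrite lt_min r0 subr_gt0.
move=> w; rewrite lt_min => /andP[w1 w2].
have w3 : nm w < 3 by have := nm_subr_ge w z; lra.
have k1 := F_lip n z3 w3; have k2 := hr w w1; have [_ k3] := FP z3 n.
have -> : F w - F z - dF z * (w - z) = ((F w - f n w) - (F z - f n z)) + (f n w - f n z - df n z * (w - z))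
   - (dF z - df n z) * (w - z) by ring.
apply: le_trans (nmB _ _) _; apply: le_trans (lerD (nmD _ _) (lexx _)) _; rewrite nmM.
have := nm_ge0 (w - z); move: k1 k2 k3 bn b0 e0.
set X := nm (w - z); set Y := nm (dF z - _) => k1 k2 k3 bn b0 e0 X0.
have : Y * X <= b n / 3 * X by rewrite ler_wpM2r.
have : b n * X <= e / 2 * X by rewrite ler_wpM2r // ltW.
have : 0 <= e * X by rewrite mulr_ge0 // ltW.
lra.
Qed.

Lemma f0_id z : f 0%N z = z. Proof. by rewrite S0. Qed.

(** [f_0] is the identity, so [F - id] is Lipschitz with constant at most 1/12. *)
Lemma F_inj z w : nm z < 3 -> nm w < 3 -> F z = F w -> z = w.
Proof.
move=> z3 w3 e; have := F_lip 0 z3 w3; rewrite !f0_id e.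
have -> : F w - w - (F w - z) = - (w - z) by ring.
rewrite nmN => k; have := inv_b (okS 0%N) => /andP[_ b4].
have : nm (w - z) <= 0 by have := nm_ge0 (w - z); nra.
move=> k2; apply/eqP; rewrite eq_sym -subr_eq0 -nm_eq0 eq_le k2 nm_ge0 //.
Qed.

Lemma small_eq0 (z : C) : (forall e : R, 0 < e -> nm z <= e) -> z = 0.
Proof.
move=> hz; apply/eqP; rewrite -nm_eq0 eq_le nm_ge0 andbT.
by apply/ler_addgt0Pr => e e0; rewrite add0r; exact: hz.
Qed.

Lemma F_0 : F 0 = 0.
Proof.
apply: small_eq0 => e e0; have [n hn] := b_cvg e0.
have [k _] := @FP 0 ltac:(by rewrite nm0) n; move: k; rewrite (inv_f0 (okS n)) subr0.
have := hn n (leqnn n); have := b_gt0 n; lra.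
Qed.

(** Differentiate the conjugacy to the rotation at the common fixed point 0. *)
Lemma df_0 n : df n 0 = rot_mult (al n).
Proof.
have z3 : nm (0 : C) < 3 by rewrite nm0.
have [_ _ d _] := inv_f (okS n) z3.
have Hd := inv_d (okS n); have dn0 : ldH (S n) 0 != 0 by apply: (inv_d0 (okS n)); rewrite nm0.
have hk : hasder (fun w => rot_mult (al n) * H n w) 0 (rot_mult (al n) * ldH (S n) 0).
  by have := hasderM (hasder_cst (rot_mult (al n)) 0) (Hd 0); rewrite mul0r add0r.
have f00 := inv_f0 (okS n).
have := @hasder_implicit R (H n) (f n) _ 0 (ldH (S n) 0) _ ltac:(by rewrite f00; exact: Hd) dn0 hk (hasder_ccont d).
move=> /(_ _) hh; rewrite (hasder_uniq d (hh _)) ?mulfK //.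
by exists 3 => // w; rewrite subr0 => w3; have [] := inv_f (okS n) w3.
Qed.

Lemma dF_0 : dF 0 = rot_mult a.
Proof.
apply/eqP; rewrite -subr_eq0; apply/eqP; apply: small_eq0 => e e0; have p0 := pi_gt0 R.
have [n1 h1] := b_cvg (e := e / 2) ltac:(lra).
have [n2 h2] := al_cvg (e := e / (4 * pi)) ltac:(by rewrite divr_gt0 // mulr_gt0).
pose n := maxn n1 n2.
have k1 := h1 n (leq_maxl _ _); have k2 := h2 n (leq_maxr _ _).
have [_ k3] := @FP 0 ltac:(by rewrite nm0) n; rewrite df_0 in k3.
have k4 := rot_mult_dist (al n) a; rewrite distrC in k4.
have k5 : 2 * pi * `|a - al n| <= e / 2.
  have : `|a - al n| * (4 * pi) <= e by rewrite -ler_pdivlMr ?mulr_gt0 // ltW.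
  lra.
have := nm_tri (dF 0) (rot_mult (al n)) (rot_mult a); have := b_gt0 n.
move: k1 k3 k4 k5; lra.
Qed.

(** * The invariant compact set *)

Definition L n : set C := h n @` disc 1.
Definition K : set C := [set z | forall n, L n z].

Lemma lr_gt1 n : 1 < lr (S n). Proof. exact: inv_r (okS n). Qed.

Lemma hP n w : nm w < lr (S n) -> H n (h n w) = w /\ nm (h n w) < 1.
Proof. by have [_ _] := inv_h (okS n); apply. Qed.

Lemma hP1 n w : nm w <= 1 -> H n (h n w) = w /\ nm (h n w) < 1.
Proof. by move=> w1; apply: hP; exact: le_lt_trans w1 (lr_gt1 n). Qed.

Lemma h_0 n : h n 0 = 0. Proof. by have [] := inv_h (okS n). Qed.

Lemma hM5 n w : nm w < lr (S n) -> nm (h n w) < 5.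
Proof. by move=> /hP [_]; lra. Qed.

Lemma h_cont n : cconton (bal (lr (S n))) (h n).
Proof. by have [] := inv_h (okS n). Qed.

Lemma L_cpt n : compact (L n).
Proof. exact: (branch_compact (@h_cont n) (lr_gt1 n)). Qed.

Lemma L_closed n : closed (L n).
Proof. by apply: compact_closed; [exact: norm_hausdorff|exact: L_cpt]. Qed.

Lemma L_conn n : connected (L n).
Proof.
have := @branch_conn R (h n) (lr (S n)) (@h_cont n) 1; congr connected; congr (_ @` _).
apply/seteqP; split=> [w []//|w w1]; split => //.
exact: le_lt_trans (w1 : nm w <= 1) (lr_gt1 n).
Qed.

Lemma L_full n : connected (~` L n).
Proof.
apply: (branch_full (inv_d (okS n)) (inv_dc (okS n)) (inv_d0 (okS n)) (@h_cont n)).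
- by move=> w /hP [].
- exact: hM5.
- lra.
- by move=> w /hP [].
- by rewrite ler01 lr_gt1.
Qed.

Lemma L_sub n w : nm w <= 1 -> h n.+1 w = h n (hs n w) /\ nm (hs n w) < 1.
Proof. by move=> w1; apply: (st_h (stS n)); exact: le_lt_trans w1 (lr_gt1 n.+1). Qed.

Lemma L_lt1 n m w : (n < m)%N -> nm w <= 1 -> exists w', [/\ h m w = h n w', nm w' < 1 &
  ~ chan (q n.+1) (sg n) (x0 n) w'].
Proof.
elim: m w => [//|m IH] w; rewrite ltnS leq_eqVlt => /orP[/eqP ->|nm'] w1.
  have [e1 e2] := L_sub m w1; exists (hs m w); split => //.
  by apply: (st_chan (stS m)); exact: le_lt_trans w1 (lr_gt1 m.+1).
by have [-> e2] := L_sub m w1; apply: IH => //; exact: ltW.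
Qed.

Lemma L_mono n m : (n <= m)%N -> L m `<=` L n.
Proof.
rewrite leq_eqVlt => /orP[/eqP -> //|nm'] z [w w1 <-].
by have [w' [-> w'1 _]] := L_lt1 nm' w1; exists w' => //; exact: ltW.
Qed.

Lemma L_1 n z : L n z -> nm z < 1.
Proof. by move=> [w /(@hP1 n) [_ h1] <-]. Qed.

Lemma K_in n z : K z -> [/\ z = h n (H n z), nm (H n z) < 1 & ~ chan (q n.+1) (sg n) (x0 n) (H n z)].
Proof.
move=> /(_ n.+1) [w w1 <-]; have [w' [-> w'1 nc]] := L_lt1 (ltnSn n) w1.
by have [-> _] := hP1 n (ltW w'1).
Qed.

Lemma K_0 : K 0.
Proof. by move=> n; exists 0; [rewrite /disc /= nm0|exact: h_0]. Qed.

Lemma L_dense n m w : (n <= m)%N -> nm w <= 1 ->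
  exists2 w', nm w' <= 1 & nm (h n w - h m w') <= (b n - b m) / 3.
Proof.
elim: m => [|m IH]; first by rewrite leqn0 => /eqP -> w1; exists w => //; rewrite !subrr nm0 mul0r.
rewrite leq_eqVlt => /orP[/eqP ->|nm'] w1; first by exists w => //; rewrite !subrr nm0 mul0r.
have [w' w'1 h1] := IH nm' w1; have [w2 w21 h2] := st_dens (stS m) w'1.
exists w2 => //; have := nm_tri (h n w) (h m w') (h m.+1 w2); have := b_step m.
move: h1 h2; lra.
Qed.

(** Points of the later discs approximate the given one with total error below b_n/3, and a nested
    intersection turns them into a point of [K]. *)
Lemma K_dense n w : nm w <= 1 -> exists2 z, K z & nm (h n w - z) <= b n / 3.
Proof.
move=> w1; have [|||x hx] := @nested_cpt R (fun m => L (n + m) `&` [set z | nm (z - h n w) <= b n / 3]).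
- move=> m; apply: (subclosed_compact _ (@closed_ball_cpt R (h n w) (b n / 3))); last by move=> z [].
  by apply: closedI; [exact: L_closed|apply: compact_closed; [exact: norm_hausdorff|exact: closed_ball_cpt]].
- move=> m; have [w' w'1 h1] := L_dense (leq_addr m n) w1.
  exists (h (n + m) w'); split; first by exists w'.
  by rewrite /= nmBC; apply: le_trans h1 _; have := b_gt0 (n + m); lra.
- by move=> m z [h1 h2]; split => //; apply: L_mono h1; rewrite leq_add2l.
exists x; last by rewrite nmBC; exact: (hx 0%N).2.
move=> m; have [h1 _] := hx m; apply: L_mono h1; exact: leq_addl.
Qed.

Lemma K_closed : closed K.
Proof.
apply/closedCP => z hz n; apply: (closedCP (L n)).1; first exact: L_closed.
by move=> e e0; have [w Kw wz] := hz e e0; exists w.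
Qed.

Lemma K_cpt : compact K.
Proof. by apply: (subclosed_compact K_closed (@L_cpt 0%N)) => z; apply. Qed.

(** A compact path off [K] misses some [L m] altogether, and with it the arms of [L m] that will
    confine the path. *)
Lemma cpt_avoid_L (A : set C) : compact A -> (forall z, A z -> ~ K z) ->
  exists n, forall m, (n <= m)%N -> forall z, A z -> ~ L m z.
Proof.
move=> cA AK; apply: contrapT => no.
have [n|n|n|x hx] := @nested_cpt R (fun n => A `&` L n).
- have clA : closed A by apply: compact_closed => //; exact: norm_hausdorff.
  apply: (subclosed_compact _ cA); last by move=> z [].
  by apply: closedI => //; exact: L_closed.
- apply: contrapT => em; apply: no; exists n => m nm' z Az Lz.
  by apply: em; exists z; split => //; exact: L_mono Lz.
- by move=> z [h1 h2]; split => //; exact: L_mono h2.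
- by apply: (AK x); [exact: (hx 0%N).1|move=> n; exact: (hx n).2].
Qed.

Lemma K_full : connected (~` K).
Proof.
have -> : ~` K = \bigcup_(n in setT) ~` L n.
  apply/seteqP; split=> [z zK|z [n _ nL] zK]; last exact: nL (zK n).
  by apply: contrapT => no; apply: zK => n; apply: contrapT => nL; apply: no; exists n.
apply: bigcup_connected; last by move=> n _; exact: L_full.
by exists 1 => n _ /L_1; rewrite nm1; lra.
Qed.

Lemma nbhd_L (e : R) : 0 < e -> exists n, forall z, L n z -> exists2 k, K k & nm (z - k) < e.
Proof.
move=> e0; pose O : set C := [set z | exists2 k, K k & nm (z - k) < e].
have cO : closed (~` O).
  apply: open_closedC; apply/openCP => z [k Kk zk]; exists (e - nm (z - k)); first by rewrite subr_gt0.
  move=> w wz; exists k => //; have := nm_tri w z k; lra.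
have [||n hn] := @cpt_avoid_L (disc 1 `&` ~` O).
- apply: (subclosed_compact _ (@compact_disc R 1)); last by move=> z [].
  apply: closedI => //; apply: compact_closed; [exact: norm_hausdorff|exact: compact_disc].
- by move=> z [_ zO] Kz; apply: zO; exists z => //; rewrite subrr nm0.
exists n => z Lz; apply: contrapT => nO; apply: (hn n (leqnn n) z) => //.
by split => //; rewrite /disc /=; exact/ltW/(L_1 Lz).
Qed.

(** The two parts of a separation of [K] would be at a positive distance [e]; some [L n] lies within
    e/3 of [K] and would be separated too. *)
Lemma K_conn : connected K.
Proof.
move=> B [b0 Bb0] [W oW eW] [Cl cCl eCl]; apply/seteqP; split; first by rewrite eW => z [].
move=> k1 Kk1; apply: contrapT => nB.
pose B' := K `&` ~` W.
have cB' : compact B' by apply: (subclosed_compact _ K_cpt); [apply: closedI; [exact: K_closed|exact: open_closedC]|move=> z []].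
have cB : compact B by apply: (subclosed_compact _ K_cpt); [rewrite eCl; apply: closedI => //; exact: K_closed|rewrite eCl => z []].
have B'E z : K z -> ~ B z -> B' z by move=> Kz nBz; split => // Wz; apply: nBz; rewrite eW.
have BK z : B z -> K z by rewrite eW => -[].
have [e e0 he] : exists2 e : R, 0 < e & forall z, B z -> forall w, B' w -> e <= nm (z - w).
  apply: (@cpt_unif R B (fun e z => forall w, B' w -> e <= nm (z - w)) cB) => [e e' z _ ee h w B'w|z Bz].
    exact: le_trans ee (h w B'w).
  have Wz : W z by move: Bz; rewrite eW => -[].
  have [e e0 he] := (openCP W).1 oW z Wz.
  exists (e / 2); first lra.
  exists (e / 2); first lra.
  move=> y By yz w [Kw nWw]; rewrite leNgt; apply/negP => yw; apply: nWw; apply: he.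
  by have := nm_tri w y z; rewrite (nmBC w y); lra.
have [n hn] := nbhd_L (e := e / 3) ltac:(lra).
pose U (A : set C) : set C := [set z | exists2 k, A k & nm (z - k) < e / 3].
have oU A : open (U A).
  apply/openCP => z [k Ak zk]; exists (e / 3 - nm (z - k)); first by rewrite subr_gt0.
  by move=> w wz; exists k => //; have := nm_tri w z k; lra.
have eL : L n `&` U B = L n `&` ~` U B'.
  apply/seteqP; split=> z [Lz Uz]; split => //.
    move=> [w B'w zw]; have [k Bk zk] := Uz; have := he k Bk w B'w.
    by have := nm_tri k z w; rewrite (nmBC k z); lra.
  have [k Kk zk] := hn z Lz; exists k => //; apply: contrapT => nBk.
  by apply: Uz; exists k => //; exact: B'E.
have eqL : L n `&` U B = L n.
  apply: (@L_conn n).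
  - by exists b0; split; [exact: (BK _ Bb0)|exists b0 => //; rewrite subrr nm0; lra].
  - by exists (U B).
  - by exists (~` U B') => //; exact: open_closedC.
have : (L n `&` U B) k1 by rewrite eqL; exact: Kk1.
move=> [_ [k Bk k1k]]; have := he k Bk k1 (B'E _ Kk1 nB); rewrite nmBC; lra.
Qed.

(** The two sides have the same image under [H n], which is not injective; but both lift the same
    map and agree at 0. *)
Lemma f_h n w : nm w <= 1 -> f n (h n w) = h n (rot_mult (al n) * w).
Proof.
move=> w1; have wr := le_lt_trans w1 (lr_gt1 n).
have rot v : nm v < lr (S n) -> nm (rot_mult (al n) * v) < lr (S n) by rewrite nmM nm_rot_mult mul1r.
have h3 v : nm v < lr (S n) -> nm (h n v) < 3 by move=> /hP [_]; lra.
apply: (lift_uniq (inv_d (okS n)) (inv_dc (okS n)) (inv_d0 (okS n)) (r := lr (S n)) (h1 := fun v => f n (h n v))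
   (h2 := fun v => h n (rot_mult (al n) * v))) => // [z zr e e0|z zr e e0|v vr|].
- have [_ _ d _] := inv_f (okS n) (h3 z zr).
  have [d1 d10 hd1] := hasder_ccont d e0; have [d2 d20 hd2] := @h_cont n z zr d1 d10.
  by exists d2 => // v vr vz; apply: hd1; exact: hd2.
- have [d1 d10 hd1] := @h_cont n _ (rot z zr) e e0; exists d1 => // v vr vz.
  by apply: hd1; [exact: rot|rewrite -mulrBr nmM nm_rot_mult mul1r].
- have [e1 k1 _ _] := inv_f (okS n) (h3 v vr); have [e2 k2] := hP vr; have [e3 k3] := hP (rot v vr).
  have bn := b_gt0 n; split.
  + by have := nm_subr_ge (f n (h n v)) (h n v); move: k1 k2 bn; lra.
  + by move: k3; lra.
  + by rewrite e1 e2 e3.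
- by rewrite mulr0 h_0 (inv_f0 (okS n)).
Qed.

Lemma K_1 z : K z -> nm z < 1. Proof. by move=> /(_ 0%N) /L_1. Qed.

(** Forward invariance passes to the limit because [L n] is closed. A preimage of [y] is found in
    the nested compact sets of points of [L n] that [F] sends within b_n/3 of [y]; they are nonempty
    because [f_n] maps [L n] onto itself. *)
Lemma F_K : F @` K = K.
Proof.
apply/seteqP; split=> [_ [x Kx <-] n|y Ky].
  have x3 : nm x < 3 by have := K_1 Kx; lra.
  apply: (closedCP (L n)).1; first exact: L_closed.
  move=> e e0; have [n0 hn0] := b_cvg e0; pose m := maxn n n0.
  exists (f m x).
    have [w w1 <-] := Kx m; rewrite f_h //; apply: (L_mono (leq_maxl n n0)).
    by exists (rot_mult (al m) * w) => //; rewrite /disc /= nmM nm_rot_mult mul1r.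
  have [k1 _] := FP x3 m; have := hn0 m (leq_maxr _ _); have := b_gt0 m; rewrite nmBC; lra.
have L3 n z : L n z -> nm z < 3 by move=> /L_1; lra.
have [n|n|n|x hx] := @nested_cpt R (fun n => L n `&` [set x | nm (F x - y) <= b n / 3]).
- apply: (subclosed_compact _ (@L_cpt n)); last by move=> z [].
  apply/closedCP => z hz.
  have Lz : L n z.
    apply: (closedCP (L n)).1; first exact: L_closed.
    by move=> e e0; have [w [Lw _] wz] := hz e e0; exists w.
  split=> //=; apply/ler_addgt0Pr => e e0.
  have [d d0 hd] := hasder_ccont (F_hasder (L3 n z Lz)) e0.
  have [w [_ /= Fw] wz] := hz d d0; have := hd w wz; have := nm_tri (F z) (F w) y.
  by rewrite (nmBC (F z) (F w)); lra.
- have [w w1 ew] := Ky n; pose w' := (rot_mult (al n))^-1 * w.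
  have r0 : rot_mult (al n) != 0 by rewrite -nm_gt0 nm_rot_mult.
  have w'1 : nm w' <= 1 by rewrite nmM nmV nm_rot_mult invr1 mul1r.
  exists (h n w'); split; first by exists w'.
  have Lw' : L n (h n w') by exists w'.
  rewrite /=; have := (FP (L3 n _ Lw') n).1; rewrite f_h // /w' mulrA divff // mul1r ew; exact.
- by move=> z [h1 h2]; split; [exact: L_mono h1|rewrite /= in h2 *; have := b_step n; have := b_gt0 n; lra].
exists x; first by move=> n; exact: (hx n).1.
apply/eqP; rewrite -subr_eq0; apply/eqP; apply: small_eq0 => e e0; have [n hn] := b_cvg e0.
have := (hx n).2; rewrite /=; have := hn n (leqnn n); have := b_gt0 n; lra.
Qed.

(* The angular step between neighbouring channels of level [n]. *)
Definition gap n : R := 2 * pi / (q n.+1)%:R.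

(* Inner radius of the annulus in which each channel winds around once. *)
Definition rim n : R := expR (- (2 * pi / sg n)).

Definition channel n (k : int) : set C := [set z | exists2 x, x0 n <= x <= 0 &
  z = cexp (rC x * Complex 1 (sg n) + im (gap n * k%:~R))].

(** * Channels, arms and the barrier *)

Lemma sg_gt0 n : 0 < sg n. Proof. exact: st_sg (stS n). Qed.

Lemma rim_gt0 n : 0 < rim n. Proof. exact: expR_gt0. Qed.

Lemma gap_gt0 n : 0 < gap n <= 2 * pi.
Proof.
have p0 := pi_gt0 R; have q0 := inv_q (okS n.+1).
have q1 : (1 : R) <= (q n.+1)%:R by rewrite ler1n.
rewrite /gap divr_gt0 ?mulr_gt0 //= ?ler_pdivrMr ?(lt_le_trans ltr01 q1) //.
by rewrite ler_peMr // mulr_ge0 // ltW.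
Qed.

Lemma channelP n k z : channel n k z -> chan (q n.+1) (sg n) (x0 n) z.
Proof.
move=> [x xx ->]; exists x, k; split => //.
by rewrite /gap; congr (cexp (_ + im _)); rewrite mulrAC.
Qed.

Lemma channel_log n k w : - (2 * pi / sg n) <= complex.Re w <= 0 ->
  sg n * complex.Re w - complex.Im w = - (gap n * k%:~R) -> channel n k (cexp w).
Proof.
move=> /andP[w1 w2] e; exists (complex.Re w).
  by rewrite w2 andbT (le_trans (st_x0 (stS n))).
congr cexp; apply: complex_ext; rewrite ?cReD ?cImD ?cReM ?cImM /=; first by ring.
by move: e; set u := gap n * _ => e; lra.
Qed.

(* A curve of [L m], for [m] large, that runs to [0] between two neighbouring channels. *)
Lemma arm n m (k : int) : (n < m)%N -> exists (p : R -> C) (om : C), [/\ pconton 0 1 p, p 0 = cexp om, p 1 = 0,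
  [/\ - gap n < sg n * complex.Re om, complex.Re om < 0 &
    - (gap n * k%:~R) < sg n * complex.Re om - complex.Im om < - (gap n * k%:~R) + gap n] &
  forall t, 0 <= t <= 1 -> [/\ nm (p t) < 1, forall j, ~ channel n j (p t) & L m (h n (p t))]].
Proof.
move=> nm'; have [w' w'1 hw'] := st_tip (stS n) k.
have [w2 w21 hw2] := L_dense nm' w'1.
(* The levels from n+1 to m displace the tip by less than [b n.+1], the radius within which [st_tip]
   applies. *)
have [|om [eom o1 o2 o3]] := hw' (h m w2).
  by rewrite nmBC; apply: le_trans hw2 _; have := b_gt0 m; have := b_gt0 n.+1; lra.
pose u t : C := rC (1 - t) * w2.
have u1 t : 0 <= t <= 1 -> nm (u t) <= 1.
  move=> /andP[t0 t1]; rewrite nmM nm_rC ger0_norm ?subr_ge0 //; have := nm_ge0 w2; nra.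
have cu : pconton 0 1 u.
  move=> t _ e e0; exists e => // s _ st.
  rewrite /u -mulrBl -rCN -rCD nmM nm_rC; have -> : 1 - s + - (1 - t) = - (s - t) by ring.
  by rewrite normrN; have := normr_ge0 (s - t); have := nm_ge0 w2; nra.
exists (fun t => H n (h m (u t))), om.
have hm t : 0 <= t <= 1 -> [/\ nm (H n (h m (u t))) < 1, forall j, ~ channel n j (H n (h m (u t))) &
    h n (H n (h m (u t))) = h m (u t)].
  move=> t01; have [w'' [e1 e2 e3]] := L_lt1 nm' (u1 t t01).
  have [e4 _] := hP1 n (ltW e2); rewrite e1 e4; split => // j /channelP //.
split.
- apply: (pconton_comp (A := setT) (h := H n)) => //.
    apply: (pconton_comp (A := bal (lr (S m)))) => //; last exact: h_cont.
    by move=> t t01; exact: le_lt_trans (u1 t t01) (lr_gt1 m).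
  by apply: ccont_on => z _; exact: hasder_ccont (inv_d (okS n) z).
- have om1 : nm (cexp om) <= 1 by rewrite nm_cexp -expR0 ler_expR ltW.
  by rewrite /u subr0 rC1 mul1r eom; have [] := hP1 n om1.
- by rewrite /u subrr rC0 mul0r h_0 (inv_0 (okS n)).
- split => //; by rewrite /gap (mulrAC (2 * pi) _ (k%:~R)).
- move=> t t01; have [h1 h2 h3] := hm t t01; split => //.
  by rewrite h3; exists (u t) => //; exact: u1.
Qed.

(** In the coordinate [shear] the channels become vertical lines at spacing [gap n]; by the
    intermediate value theorem a path avoiding them stays between the same two. *)
Lemma log_between n (k : int) (w : R -> C) (T : R) : 0 <= T -> pconton 0 T w ->
  (forall t, 0 <= t <= T -> - (2 * pi / sg n) <= complex.Re (w t) <= 0) ->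
  (forall t, 0 <= t <= T -> forall j, ~ channel n j (cexp (w t))) ->
  - (gap n * k%:~R) < sg n * complex.Re (w 0) - complex.Im (w 0) < - (gap n * k%:~R) + gap n ->
  forall t, 0 <= t <= T -> - (gap n * k%:~R) < sg n * complex.Re (w t) - complex.Im (w t) < - (gap n * k%:~R) + gap n.
Proof.
move=> T0 cw re nc /andP[lo hi] t /andP[t0 tT].
have cw' : pconton 0 t (shear (sg n) \o w).
  apply: (pconton_comp (A := setT)) => //; first exact: pconton_sub cw.
  by apply: ccont_on => z _; exact: shear_cont (sg_gt0 n).
have hit (G : C -> R) v : (forall z z', `|G z - G z'| <= 1 * nm (z - z')) ->
   G (shear (sg n) (w 0)) <= v <= G (shear (sg n) (w t)) -> exists2 s, 0 <= s <= t & G (shear (sg n) (w s)) = v.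
  by move=> GL hv; exact: (ivt_C t0 ltr01 cw' GL).
apply/andP; split; rewrite ltNge; apply/negP => bad.
  have [z z'||s /andP[s0 st] es] := hit (fun z => - complex.Re z) (gap n * k%:~R).
  - by rewrite mul1r -opprD normrN -cReN -cReD; exact: Re_le_nm.
  - by rewrite /shear /=; lra.
  have sT : 0 <= s <= T by rewrite s0 (le_trans st).
  apply: (nc s sT k); apply: channel_log; first exact: re.
  by move: es; rewrite /shear /=; lra.
have [z z'||s /andP[s0 st] es] := hit (fun z => complex.Re z) (- (gap n * (k - 1)%:~R)).
- by rewrite mul1r -cReN -cReD; exact: Re_le_nm.
- by rewrite /shear /= intrD mulrDr mulrN1; lra.
have sT : 0 <= s <= T by rewrite s0 (le_trans st).
apply: (nc s sT (k - 1)); apply: channel_log; first exact: re.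
by move: es; rewrite /shear /=; lra.
Qed.

(** Put th = gap n * k and pass to sheared logarithms. Avoiding the sector confines the path to th -
    2 pi + 2 gap < Im < th - 2 gap. Across this band runs an arm of some [L m], within -th < Re <
    -th + gap. The path starts to the right of the arm, while the possible endings on the rim or on
    channel [k] have Re <= -th; by [crossing] the path would meet the arm, but it avoids [L m]. *)
Lemma barrier_core n (k : int) (g : R -> C) (s0 s1 : R) : s0 <= s1 -> pconton s0 s1 g ->
  (forall s, s0 <= s <= s1 -> [/\ rim n <= nm (g s), nm (g s) <= 1 & ~ K (h n (g s))]) ->
  nm (g s0) = 1 ->
  (forall s r y, s0 <= s <= s1 -> rim n <= r <= 1 -> `|y - gap n * k%:~R| <= 2 * gap n ->
     g s <> rC r * cexp (im y)) ->
  nm (g s1) <> rim n /\ ~ channel n k (g s1).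
Proof.
move=> s01 cg gP g0 wall; have sg0 := sg_gt0 n; have p0 := pi_gt0 R.
have /andP[v0 v1] := gap_gt0 n; have r0 := rim_gt0 n.
have [n0 hn0] : exists n0, forall m, (n0 <= m)%N -> forall z, ((h n \o g) @` `[s0, s1]) z -> ~ L m z.
  apply: cpt_avoid_L.
    apply: pconton_cpt; apply: (pconton_comp (A := bal (lr (S n)))) => //; last exact: h_cont.
    by move=> s /gP [_ g1 _]; exact: le_lt_trans g1 (lr_gt1 n).
  by move=> z [s /= ss <-]; have [] := gP s ltac:(by rewrite in_itv in ss).
pose m := maxn n0 n.+1; have nm' : (n < m)%N by rewrite leq_max ltnSn orbT.
have [p [om [cp p0' p1 [m1 o2 o3] hp]]] := arm k nm'.
have Ro : rim n <= nm (p 0).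
  rewrite p0' nm_cexp ler_expR lerNl ler_pdivlMr //.
  move: m1; rewrite mulNr (mulrC (complex.Re om)) => m1; lra.
have [|T /andP[T0 T1] [eT hT]] := first_hit ler01 cp Ro; first by rewrite p1 nm0 ltW.
have [|w [cw ew0 ew]] := cexp_lift T0 (pconton_sub (lexx 0) T1 cp) _ (esym p0').
  by move=> t tT; rewrite -nm_gt0; exact: lt_le_trans r0 (hT t tT).
have in01 t : 0 <= t <= T -> 0 <= t <= 1 by move=> /andP[-> tT]; exact: le_trans tT T1.
have Rw t : 0 <= t <= T -> - (2 * pi / sg n) <= complex.Re (w t) <= 0.
  move=> tT; have := hT t tT; have [pt1 _ _] := hp t (in01 t tT).
  move: pt1; rewrite -(ew t tT) nm_cexp ler_expR -expR0 ltr_expR => h1 h2.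
  by rewrite h2 ltW.
have psw t : 0 <= t <= T -> - (gap n * k%:~R) < sg n * complex.Re (w t) - complex.Im (w t) < - (gap n * k%:~R) + gap n.
  move: t; apply: (log_between T0 cw Rw); rewrite ?ew0 // => s sT j.
  by rewrite ew //; have [_ nc _] := hp s (in01 s sT).
have ReT : complex.Re (w T) = - (2 * pi / sg n).
  by apply: expR_inj; rewrite -nm_cexp ew ?lexx ?T0 // -eT.
pose th := gap n * k%:~R.
(* The logarithm of the starting point is taken in the window [th - 2 pi, th) between two lifts of
   the middle of the sector. *)
have [w0 ew0' /andP[i1 i2]] := @cexp_surj_win R (g s0) (th - 2 * pi) ltac:(by rewrite -nm_gt0 g0).
have [|W [cW eW0 eW]] := cexp_lift s01 cg _ ew0'.
  by move=> s ss; rewrite -nm_gt0; have [h1 _ _] := gP s ss; exact: lt_le_trans r0 h1.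
have nowall s (j : int) : s0 <= s <= s1 -> 2 * gap n < `|complex.Im (W s) + 2 * pi * j%:~R - th|.
  move=> ss; rewrite ltNge; apply/negP => bad; have [h1 h2 _] := gP s ss.
  apply: (wall s (nm (g s)) (complex.Im (W s) + 2 * pi * j%:~R)) => //; first by rewrite h1.
  rewrite imD cexpD cexp_im2pi mulr1 -(eW s ss) nm_cexp rC_cexp; congr cexp.
  by apply: complex_ext; rewrite ?cReD ?cImD /= ?addr0 ?add0r.
have ImW s : s0 <= s <= s1 -> th - 2 * pi + 2 * gap n < complex.Im (W s) < th - 2 * gap n.
  have start : th - 2 * pi + 2 * gap n < complex.Im (W s0) < th - 2 * gap n.
    have ss : s0 <= s0 <= s1 by rewrite lexx.
    have h0 := nowall s0 0 ss; have h1 := nowall s0 1 ss.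
    rewrite eW0 ?mulr0 ?addr0 ?mulr1 in h0 h1 *; rewrite subrK in i2; apply: between_walls; rewrite ?i1 ?i2 //.
  move=> /andP[ss1 ss2]; have cWs : pconton s0 s W := pconton_sub (lexx s0) ss2 cW.
  have hit (G : C -> R) v : (forall z z', `|G z - G z'| <= 1 * nm (z - z')) ->
     G (W s0) <= v <= G (W s) -> exists2 u, s0 <= u <= s & G (W u) = v.
    by move=> GL hv; exact: (ivt_C ss1 ltr01 cWs GL).
  apply/andP; split; rewrite ltNge; apply/negP => bad.
    have [z z'||u /andP[u1 u2] eu] := hit (fun z => - complex.Im z) (- (th - 2 * pi + 2 * gap n)).
    - by rewrite mul1r -opprD normrN -cImN -cImD; exact: Im_le_nm.
    - lra.
    have := nowall u 1 ltac:(by rewrite u1 (le_trans u2)); rewrite mulr1.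
    rewrite (oppr_inj eu) (_ : _ + _ - th = 2 * gap n); last by ring.
    by rewrite ger0_norm ?ltxx // mulr_ge0 // ltW.
  have [z z'||u /andP[u1 u2] eu] := hit (fun z => complex.Im z) (th - 2 * gap n).
  - by rewrite mul1r -cImN -cImD; exact: Im_le_nm.
  - lra.
  have := nowall u 0 ltac:(by rewrite u1 (le_trans u2)); rewrite mulr0 addr0.
  rewrite eu (_ : _ - th = - (2 * gap n)); last by ring.
  by rewrite normrN ger0_norm ?ltxx // mulr_ge0 // ltW.
have start : - th + gap n <= complex.Re (shear (sg n) (W s0)).
  have /andP[_ h1] := ImW s0 ltac:(by rewrite lexx).
  have -> : complex.Re (shear (sg n) (W s0)) = - complex.Im (W s0).
    rewrite /shear /= (_ : complex.Re (W s0) = 0) ?mulr0 ?sub0r //.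
    by apply: expR_inj; rewrite -nm_cexp eW0 ew0' g0 expR0.
  lra.
have noend : ~ (complex.Re (shear (sg n) (W s1)) <= - th).
  move=> fin.
  have cP : pconton s0 s1 (shear (sg n) \o W).
    apply: (pconton_comp (A := setT)) => //.
    by apply: ccont_on => z _; exact: shear_cont.
  have cQ : pconton 0 T (shear (sg n) \o w).
    apply: (pconton_comp (A := setT)) => //.
    by apply: ccont_on => z _; exact: shear_cont.
  have [||s [t [ss tT est]]] := crossing s01 T0 cP cQ start fin ImW psw.
  - by rewrite /= ew0; move: m1 o3; rewrite -/th; lra.
  - have := psw T ltac:(by rewrite lexx T0); rewrite /= ReT -/th.
    have -> : sg n * - (2 * pi / sg n) = - (2 * pi) by field; rewrite gt_eqF.
    lra.
  have eWw := shear_inj sg0 est.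
  have [_ _ Lt] := hp t (in01 t tT).
  apply: (hn0 m (leq_maxl _ _) _ _ Lt); exists s; first by rewrite /= in_itv.
  by rewrite /= -(eW s ss) eWw (ew t tT).
have /andP[e1 e2] := ImW s1 ltac:(by rewrite lexx s01).
have ss1 : s0 <= s1 <= s1 by rewrite lexx s01.
split=> [er|[x /andP[xx0 x00] ex]]; apply: noend.
  have -> : complex.Re (shear (sg n) (W s1)) = - (2 * pi) - complex.Im (W s1); last lra.
  rewrite /shear /= (_ : complex.Re (W s1) = - (2 * pi / sg n)); first by field; rewrite gt_eqF.
  by apply: expR_inj; rewrite -nm_cexp eW // er.
have [eR [j eI]] := cexp_eq (etrans (eW s1 ss1) ex).
move: eR eI; rewrite !cReD !cImD !cReM !cImM /= -/th => eR eI.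
have sx : sg n * x <= 0 by rewrite pmulr_rle0.
(* The lower bound on the imaginary part of [W s1] excludes j <= -1, so this lift of the channel is
   not to the right of -th. *)
have j0 : 0 <= (j%:~R : R).
  rewrite (ler_int R 0) leNgt; apply/negP => jn; have : j%:~R <= -1 :> R by rewrite (ler_int R j (-1)) -ltzD1 addNr.
  nra.
rewrite eR eI; nra.
Qed.

(** The lower bound of [barrier_core] on the modulus is automatic: at the first time on the circle
    of radius [rim n], [barrier_core] applies and gives a contradiction. *)
Lemma barrier n (k : int) (g : R -> C) (s0 s1 : R) : s0 <= s1 -> pconton s0 s1 g ->
  (forall s, s0 <= s <= s1 -> nm (g s) <= 1 /\ ~ K (h n (g s))) -> nm (g s0) = 1 ->
  (forall s r y, s0 <= s <= s1 -> rim n <= r <= 1 -> `|y - gap n * k%:~R| <= 2 * gap n ->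
     g s <> rC r * cexp (im y)) ->
  rim n < nm (g s1) /\ ~ channel n k (g s1).
Proof.
move=> s01 cg gP g0 wall.
have rim1 : rim n <= 1 by rewrite -expR0 ler_expR oppr_le0 divr_ge0 ?mulr_ge0 ?pi_ge0 // ltW ?sg_gt0.
have ge s : s0 <= s <= s1 -> rim n < nm (g s).
  move=> /andP[ss1 ss2]; rewrite ltNge; apply/negP => bad.
  have [|T /andP[T0 T1] [eT hT]] := first_hit ss1 (pconton_sub (lexx s0) ss2 cg) _ bad; first by rewrite g0.
  have T1' := le_trans T1 ss2.
  have [] := @barrier_core n k g s0 T T0 (pconton_sub (lexx s0) T1' cg) _ g0 _ => //.
    move=> u uT; have /andP[u1 u2] := uT; have [] := gP u ltac:(by rewrite u1 (le_trans u2)).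
    by split => //; exact: hT.
  by move=> u r y /andP[u1 u2]; apply: wall; rewrite u1 (le_trans u2).
split; first by apply: ge; rewrite s01 lexx.
have [] := @barrier_core n k g s0 s1 s01 cg _ g0 wall => //.
by move=> s ss; have [h1 h2] := gP s ss; split => //; exact/ltW/ge.
Qed.

Lemma h_open n w : nm w < 1 -> exists2 d : R, 0 < d & forall z, nm (z - h n w) < d -> nm (H n z) < 1 /\ z = h n (H n z).
Proof.
move=> w1.
have sub : bal 1 `<=` bal (lr (S n)) by move=> v v1; exact: lt_trans v1 (lr_gt1 n).
have [|||d d0 hd] := branch_open (inv_d (okS n)) (inv_dc (okS n)) (inv_d0 (okS n)) (h := h n) (r := 1) _ _ _ w1.
- by apply: (cconton_sub sub); exact: h_cont.
- by move=> v /sub /hP [].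
- by move=> v /sub; exact: hM5.
by exists d => // z zw; have [h1 h2] := hd z zw; split.
Qed.

Lemma L_interior n z : L n z -> nm (H n z) < 1 -> exists2 d : R, 0 < d & forall y, nm (y - z) < d -> L n y.
Proof.
move=> [w w1 <-]; have [-> _] := hP1 n w1 => w1'; have [d d0 hd] := h_open n w1'.
by exists d => // y /hd [h1 ->]; exists (H n y) => //; exact: ltW.
Qed.

Lemma avoid_from z : ~ K z -> exists n, forall m, (n <= m)%N -> ~ L m z.
Proof.
move=> nK; have [||n hn] := @cpt_avoid_L [set z]; first exact: compact_set1.
  by move=> _ ->.
by exists n => m nm'; exact: hn.
Qed.

(** The barrier is applied to the reversed path, from the first exit out of [L n], where |H n| = 1,
    back to the start. *)
Lemma tail_barrier n (k : int) (c : R -> C) (u v : R) : u <= v -> pconton u v c ->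
  (forall t, u <= t <= v -> ~ K (c t)) -> L n (c u) -> ~ L n (c v) ->
  (forall t r y, u <= t <= v -> rim n <= r <= 1 -> `|y - gap n * k%:~R| <= 2 * gap n ->
     c t <> h n (rC r * cexp (im y))) ->
  rim n < nm (H n (c u)) /\ ~ channel n k (H n (c u)).
Proof.
move=> uv cc cK Lu nLv wall.
have [T [/andP[T0 T1] hT exit]] := first_exit uv cc (@L_closed n) Lu nLv.
have uT s : u <= s <= T -> u <= s <= v by move=> /andP[-> sT]; exact: le_trans sT T1.
have inL s : u <= s <= T -> nm (H n (c s)) <= 1 /\ h n (H n (c s)) = c s.
  by move=> /hT [w w1 <-]; have [-> _] := hP1 n w1.
have HT1 : nm (H n (c T)) = 1.
  have TT : u <= T <= T by rewrite T0 lexx.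
  have [h1 _] := inL T TT; apply/eqP; rewrite eq_le h1 leNgt; apply/negP => h2.
  have [d d0 hd] := L_interior (hT T TT) h2.
  have [d' d'0 hd'] := cc T ltac:(by rewrite T0) d d0.
  have [s [/andP[s1 s2] s3 nL]] := exit d' d'0; apply: nL; apply: hd; apply: hd'.
    by rewrite s2 (le_trans T0).
  by rewrite ltr_norml; lra.
have cg : pconton u T (H n \o c).
  apply: (pconton_comp (A := setT)) => //; first exact: pconton_sub (lexx u) T1 cc.
  by apply: ccont_on => z _; exact: hasder_ccont (inv_d (okS n) z).
have rev s : - T <= s <= - u -> u <= - s <= T by rewrite lerNr lerNl andbC.
have := @barrier n k (fun t => H n (c (- t))) (- T) (- u) _ (pconton_rev cg).
rewrite !opprK; apply => //; first by rewrite lerN2.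
  by move=> s /rev sT; have [h1 h2] := inL _ sT; rewrite h2; split => //; exact/cK/uT.
by move=> s r y /rev sT rr yy e; apply: (wall (- s) r y (uT _ sT) rr yy); rewrite -e; have [_ ->] := inL _ sT.
Qed.

Lemma tail_barrier_rev n (k : int) (c : R -> C) (u v : R) : u <= v -> pconton u v c ->
  (forall t, u <= t <= v -> ~ K (c t)) -> ~ L n (c u) -> L n (c v) ->
  (forall t r y, u <= t <= v -> rim n <= r <= 1 -> `|y - gap n * k%:~R| <= 2 * gap n ->
     c t <> h n (rC r * cexp (im y))) ->
  rim n < nm (H n (c v)) /\ ~ channel n k (H n (c v)).
Proof.
move=> uv cc cK nLu Lv wall.
have rev s : - v <= s <= - u -> u <= - s <= v by rewrite lerNr lerNl andbC.
have := @tail_barrier n k (fun t => c (- t)) (- v) (- u) _ (pconton_rev cc).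
rewrite !opprK; apply => //; first by rewrite lerN2.
  by move=> s /rev; exact: cK.
by move=> s r y /rev; exact: wall.
Qed.

Lemma near_channel n (y : R) : exists k : int, `|y - gap n * k%:~R| <= gap n.
Proof.
have /andP[v0 _] := gap_gt0 n.
exists (Num.floor (y / gap n)); have h1 := floor_le (y / gap n); have h2 := floorD1_gt (y / gap n).
have : (Num.floor (y / gap n))%:~R * gap n <= y by rewrite -ler_pdivlMr.
have : y < (Num.floor (y / gap n) + 1)%:~R * gap n by rewrite -ltr_pdivrMr.
rewrite intrD mulrDl mul1r mulrC => k1 k2.
by rewrite ger0_norm; lra.
Qed.

Lemma wall_near n (k : int) y0 r y : `|y0 - gap n * k%:~R| <= gap n -> rim n <= r <= 1 ->
  `|y - gap n * k%:~R| <= 2 * gap n -> nm (h n (rC r * cexp (im y)) - h n (cexp (im y0))) <= b n / 4.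
Proof.
move=> h1 h2 h3; apply: (st_wall (stS n)) => //.
have -> : 8 * pi / (q n.+1)%:R = 4 * gap n by rewrite /gap; ring.
have -> : y - y0 = (y - gap n * k%:~R) - (y0 - gap n * k%:~R) by ring.
have /andP[v0 _] := gap_gt0 n.
by apply: le_trans (ler_normB _ _) _; lra.
Qed.

(** * Inaccessibility of the fixed point *)

Lemma far_K : exists2 z, K z & 1 / 3 < nm z.
Proof.
(* The point h_0(1) = 1/2 has a point of [K] within b_0/3 <= 1/12. *)
have [|z Kz] := K_dense 0 (w := 1); first by rewrite nm1.
rewrite S0 /= mulr1 => hz; exists z => //.
have := nm_subr_ge (rC (1 / 2)) z; rewrite nm_rC ger0_norm; lra.
Qed.

(** A point of [L n] of maximal modulus is not interior, so it lies on the image of the unit circle.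
    The channel mouth next to it will be far from 0. *)
Lemma far_boundary n : exists y, 1 / 3 < nm (h n (cexp (im y))).
Proof.
have [|||z [w w1 ew] zmax] := @nm_argmax R (L n).
- exact: L_cpt.
- by exists 0; exact: (K_0 n).
- by move=> z /L_1 z1; rewrite /disc /= ltW.
have zbig : 1 / 3 < nm z by have [y Ky yb] := far_K; exact: lt_le_trans yb (zmax _ (Ky n)).
suff w1' : nm w = 1.
  by have [y ey] := polar w; exists y; rewrite w1' rC1 mul1r in ey; rewrite -ey ew.
apply/eqP; rewrite eq_le [_ <= 1]w1 leNgt; apply/negP => wlt.
have [d d0 hd] := h_open n wlt; rewrite ew in hd.
pose z' := rC (1 + d / 2) * z.
have z1 : nm z < 1 by apply: (@L_1 n); exists w.
have Lz' : L n z'.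
  have [|k1 k2] := hd z'; last by exists (H n z') => //; exact: ltW.
  have -> : z' - z = rC (d / 2) * z by rewrite /z' rCD rC1; ring.
  rewrite nmM nm_rC ger0_norm; nra.
by have := zmax z' Lz'; rewrite /z' nmM nm_rC ger0_norm; nra.
Qed.

Lemma K_inaccessible : ~ accessible K 0.
Proof.
move=> [c [/pcontonP cc [cK c1]]].
have cK' t : 0 <= t < 1 -> ~ K (c t) by move=> t01; apply: cK; rewrite /= in_itv.
(* The sector around a mouth close to a boundary point beyond modulus 1/3 has its image within b_n/4
   <= 1/16 of that point, hence beyond 1/4: the end of the path cannot meet it. *)
have [d d0 hd] := cc 1 ltac:(by rewrite ler01 lexx) (1 / 4) ltac:(lra).
have [t0 [t00 t01 t0d]] : exists t0 : R, [/\ 0 <= t0, t0 < 1 & 1 - d < t0].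
  have [h|h] := leP 0 (1 - d / 2); first by exists (1 - d / 2); split; lra.
  by exists 0; split; lra.
have small t : t0 <= t <= 1 -> nm (c t) < 1 / 4.
  move=> tt; have := hd t ltac:(lra); rewrite c1 subr0; apply.
  by rewrite ltr_norml; lra.
have [n hn] := avoid_from (cK' t0 ltac:(by rewrite t00)).
have nL := hn n (leqnn n).
have [y yb] := far_boundary n; have [k yk] := near_channel n y.
have Hc0 : ccont (H n) 0 := hasder_ccont (inv_d (okS n) 0).
have [d1 d10 h1] := Hc0 _ (rim_gt0 n); rewrite (inv_0 (okS n)) in h1.
have [d2 d20 h2] := h_open n (w := 0) ltac:(by rewrite nm0 ltr01); rewrite h_0 in h2.
have [d3 d30 h3] := cc 1 ltac:(by rewrite ler01 lexx) (Num.min d1 d2) ltac:(by rewrite lt_min d10).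
have [t1 [t11 t12 t13]] : exists t1 : R, [/\ t0 <= t1, t1 < 1 & 1 - d3 < t1].
  have [h|h] := leP t0 (1 - d3 / 2); first by exists (1 - d3 / 2); split; lra.
  by exists t0; split; lra.
have ct1 : nm (c t1) < Num.min d1 d2.
  by have := h3 t1 ltac:(lra); rewrite c1 subr0; apply; rewrite ltr_norml; lra.
move: ct1; rewrite lt_min => /andP[ct1 ct2].
have rimc : nm (H n (c t1)) < rim n by have := h1 (c t1); rewrite !subr0; apply.
have [h4 h5] : nm (H n (c t1)) < 1 /\ c t1 = h n (H n (c t1)) by apply: h2; rewrite subr0.
have [] := @tail_barrier_rev n k c t0 t1 t11 (pconton_sub t00 (ltW t12) cc) _ nL _ _.
- by move=> t tt; apply: cK'; lra.
- by exists (H n (c t1)) => //; exact: ltW.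
- move=> t r y' tt rr yy e; have := wall_near yk rr yy; rewrite -e.
  have := small t ltac:(lra); have := nm_subr_ge (h n (cexp (im y))) (c t); rewrite nmBC.
  have /andP[_ b4] := inv_b (okS n); lra.
- by rewrite ltNge (ltW rimc).
Qed.

(** * Impressions of prime ends *)

Lemma channel_le1 n k z : channel n k z -> nm z <= 1.
Proof. by move=> [x /andP[_ x0'] ->]; rewrite cexpD nmM nm_cexp_im mulr1 nm_cexp /= mul0r subr0 mulr1 -expR0 ler_expR. Qed.

Lemma channel_notK n k z : channel n k z -> ~ K (h n z).
Proof.
move=> cz Kz; have [_ _] := K_in n Kz; apply.
by have [-> _] := hP1 n (channel_le1 cz); exact: channelP cz.
Qed.

Lemma circle_notK n z : nm z = 1 -> ~ K (h n z).
Proof.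
move=> z1 Kz; have [_ h1 _] := K_in n Kz; move: h1.
by have [-> _] := hP1 n (w := z) ltac:(by rewrite z1); rewrite z1 ltxx.
Qed.

Lemma channel_fill n (k : int) z : K z -> exists2 w, channel n k w & nm (h n w - z) <= b n / 4.
Proof.
move=> Kz; have [ez h1 _] := K_in n Kz; have [x xx hx] := st_fill (stS n) k (ltW h1).
exists (cexp (rC x * Complex 1 (sg n) + im (gap n * k%:~R))); first by exists x.
by rewrite {1}ez; move: hx; rewrite /gap (mulrAC (2 * pi)).
Qed.

Lemma h_path n (p : R -> C) (u v : R) : pconton u v p -> (forall t, u <= t <= v -> nm (p t) <= 1) ->
  pconton u v (h n \o p).
Proof.
move=> cp p1; apply: (pconton_comp (A := bal (lr (S n)))) => // [t /p1 h1|].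
  exact: le_lt_trans h1 (lr_gt1 n).
exact: h_cont.
Qed.

Lemma cexp_line (u v : R) (c d : C) : pconton u v (fun t => cexp (rC t * c + d)).
Proof.
apply: (pconton_comp (g := fun t => rC t * c + d) (h := @cexp R) (A := setT)) => //; last first.
  by apply: ccont_on => z _; exact: ccont_cexp.
move=> t _ e e0; exists (e / (nm c + 1)); first by rewrite divr_gt0 // ltr_wpDl ?nm_ge0.
move=> s _; rewrite ltr_pdivlMr ?ltr_wpDl ?nm_ge0 // => st.
have -> : rC s * c + d - (rC t * c + d) = rC (s - t) * c by rewrite rCD rCN; ring.
rewrite nmM nm_rC; have := normr_ge0 (s - t); lra.
Qed.

Lemma bdry_K z : bdry (~` K) z -> K z.
Proof.
move=> [_ nI]; apply: contrapT => nK; apply: nI; apply/nbhsCP.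
by apply: ((openCP (~` K)).1 _ z nK); apply: closed_openC; exact: K_closed.
Qed.

Lemma crosscutP (A : set C) : crosscut (~` K) A -> exists g : R -> C, [/\ pconton 0 1 g, K (g 0), K (g 1),
  forall t, 0 < t < 1 -> A (g t) /\ ~ K (g t) & forall z, A z -> exists2 t, 0 < t < 1 & z = g t].
Proof.
move=> [g [/pcontonP cg [_ [-> [sA [/bdry_K k0 /bdry_K k1]]]]]]; exists g; split => //.
  move=> t t01; have At : (g @` `]0, 1[%classic) (g t) by exists t => //=; rewrite in_itv.
  by split => //; exact: sA.
by move=> z [t /= tt <-]; exists t => //; rewrite in_itv in tt.
Qed.

(** Take [n] with [p] and a point [x1] of C_0 outside [L n]. A crosscut of small diameter ending in
    [K] lies in [L n], so the connected complement of [L n] joins [x1] to points near [p] without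
    meeting it. As the crosscut separates C_0 from its successor, [p] is not in the impression. *)
Lemma impression_sub (Cn : nat -> set C) : null_chain (~` K) Cn -> impression (~` K) Cn `<=` K.
Proof.
move=> [cc disj sep small] p imp; apply: contrapT => nKp.
have [g0 [_ _ _ g0P _]] := crosscutP (cc 0%N).
have [C0x nKx] := g0P (1 / 2) ltac:(lra); set x1 := g0 (1 / 2) in C0x nKx.
have [n1 hn1] := avoid_from nKp; have [n2 hn2] := avoid_from nKx.
pose n := maxn n1 n2; have nLp := hn1 n (leq_maxl _ _); have nLx := hn2 n (leq_maxr _ _).
have [d d0 hd] : exists2 d : R, 0 < d & forall z, K z -> forall y, nm (y - z) < d -> L n y.
  apply: (@cpt_unif R K (fun d z => forall y, nm (y - z) < d -> L n y)); first exact: K_cpt.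
    by move=> d d' x _ dd hx y yx; apply: hx; exact: lt_le_trans yx dd.
  move=> z Kz; have [_ z1 _] := K_in n Kz.
  have [d d0 hd] := L_interior (Kz n) z1.
  exists (d / 2); first by rewrite divr_gt0.
  exists (d / 2); first by rewrite divr_gt0.
  by move=> y _ yz w wy; apply: hd; have := nm_tri w y z; lra.
have [j _ hj] := small (d / 2) ltac:(lra).
have CL : Cn j.+1 `<=` L n.
  have [g [cg Kg0 _ gP _]] := crosscutP (cc j.+1).
  have [e e0 he] := cg 0 ltac:(by rewrite lexx ler01) (d / 2) ltac:(lra).
  have [s [s0 s1 se]] : exists s : R, [/\ 0 < s, s < 1 & s < e].
    have [h|h] := leP 1 (e / 2); first by exists (1 / 2); split; lra.
    by exists (e / 2); split; lra.
  move=> z Cz; apply: (hd _ Kg0); have [Cs _] := gP s ltac:(by rewrite s0).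
  have := hj j.+1 (leqnSn j) z (g s) Cz Cs; rewrite nm_norm_lt => k1.
  have := he s ltac:(lra) ltac:(by rewrite subr0 gtr0_norm); have := nm_tri z (g s) (g 0); lra.
have [e e0 he] := (openCP (~` L n)).1 (closed_openC (@L_closed n)) p nLp.
have [y [x Cx xy] yp] := (closureCP _ _).1 (imp j.+1 I) e e0.
have nLy := he y yp; have [_ [_ noconn]] := sep j.
apply: (noconn x1 x C0x Cx).
apply: (connected_component_trans (y := y)); last exact: connected_component_sym.
apply: (@connected_component_max _ _ (~` L n)) => //; last exact: L_full.
move=> z nLz; split; first by move=> Kz; exact: nLz (Kz n).
by move=> /CL.
Qed.

(** Let [g] be the crosscut C_i and [g'] the next one. The first exit of [g'] from a late [L n] is
    next to a channel mouth whose sector [g] cannot meet, because g'(0) has distance at least [dl]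
    from [g]. By the barrier, C_i misses this channel. Hence the channel is in the component of
    C_(i+1), and it comes within b_n/4 of every point of [K]. *)
Lemma impression_sup (Cn : nat -> set C) : null_chain (~` K) Cn -> K `<=` impression (~` K) Cn.
Proof.
move=> [cc disj _ _] z Kz i _; apply/closureCP => e e0.
have [g [cg Kg0 Kg1 gP gA]] := crosscutP (cc i).
have [g' [cg' Kg'0 _ g'P _]] := crosscutP (cc i.+1).
pose A := g @` `[0, 1].
have cA : compact A := pconton_cpt cg.
have clA : closed A by apply: compact_closed => //; exact: norm_hausdorff.
have AC : A `<=` closure (Cn i).
  move=> _ [t /= tt <-]; rewrite in_itv /= in tt; apply/closureCP => e' e'0.
  have [d d0 hd] := cg t tt e' e'0.
  have [s [s0 s1 st]] : exists s : R, [/\ 0 < s, s < 1 & `|s - t| < d].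
    have [h1|h1] := leP t (1 / 2).
      exists (t + Num.min (1 / 4) (d / 2)); have : 0 < Num.min (1 / 4) (d / 2) by rewrite lt_min !divr_gt0.
      have : Num.min (1 / 4) (d / 2) <= 1 / 4 by rewrite ge_min lexx.
      have : Num.min (1 / 4) (d / 2) <= d / 2 by rewrite ge_min lexx orbT.
      by move=> k1 k2 k3; split; rewrite ?ltr_norml; lra.
    exists (t - Num.min (1 / 4) (d / 2)); have : 0 < Num.min (1 / 4) (d / 2) by rewrite lt_min !divr_gt0.
    have : Num.min (1 / 4) (d / 2) <= 1 / 4 by rewrite ge_min lexx.
    have : Num.min (1 / 4) (d / 2) <= d / 2 by rewrite ge_min lexx orbT.
    by move=> k1 k2 k3; split; rewrite ?ltr_norml; lra.
  by exists (g s); [have [] := gP s ltac:(by rewrite s0)|apply: hd => //; rewrite !ltW].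
have nA : ~ A (g' 0).
  move=> /AC cl; have : (closure (Cn i) `&` closure (Cn i.+1)) (g' 0); last by rewrite disj.
  split => //; apply/closureCP => e' e'0.
  have [d d0 hd] := cg' 0 ltac:(by rewrite lexx ler01) e' e'0.
  have [s [s0 s1 se]] : exists s : R, [/\ 0 < s, s < 1 & s < d].
    have [h|h] := leP 1 (d / 2); first by exists (1 / 2); split; lra.
    by exists (d / 2); split; lra.
  exists (g' s); first by have [] := g'P s ltac:(by rewrite s0).
  by apply: hd; rewrite ?subr0 ?gtr0_norm // !ltW.
have [dl dl0 hdl] := (openCP (~` A)).1 (closed_openC clA) _ nA.
have [d d0 hd] := cg' 0 ltac:(by rewrite lexx ler01) (dl / 2) ltac:(lra).
have [t2 [t20 t21 t2d]] : exists s : R, [/\ 0 < s, s < 1 & s < d].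
  have [h|h] := leP 1 (d / 2); first by exists (1 / 2); split; lra.
  by exists (d / 2); split; lra.
have [_ nKm] := gP (1 / 2) ltac:(lra).
have [_ nKt] := g'P t2 ltac:(by rewrite t20).
have [n1 hn1] := avoid_from nKm; have [n2 hn2] := avoid_from nKt.
have [n3 hn3] := b_cvg (e := Num.min dl e) ltac:(by rewrite lt_min dl0).
pose n := maxn (maxn n1 n2) n3.
have nLm : ~ L n (g (1 / 2)) by apply: hn1; rewrite /n -maxnA leq_maxl.
have nLt : ~ L n (g' t2) by apply: hn2; rewrite /n (maxnC n1) -maxnA leq_maxl.
have /andP[bdl be] : (b n < dl) && (b n < e) by rewrite -lt_min; apply: hn3; exact: leq_maxr.
have bn0 := b_gt0 n.
have cg't : pconton 0 t2 g' := pconton_sub (lexx 0) (ltW t21) cg'.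
have [T [/andP[T0 T1] hT exit]] := first_exit (ltW t20) cg't (@L_closed n) (Kg'0 n) nLt.
have TT : 0 <= T <= T by rewrite T0 lexx.
have [w w1 ew] := hT T TT; have [eHw _] := hP1 n w1; rewrite ew in eHw.
have w1' : nm w = 1.
  apply/eqP; rewrite eq_le [_ <= 1]w1 leNgt; apply/negP => h2.
  have [d' d'0 hd'] := L_interior (hT T TT) ltac:(by rewrite eHw).
  have [d3 d30 hd3] := cg't T ltac:(by rewrite T0) d' d'0.
  have [s [/andP[s1 s2] s3 nL]] := exit d3 d30; apply: nL; apply: hd'; apply: hd3.
    by rewrite s2 (le_trans T0).
  by rewrite ltr_norml; lra.
have T0' : 0 < T.
  rewrite lt_neqAle T0 andbT; apply/eqP => e0T; have [_ k1 _] := K_in n Kg'0.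
  by move: k1; rewrite e0T eHw w1' ltxx.
have [y0 ey0] := polar w; rewrite w1' rC1 mul1r in ey0; rewrite ey0 in ew.
have [CT nKT] := g'P T ltac:(by rewrite T0' (le_lt_trans T1)).
have gT : nm (g' T - g' 0) < dl / 2.
  by apply: hd; rewrite ?subr0 ?gtr0_norm // ?T0 ?(le_trans T1) ?(le_lt_trans T1) // ltW.
have [k yk] := near_channel n y0.
have wall t r y : 0 <= t <= 1 -> rim n <= r <= 1 -> `|y - gap n * k%:~R| <= 2 * gap n ->
    g t <> h n (rC r * cexp (im y)).
  move=> tt rr yy eg; have := wall_near yk rr yy; rewrite -eg ew => k1.
  apply: (hdl (g t)); last by exists t => //=; rewrite in_itv.
  have := nm_tri (g t) (g' T) (g' 0); lra.
have avoid v : channel n k v -> ~ Cn i (h n v).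
  move=> cv /gA [u /andP[u0 u1] eu]; have v1 := channel_le1 cv; have [eH _] := hP1 n v1.
  have Lu : L n (g u) by rewrite -eu; exists v.
  have nK t : 0 < t < 1 -> ~ K (g t) by move=> /gP [].
  have h0 : 0 <= 1 / 2 :> R by lra.
  have h1 : 1 / 2 <= 1 :> R by lra.
  (* A meeting point is joined along [g] to the midpoint, which is outside [L n]; the side on which
     it lies decides whether the path is read forwards or backwards. *)
  have [uh|hu] := leP u (1 / 2).
    have cu := pconton_sub (ltW u0) h1 cg.
    have := @tail_barrier n k g u (1 / 2) uh cu _ Lu nLm _.
    rewrite -eu eH; case.
    - by move=> t /andP[t1 t2']; apply: nK; rewrite (lt_le_trans u0 t1) (le_lt_trans t2') //; lra.
    - by move=> t r y /andP[t1 t2']; apply: wall; rewrite (le_trans (ltW u0) t1) (le_trans t2').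
    - by [].
  have cu := pconton_sub h0 (ltW u1) cg.
  have := @tail_barrier_rev n k g (1 / 2) u (ltW hu) cu _ nLm Lu _.
  rewrite -eu eH; case.
  - by move=> t /andP[t1 t2']; apply: nK; rewrite (le_lt_trans t2' u1) (lt_le_trans _ t1) //; lra.
  - by move=> t r y /andP[t1 t2']; apply: wall; rewrite (le_trans h0 t1) (le_trans t2' (ltW u1)).
  - by [].
have [v cv hv] := channel_fill n k Kz.
exists (h n v); last by apply: le_lt_trans hv _; lra.
exists (g' T) => //; have /andP[v0 _] := gap_gt0 n.
have rim1 : rim n <= 1 by rewrite -expR0 ler_expR oppr_le0 divr_ge0 ?mulr_ge0 ?pi_ge0 // ltW ?sg_gt0.
(* An arc of the unit circle leads from the exit point to the mouth, and from there the channel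
   leads inwards. *)
apply: (connected_component_trans (y := h n (cexp (im (gap n * k%:~R))))).
  pose p t : C := cexp (rC t * im (gap n * k%:~R - y0) + im y0).
  have pE t : p t = cexp (im (y0 + t * (gap n * k%:~R - y0))).
    by congr cexp; apply: complex_ext; rewrite ?cReD ?cImD ?cReM ?cImM /=; ring.
  have := @path_component R (~` K `\` Cn i) (h n \o p) 0 1 _ _ 0 1.
  rewrite /= !pE mul0r addr0 mul1r ew [y0 + _]addrC subrK; apply; rewrite ?lexx ?ler01 //.
    by apply: h_path; [exact: cexp_line|move=> t _; rewrite pE nm_cexp_im].
  move=> t /andP[t0 t1]; rewrite pE; split; first by apply: circle_notK; rewrite nm_cexp_im.
  move=> /gA [u /andP[u0 u1] eu]; have u01 : 0 <= u <= 1 by rewrite !ltW.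
  have rr : rim n <= (1 : R) <= 1 by rewrite rim1 lexx.
  apply: (wall u 1 (y0 + t * (gap n * k%:~R - y0)) u01 rr); last by rewrite rC1 mul1r.
  have -> : y0 + t * (gap n * k%:~R - y0) - gap n * k%:~R = (1 - t) * (y0 - gap n * k%:~R) by ring.
  by rewrite normrM ger0_norm ?subr_ge0 //; have := normr_ge0 (y0 - gap n * k%:~R); nra.
have [x /andP[x1 x2] ev] := cv.
have := @path_component R (~` K `\` Cn i) (h n \o (fun t => cexp (rC t * Complex 1 (sg n) + im (gap n * k%:~R)))) x 0 _ _ 0 x.
rewrite /= rC0 mul0r add0r -ev; apply; rewrite ?lexx ?x2 //.
  apply: h_path; first exact: cexp_line.
  by move=> t /andP[t1 t3]; apply: (@channel_le1 n k); exists t => //; rewrite t3 (le_trans x1).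
move=> t /andP[t1 t3]; have ct : channel n k (cexp (rC t * Complex 1 (sg n) + im (gap n * k%:~R))).
  by exists t => //; rewrite t3 (le_trans x1).
by split; [exact: channel_notK ct|exact: avoid].
Qed.

(** * Non-linearizability *)

Lemma rot_dense (t e : R) : 0 <= t -> 0 < e -> exists j : nat, nm (rot_mult a ^+ j - cexp (im t)) < e.
Proof.
move=> t0 e0; have p0 := pi_gt0 R; pose n := Num.trunc (4 * pi / e).
have [p hp] := inv_a (okS n); have /andP[a1 a2] := alim n; have q0 := q_gt0 n; have q1 := q_gt0 n.+1.
(* The q_n-th power of the rotation turns by 2 pi eta, a positive angle of at most 4 pi/(n+2); its
   multiples approach every [t >= 0] from below. *)
pose eta := (a - al n) * (q n)%:R.
have eta0 : 0 < eta by rewrite mulr_gt0 // subr_gt0.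
have etae : 2 * pi * eta < e.
  have n0 : (0 : R) < n.+2%:R by [].
  have k1 : eta * n.+2%:R <= 2.
    rewrite /eta -mulrA (mulrC (q n)%:R).
    apply: (@le_trans _ _ ((a - al n) * (q n.+1)%:R)); first by rewrite ler_pM2l ?subr_gt0 //; exact: q_step.
    by rewrite -ler_pdivlMr // lerBlDl.
  have k2 : 4 * pi / e < n.+2%:R by apply: lt_le_trans (truncnS_gt _) _; rewrite ler_nat.
  rewrite ltr_pdivrMr // in k2; rewrite -(ltr_pM2r n0).
  have : pi * (eta * n.+2%:R) <= pi * 2 by rewrite ler_pM2l.
  rewrite (mulrC e); lra.
pose i := Num.trunc (t / (2 * pi * eta)).
have pe : 0 < 2 * pi * eta by rewrite mulr_gt0 // mulr_gt0.
have i1 : i%:R * (2 * pi * eta) <= t.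
  by rewrite -ler_pdivlMr //; rewrite truncn_le divr_ge0 // ltW.
have i2 : t < (i%:R + 1) * (2 * pi * eta) by rewrite -ltr_pdivrMr // natr1 truncnS_gt.
exists (q n * i)%N.
have -> : rot_mult a ^+ (q n * i) = cexp (im (2 * pi * eta * i%:R)).
  rewrite rot_multE cexpXn im_mulrn natrM.
  have -> : (q n)%:R * i%:R * (2 * pi * a) = 2 * pi * eta * i%:R + 2 * pi * ((p * i%:Z)%:~R) :> R.
    by rewrite intrM -hp /eta; have -> : (i%:Z)%:~R = i%:R :> R by []; ring.
  by rewrite imD cexpD cexp_im2pi mulr1.
have -> : 2 * pi * eta * i%:R = t + (2 * pi * eta * i%:R - t) by ring.
rewrite imD cexpD -[X in _ - X]mulr1 -mulrBr nmM nm_cexp_im mul1r.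
apply: le_lt_trans (nm_cexp_im_sub1 _) _; rewrite distrC ger0_norm; lra.
Qed.

(** The images of the channels avoid [K] and approach each of its points. *)
Lemma K_nowhere z (e : R) : K z -> 0 < e -> exists2 w, ~ K w & nm (w - z) < e.
Proof.
move=> Kz e0; have [n hn] := b_cvg e0; have [w cw hw] := channel_fill n 0 Kz.
exists (h n w); first exact: channel_notK cw.
by apply: le_lt_trans hw _; have := hn n (leqnn n); have := b_gt0 n; lra.
Qed.

(* The linearizer maps the component of [K] near [0] onto a union of rotation-invariant
   sets; connectedness of [K] makes every small circle meet it, hence be contained in it. *)
Lemma not_linearizable : ~ linearizable F (rot_mult a).
Proof.
move=> [phi [r0 [r00 [hol [inj [phi0 cj]]]]]].
have [e e0 he] := (nbhsCP _ _).1 cj.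
have inB z : nm z < r0 -> ball (0 : C) (rC r0) z by move=> z1; apply/ballCE; rewrite subr0.
pose r5 := Num.min (Num.min (r0 / 2) (e / 2)) (1 / 4).
have [r50 r51 r52 r53] : [/\ 0 < r5, r5 < r0, r5 < e & r5 <= 1 / 4].
  rewrite /r5 !lt_min !gt_min !ge_min lexx !orbT; split => //; last 2 first.
  - by apply/orP; left; apply/orP; left; lra.
  - by apply/orP; left; apply/orP; right; lra.
  by rewrite !divr_gt0.
have cphi z : nm z <= r5 -> ccont phi z by move=> z5; apply/derivable_ccont/hol/inB; lra.
have iphi z w : nm z <= r5 -> nm w <= r5 -> phi z = phi w -> z = w.
  by move=> z5 w5; apply: inj; apply: inB; lra.
have [d d0 hd] := hasder_ccont (F_hasder (z := 0) ltac:(by rewrite nm0)) r50.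
rewrite F_0 in hd; pose r4 := Num.min (d / 2) (r5 / 2).
have [r40 r4d r45] : [/\ 0 < r4, r4 < d & r4 < r5].
  rewrite /r4 lt_min !gt_min !divr_gt0 //; split => //; apply/orP; [left|right]; lra.
have Fr z : nm z <= r4 -> nm (F z) < r5.
  by move=> z4; have := hd z; rewrite !subr0; apply; exact: le_lt_trans r4d.
(* On this annulus the injective [phi] stays away from 0. So |phi| < m traps the points of |z| <= r5
   in |z| < r4, and their orbits with them. *)
have [m m0 hm] : exists2 m : R, 0 < m & forall z, r4 <= nm z <= r5 -> m <= nm (phi z).
  apply: (@cpt_away0 R [set z | r4 <= nm z <= r5] phi).
  - apply: (subclosed_compact _ (@compact_disc R r5)); last by move=> z /= /andP[].
    apply/closedCP => z hz /=; apply/andP; split; rewrite leNgt; apply/negP => zz.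
      have [w /= /andP[w1 w2] wz] := hz (r4 - nm z) ltac:(by rewrite subr_gt0).
      by have := nm_subr_ge w z; lra.
    have [w /= /andP[w1 w2] wz] := hz (nm z - r5) ltac:(by rewrite subr_gt0).
    by have := nm_subr_ge z w; rewrite nmBC; lra.
  - by apply: ccont_on => z /= /andP[_ z5]; exact: cphi.
  - move=> z /= /andP[z4 z5]; apply/eqP => pz0.
    have z00 : z = 0 by apply: iphi; rewrite ?phi0 ?nm0 // ltW.
    by move: z4; rewrite z00 nm0; lra.
have small z : nm z <= r5 -> nm (phi z) < m -> nm z < r4.
  by move=> z5 zm; rewrite ltNge; apply/negP => z4; have := hm z; rewrite z4 z5 => /(_ isT); lra.
(* Otherwise the part of [K] near 0 with |phi| < s is open and closed in [K], hence all of [K],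
   against [far_K]. *)
have circle s : 0 <= s < m -> exists2 z, K z & nm z < r4 /\ nm (phi z) = s.
  move=> /andP[s0 sm]; apply: contrapT => no.
  have sne z : K z -> nm z < r4 -> nm (phi z) <> s by move=> Kz z4 es; apply: no; exists z.
  have s0' : 0 < s.
    by rewrite lt_neqAle s0 andbT; apply/eqP => es; apply: (sne 0 K_0); rewrite ?nm0 // phi0 nm0.
  pose B := K `&` [set z | nm z < r4 /\ nm (phi z) < s].
  have eB : B = K.
    apply: K_conn.
    - by exists 0; split; [exact: K_0|rewrite /= phi0 nm0].
    - exists [set z | nm z < r4 /\ nm (phi z) < s] => //.
      apply/openCP => z [z4 zs]; have [d1 d10 h1] := cphi z ltac:(lra) (s - nm (phi z)) ltac:(by rewrite subr_gt0).
      exists (Num.min d1 (r4 - nm z)); first by rewrite lt_min d10 subr_gt0.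
      move=> w; rewrite lt_min => /andP[w1 w2]; have := h1 w w1; have := nm_subr_ge w z.
      by have := nm_subr_ge (phi w) (phi z) => k1 k2 k3; split; lra.
    - exists [set z | nm z <= r4 /\ nm (phi z) <= s].
        apply/closedCP => z hz.
        have z4 : nm z <= r4.
          rewrite leNgt; apply/negP => zz.
          have [w /= [w1 w2] wz] := hz (nm z - r4) ltac:(by rewrite subr_gt0).
          by have := nm_subr_ge z w; rewrite nmBC; lra.
        split => //; rewrite leNgt; apply/negP => zz.
        have [d1 d10 h1] := cphi z ltac:(lra) (nm (phi z) - s) ltac:(by rewrite subr_gt0).
        have [w /= [w1 w2] wz] := hz d1 d10; have := h1 w wz; rewrite nmBC.
        by have := nm_subr_ge (phi z) (phi w); lra.
      apply/seteqP; split=> z [Kz [z4 zs]]; split => //; split; rewrite ?ltW //.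
        by apply: small; lra.
      rewrite lt_neqAle zs andbT; apply/eqP; apply: sne => //.
      by apply: small; lra.
  have [z Kz zb] := far_K; have : B z by rewrite eB.
  by move=> [_ [z4 _]]; lra.
have orbit z j : K z -> nm z < r4 -> nm (phi z) < m ->
    [/\ K (iter j F z), nm (iter j F z) < r4 & phi (iter j F z) = rot_mult a ^+ j * phi z].
  move=> Kz z4 zm; elim: j => [|j [Kj j4 ej]]; first by rewrite expr0 mul1r.
  have F5 := Fr _ (ltW j4).
  have ep : phi (F (iter j F z)) = rot_mult a * phi (iter j F z) by apply: he; rewrite subr0; lra.
  split=> /=; first by rewrite -F_K; exists (iter j F z).
    by apply: small; [exact: ltW|rewrite ep ej !nmM nmX nm_rot_mult expr1n !mul1r].
  by rewrite ep ej exprS mulrA.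
(* In the coordinate [phi] the orbit of [z1] is dense in the circle through [phi z]. As [K] is
   compact and [phi] injective, [z] must belong to [K]. *)
have full z : nm z < r4 -> nm (phi z) < m -> K z.
  move=> z4 zm; apply: contrapT => nKz.
  have [z1 Kz1 [z14 z1s]] := circle (nm (phi z)) ltac:(by rewrite nm_ge0).
  have [c c0 hc] : exists2 c : R, 0 < c & forall w, (K `&` disc r4) w -> c <= nm (phi w - phi z).
    apply: (@cpt_away0 R (K `&` disc r4) (fun w => phi w - phi z)).
    - apply: (subclosed_compact _ K_cpt); last by move=> w [].
      apply: closedI; [exact: K_closed|apply: compact_closed; [exact: norm_hausdorff|exact: compact_disc]].
    - apply: ccont_on => w [_ w4]; apply: ccontD; last exact: ccont_cst.
      by apply: cphi; rewrite /disc /= in w4; lra.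
    - move=> w [Kw w4]; rewrite subr_eq0; apply/eqP => ew; apply: nKz.
      by rewrite -(iphi w z) //; rewrite /disc /= in w4; lra.
  have [pz0|pzn] := eqVneq (phi z1) 0.
    have := hc z1 (conj Kz1 (ltW z14)); rewrite pz0 sub0r nmN -z1s pz0 nm0; lra.
  have [w ew /andP[w0 _]] := @cexp_surj_win R (phi z / phi z1) 0 ltac:(by rewrite mulf_neq0 ?invr_eq0 // -nm_gt0 -z1s nm_gt0).
  have Rw : complex.Re w = 0 by apply: expR_inj; rewrite -nm_cexp ew nmM nmV -z1s divff ?expR0 // nm_eq0.
  have ewi : cexp (im (complex.Im w)) * phi z1 = phi z.
    rewrite -[RHS](divfK pzn) -ew; congr (cexp _ * _).
    by apply: complex_ext => /=; rewrite ?Rw.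
  have n1 : 0 < nm (phi z1) by rewrite nm_gt0.
  have [j hj] := rot_dense w0 (e := c / nm (phi z1)) ltac:(by rewrite divr_gt0).
  have [Kj j4 ej] := orbit z1 j Kz1 z14 ltac:(by rewrite z1s).
  have := hc _ (conj Kj (ltW j4)); rewrite ej -ewi -mulrBl nmM.
  by move: hj; rewrite ltr_pdivlMr // => h1 h2; lra.
have [d1 d10 h1] := cphi 0 ltac:(by rewrite nm0 ltW) m m0; rewrite phi0 in h1.
have [w nKw wz] := K_nowhere K_0 (e := Num.min r4 d1) ltac:(by rewrite lt_min r40).
apply: nKw; move: wz; rewrite lt_min => /andP[w4 wd]; apply: full; first by rewrite subr0 in w4.
by have := h1 w wd; rewrite subr0.
Qed.

End Limit.

Theorem theorem1p2 (R : realType) :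
  exists (alpha : R) (f : Cplx R -> Cplx R) (U V K : set (Cplx R)),
    [/\ irrational alpha,
        jordan_domain U, U 0, open V & closure U `<=` V] /\
    [/\ holomorphic_on V f, injective_on V f, f 0 = 0,
        is_derive (0 : Cplx R) (1 : Cplx R) f (rot_mult alpha) &
        ~ linearizable f (rot_mult alpha)] /\
    [/\ hedgehog f U V K,
        (forall Cn : nat -> set (Cplx R),
           null_chain (~` K) Cn -> impression (~` K) Cn = K) &
        ~ accessible K 0].
Proof.
have [S [hs [sg [x0 [S0 okst]]]]] := tower R.
have ok n := (okst n).1; have st n := (okst n).2.
have [a alim] := angle_limit ok st.
have [F [dF FP]] := limit_exists ok st.
have KK : K S !=set0 by exists 0; exact: K_0.
have K1 : K S `<=` disc 1 by move=> z /(K_1 ok) /ltW.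
have [zm Kzm zmax] := nm_argmax (K_cpt ok) KK K1.
have [zf Kzf zf3] := far_K S0 ok st.
(* [U] is the disc about 0 whose boundary passes through a farthest point of [K]. *)
pose r := nm zm; have r0 : 0 < r by have := zmax _ Kzf; rewrite /r; lra.
have r1 : r < 1 := K_1 ok Kzm.
have clU : closure (@bal R r) = disc r := bal_closure r0.
exists a, F, (bal r), (bal 3), (K S); split; [split|split; split].
- exact: (a_irrational ok st alim).
- exact: bal_jordan.
- by rewrite /bal /= nm0.
- exact: bal_open.
- by rewrite clU => z; rewrite /disc /bal /= => zr; lra.
- move=> z z3; have [] := hasder_derive (F_hasder ok st FP z3) => //.
- by move=> z w z3 w3; apply: (F_inj S0 ok st FP).
- exact: (F_0 ok st FP).
- have := hasder_derive (F_hasder ok st FP (z := 0) ltac:(by rewrite nm0)).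
  by rewrite (dF_0 ok st alim FP).
- exact: (not_linearizable S0 ok st alim FP).
- split; split.
  + exact: K_cpt.
  + exact: K_conn st.
  + exact: K_full.
  + exact: K_0.
  + by rewrite clU => z /zmax.
  + exists zm; split => //; split; first by rewrite clU /disc /=.
    move=> /nbhsCP [e e0 he].
    have zz : nm (rC (1 + e / 2) * zm - zm) < e.
      have -> : rC (1 + e / 2) * zm - zm = rC (e / 2) * zm by rewrite rCD rC1; ring.
      by rewrite nmM nm_rC gtr0_norm ?divr_gt0 // -/r; nra.
    have := he _ zz; rewrite /bal /= nmM nm_rC gtr0_norm -/r; [nra|lra].
  + exact: (F_K ok st FP).
  + apply/seteqP; split=> [z [z3 Kz]|z Kz].
      move: Kz; rewrite -{1}(F_K ok st FP) => -[x Kx ex].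
      have x3 : nm x < 3 by have := K_1 ok Kx; lra.
      by rewrite -(F_inj S0 ok st FP x3 z3 ex).
    split; first by rewrite /bal /=; have := K_1 ok Kz; lra.
    by rewrite -(F_K ok st FP); exists z.
  + by move=> eK; move: Kzf; rewrite eK => e0; move: zf3; rewrite e0 nm0; lra.
- move=> Cn nc; apply/seteqP; split; first exact: (impression_sub ok st nc).
  exact: (impression_sup ok st nc).
- exact: (K_inaccessible S0 ok st).
Qed.
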